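(* Let $r\ge 2$ and fix a $\mathscr C^r$ expanding map $E:\mathbb{S}^1\to\mathbb{S}^1$ of degree $\ell\ge 2$. For every $\varrho>1$ there is an open dense subset $\mathscr V\subset\mathscr C^r(\mathbb{S}^1)$ (real-valued $\mathscr C^r$ functions with the $\mathscr C^r$ topology) such that $\mathcal N(\tau)<\varrho$ for every $\tau\in\mathscr V$. Consequently, there is a residual subset $\mathscr R\subset\mathscr C^r(\mathbb{S}^1)$ such that $\mathcal N(\tau)=1$ for every $\tau\in\mathscr R$ (i.e. $f_{E,\tau}$ is partially captive for generic $\tau$).
   Context: Let $\mathbb{S}^1=\mathbb{R}/\mathbb{Z}$ and $\mathbb{T}^2=\mathbb{S}^1\times\mathbb{S}^1$. Let $E$ be a $\mathscr C^r$ expanding map of degree $\ell\ge2$ and let $1<\lambda\le\Lambda$ be constants with $\lambda\le E'(x)\le\Lambda$ for all $x\in\mathbb{S}^1$. For $\tau\in\mathscr C^r(\mathbb{S}^1,\mathbb{R})$ let $f=f_{E,\tau}:\mathbb{T}^2\to\mathbb{T}^2$, $f(x,s)=(E(x),\,s+\tau(x)\bmod 1)$, so that $Df(x,s)=\begin{pmatrix}E'(x)&0\\ \tau'(x)&1\end{pmatrix}$. For $R>0$ set $\vartheta_R=R/(\lambda-1)$ and let $\mathscr K_R=\{(\xi,\eta)\in\mathbb{R}^2:|\eta|\le\vartheta_R|\xi|\}$. For $R>\|\tau'\|_\infty$ and $n\ge1$ define $\mathcal N(\tau,R;n)=\sup_{z\in\mathbb{T}^2}\sup_{v}\#\{\zeta\in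 f^{-n}(z): v\in Df^n(\zeta)\mathscr K_R\}$, where $\sup_v$ is over unit vectors $v\in\mathbb{R}^2$. The sequence $n\mapsto\mathcal N(\tau,R;n)$ is submultiplicative, the limit $\mathcal N(\tau)=\lim_{n\to\infty}\mathcal N(\tau,R;n)^{1/n}=\inf_n\mathcal N(\tau,R;n)^{1/n}$ exists and does not depend on the choice of $R>\|\tau'\|_\infty$. $f_{E,\tau}$ is called partially captive if $\mathcal N(\tau)=1$. *)

(* Defs.v *)
From Stdlib Require Import Reals Lra List.
Open Scope R_scope.

Definition DerivSeq (r : nat) (f : R -> R) (d : nat -> R -> R) : Prop :=
  (forall x, d 0%nat x = f x) /\
  (forall (k : nat) (x : R), (k < r)%nat -> derivable_pt_lim (d k) x (d (S k) x)) /\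
  continuity (d r).

Definition Cr (r : nat) (f : R -> R) : Prop := exists d, DerivSeq r f d.

(** Functions on S^1 = R/Z are represented by 1-periodic functions on R. *)
Definition Periodic1 (f : R -> R) : Prop := forall x, f (x + 1) = f x.

Definition CrS1 (r : nat) (tau : R -> R) : Prop := Cr r tau /\ Periodic1 tau.

Definition CircleLift (l : nat) (E : R -> R) : Prop :=
  forall x, E (x + 1) = E x + INR l.

(** sigma lies in the open C^r ball of radius eps around tau:
    max_{k<=r} sup_x |sigma^(k) x - tau^(k) x| < eps
    (sups of continuous periodic functions are attained). *)
Definition CrClose (r : nat) (sigma tau : R -> R) (eps : R) : Prop :=
  exists ds dt, DerivSeq r sigma ds /\ DerivSeq r tau dt /\
    forall (k : nat) (x : R), (k <= r)%nat -> Rabs (ds k x - dt k x) < eps.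

Definition OpenCr (r : nat) (V : (R -> R) -> Prop) : Prop :=
  (forall tau, V tau -> CrS1 r tau) /\
  forall tau, V tau -> exists eps, eps > 0 /\
    forall sigma, CrS1 r sigma -> CrClose r sigma tau eps -> V sigma.

Definition DenseCr (r : nat) (V : (R -> R) -> Prop) : Prop :=
  forall tau eps, CrS1 r tau -> eps > 0 ->
    exists sigma, V sigma /\ CrClose r sigma tau eps.

Definition ResidualCr (r : nat) (S : (R -> R) -> Prop) : Prop :=
  (forall tau, S tau -> CrS1 r tau) /\
  exists U : nat -> ((R -> R) -> Prop),
    (forall n, OpenCr r (U n) /\ DenseCr r (U n)) /\
    (forall tau, CrS1 r tau -> (forall n, U n tau) -> S tau).

(** Points of T^2 are represented by points of R^2 modulo Z^2. *)
Definition eqmod1 (a b : R) : Prop := exists k : Z, a - b = IZR k.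
Definition torus_eq (p q : R * R) : Prop :=
  eqmod1 (fst p) (fst q) /\ eqmod1 (snd p) (snd q).

Definition Flift (E tau : R -> R) (p : R * R) : R * R :=
  (E (fst p), snd p + tau (fst p)).

Fixpoint Fiter (E tau : R -> R) (n : nat) (p : R * R) : R * R :=
  match n with
  | O => p
  | S m => Fiter E tau m (Flift E tau p)
  end.

(** Df^n(zeta) w = Df(f^{n-1} zeta) ... Df(zeta) w, where
    Df(x,s) = [[E'(x), 0], [tau'(x), 1]]. *)
Fixpoint Dfn (E E' Dtau : R -> R) (n : nat) (x : R) (w : R * R) : R * R :=
  match n with
  | O => w
  | S m => Dfn E E' Dtau m (E x) (E' x * fst w, Dtau x * fst w + snd w)
  end.

Definition InCone (lam Rc : R) (w : R * R) : Prop :=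
  Rabs (snd w) <= (Rc / (lam - 1)) * Rabs (fst w).

Definition UnitVec (v : R * R) : Prop := fst v ^ 2 + snd v ^ 2 = 1.

Definition Qualifies (E E' tau Dtau : R -> R) (lam Rc : R) (n : nat)
  (z v zeta : R * R) : Prop :=
  torus_eq (Fiter E tau n zeta) z /\
  exists w, InCone lam Rc w /\ Dfn E E' Dtau n (fst zeta) w = v.

Definition GoodList (E E' tau Dtau : R -> R) (lam Rc : R) (n : nat)
  (z v : R * R) (L : list (R * R)) : Prop :=
  UnitVec v /\
  ForallOrdPairs (fun a b => ~ torus_eq a b) L /\
  Forall (Qualifies E E' tau Dtau lam Rc n z v) L.

(** m = N(tau, R; n) = sup_z sup_v #{zeta in f^{-n}(z) : v in Df^n(zeta) K_R}
    (the sup is over natural numbers bounded by l^n, hence a maximum). *)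
Definition IsNcount (E E' tau Dtau : R -> R) (lam Rc : R) (n m : nat) : Prop :=
  (exists z v L, GoodList E E' tau Dtau lam Rc n z v L /\ length L = m) /\
  (forall z v L, GoodList E E' tau Dtau lam Rc n z v L -> (length L <= m)%nat).

(** N(tau) = L: for every R > ||tau'||_inf, N(tau,R;n)^{1/n} -> L as n -> oo
    (sequence indexed from n = 1). *)
Definition NLimit (E E' tau : R -> R) (lam : R) (Lim : R) : Prop :=
  forall Dtau : R -> R, (forall x, derivable_pt_lim tau x (Dtau x)) ->
  forall Rc : R, (forall x, Rabs (Dtau x) < Rc) ->
  exists a : nat -> nat,
    (forall n, IsNcount E E' tau Dtau lam Rc (S n) (a n)) /\
    Un_cv (fun n => Rpower (INR (a n)) (/ INR (S n))) Lim.

(* Main.v *)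
Require Import Defs.
From Stdlib Require Import Reals Lra Lia List Arith ZArith Classical ClassicalEpsilon.
From Stdlib Require Import FinFun Permutation FunctionalExtensionality.
Import ListNotations.
Open Scope R_scope.

(** The vectors of slope [t] over [x] that lie in the image cones of [f^n] are counted along
    the [l^n] inverse branches of [E^n]: the branch [u] is counted when the slope pulled back
    along it has modulus at most [theta_R]. This count is submultiplicative in [n], so its
    exponential rate is at most its [n]-th root for every single [n], and [N(tau) < rho] as
    soon as the count is below [rho^n] for one [n]; the latter is an open condition on [tau].

    For density, [tau] is perturbed by [sum_i c_i psi_i], where [psi_i'] is a narrow
    trigonometric bump and [c] runs over a finite grid, and bad [c] are counted by a moment
    method. Take [D] branches such that none of them comes close, at small depth, to the
    [nu]-th point of another one. The bumps at these [D] points move the [D] pulled back slopes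
    through a diagonally dominant matrix, so the proportion of [c] for which all [D] slopes are
    hit is at most [prod_j C / (E^n)'(y_j)]. By bounded distortion
    [sum_y 1 / (E^n)'(y)] is bounded, so the mean number of such [D]-tuples is bounded
    independently of [n]. If a point carried more than about [q^n] branches (with [1 < q],
    [q^2 = rho]), it would carry about [q^(n D)] such tuples; since [(x, t)] can be
    discretized with [B^(2n)] points, [q^D > 2 B^2] makes bad parameters rare. *)

(** * Finite sums and products *)

(** A bump also moves every branch that returns to its support, so the pulled back slopes cannot be
    moved independently along their whole length. Noninterference is therefore asked only along the
    first [nu + Q] points, a depth independent of [n]; the bumps keep a fixed width and number while
    [n] grows. Visits after that depth have total weight of order [lam ^ (- Q)] and fit into the
    diagonal dominance. A branch may still revisit its own bump; since a bump is nonnegative up to a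
    small constant, this hardly lowers the diagonal entry.

    A first moment would lose against the union over the [B^(2n)] grid points, whereas the [D]-th
    moment gains [q^(n D)]. The spare factor [2^n] makes the bounds summable over the scales
    [n0 + i N], so one parameter serves for all of them. Slow growth then follows by blocks of
    length [N]: few blocks have many continuations, and the others contribute little. The proportion
    of bad parameters does not depend on the mesh of the parameter grid, which can thus be fixed
    last, fine enough for the largest scale. *)

Definition dec (P : Prop) : bool := if excluded_middle_informative P then true else false.

Lemma dec_true (P : Prop) : dec P = true <-> P.
Proof. unfold dec; destruct (excluded_middle_informative P); split; intro; easy. Qed.

Lemma dec_false (P : Prop) : dec P = false <-> ~ P.
Proof. unfold dec; destruct (excluded_middle_informative P); split; intro; easy. Qed.

Definition count {A} (P : A -> Prop) (L : list A) : nat :=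
  length (filter (fun a => dec (P a)) L).

Definition indic (P : Prop) : R := if dec P then 1 else 0.

Lemma indic_1 (P : Prop) : P -> indic P = 1.
Proof. intro H; unfold indic; apply dec_true in H; now rewrite H. Qed.

Lemma indic_0 (P : Prop) : ~ P -> indic P = 0.
Proof. intro H; unfold indic; apply dec_false in H; now rewrite H. Qed.

Lemma indic_range (P : Prop) : 0 <= indic P <= 1.
Proof. unfold indic; destruct (dec P); lra. Qed.

Lemma indic_le (P Q : Prop) : (P -> Q) -> indic P <= indic Q.
Proof.
  intro H; destruct (classic P) as [p|p].
  - rewrite (indic_1 P p), (indic_1 Q (H p)); lra.
  - rewrite (indic_0 P p); apply indic_range.
Qed.

Fixpoint sumR {A} (f : A -> R) (L : list A) : R :=
  match L with
  | [] => 0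
  | a :: L' => f a + sumR f L'
  end.

Lemma sumR_app {A} (f : A -> R) L L' : sumR f (L ++ L') = sumR f L + sumR f L'.
Proof. induction L; simpl; lra. Qed.

Lemma sumR_map {A B} (h : A -> B) (f : B -> R) L :
  sumR f (map h L) = sumR (fun a => f (h a)) L.
Proof. induction L; simpl; congruence. Qed.

Lemma sumR_flat_map {A B} (h : A -> list B) (f : B -> R) L :
  sumR f (flat_map h L) = sumR (fun a => sumR f (h a)) L.
Proof. induction L; simpl; rewrite ?sumR_app; congruence. Qed.

Lemma sumR_ext {A} (f f' : A -> R) L :
  (forall a, In a L -> f a = f' a) -> sumR f L = sumR f' L.
Proof.
  induction L as [|a L IH]; simpl; intros H; [easy|].
  rewrite (H a), IH; auto.
Qed.

Lemma sumR_le {A} (f f' : A -> R) L :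
  (forall a, In a L -> f a <= f' a) -> sumR f L <= sumR f' L.
Proof.
  induction L as [|a L IH]; simpl; intros H; [lra|].
  apply Rplus_le_compat; auto.
Qed.

Lemma sumR_ge0 {A} (f : A -> R) L : (forall a, In a L -> 0 <= f a) -> 0 <= sumR f L.
Proof.
  induction L as [|a L IH]; simpl; intros H; [lra|].
  apply Rplus_le_le_0_compat; auto.
Qed.

Lemma sumR_plus {A} (f f' : A -> R) L :
  sumR (fun a => f a + f' a) L = sumR f L + sumR f' L.
Proof. induction L; simpl; lra. Qed.

Lemma sumR_scal {A} (c : R) (f : A -> R) L :
  sumR (fun a => c * f a) L = c * sumR f L.
Proof. induction L; simpl; lra. Qed.

Lemma sumR_const {A} (c : R) (L : list A) : sumR (fun _ => c) L = INR (length L) * c.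
Proof.
  induction L as [|a L IH]; simpl sumR; [simpl; lra|].
  simpl length; rewrite S_INR, IH; lra.
Qed.

Lemma sumR_exchange {A B} (f : A -> B -> R) L L' :
  sumR (fun a => sumR (f a) L') L = sumR (fun b => sumR (fun a => f a b) L) L'.
Proof.
  induction L as [|a L IH]; simpl.
  - induction L'; simpl; lra.
  - rewrite IH, <- sumR_plus; easy.
Qed.

Lemma sumR_member {A} (f : A -> R) L a :
  (forall b, In b L -> 0 <= f b) -> In a L -> f a <= sumR f L.
Proof.
  induction L as [|b L IH]; simpl; intros H Ha; [easy|].
  destruct Ha as [<-|Ha].
  - assert (0 <= sumR f L) by (apply sumR_ge0; auto); lra.
  - assert (f a <= sumR f L) by (apply IH; auto).
    assert (0 <= f b) by auto; lra.
Qed.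

Lemma Rabs_sumR {A} (f : A -> R) L : Rabs (sumR f L) <= sumR (fun a => Rabs (f a)) L.
Proof.
  induction L as [|a L IH]; simpl; [rewrite Rabs_R0; lra|].
  eapply Rle_trans; [apply Rabs_triang|]; lra.
Qed.

Lemma count_sumR {A} (P : A -> Prop) L : INR (count P L) = sumR (fun a => indic (P a)) L.
Proof.
  unfold count; induction L as [|a L IH]; simpl; [easy|].
  unfold indic at 1; destruct (dec (P a)).
  - simpl length; rewrite S_INR, IH; lra.
  - rewrite IH; lra.
Qed.

Lemma count_le_length {A} (P : A -> Prop) L : (count P L <= length L)%nat.
Proof. apply filter_length_le. Qed.

Lemma count_le {A} (P Q : A -> Prop) L :
  (forall a, In a L -> P a -> Q a) -> (count P L <= count Q L)%nat.
Proof.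
  intro H; apply INR_le; rewrite !count_sumR; apply sumR_le.
  intros a Ha; apply indic_le; auto.
Qed.

Lemma count_pos {A} (P : A -> Prop) L : (0 < count P L)%nat -> exists a, In a L /\ P a.
Proof.
  unfold count; destruct (filter _ L) as [|a F] eqn:EF; simpl; [lia|].
  intros _; exists a.
  assert (Ha : In a (filter (fun a => dec (P a)) L)) by (rewrite EF; now left).
  apply filter_In in Ha; rewrite dec_true in Ha; exact Ha.
Qed.

Lemma count_In_pos {A} (P : A -> Prop) L a : In a L -> P a -> (0 < count P L)%nat.
Proof.
  intros Ha Pa; unfold count.
  assert (H : In a (filter (fun a => dec (P a)) L))
    by (apply filter_In; split; [easy|now apply dec_true]).
  destruct (filter _ L); simpl in *; [easy|lia].
Qed.

(** * Cartesian products of lists and finite products of reals *)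

Fixpoint lprod {A} (Ls : list (list A)) : list (list A) :=
  match Ls with
  | [] => [[]]
  | L :: Ls' => flat_map (fun a => map (cons a) (lprod Ls')) L
  end.

Lemma In_lprod {A} (Ls : list (list A)) u : In u (lprod Ls) <-> Forall2 (@In A) u Ls.
Proof.
  revert u; induction Ls as [|L Ls IH]; simpl; intro u.
  - split; [intros [<-|[]]; constructor | intro H; inversion H; now left].
  - rewrite in_flat_map; split.
    + intros (a & Ha & Hu); apply in_map_iff in Hu as (v & <- & Hv).
      constructor; [easy|now apply IH].
    + intro H; inversion H as [|a L0 v Ls0 Ha Hv]; subst.
      exists a; split; [easy|apply in_map, IH, Hv].
Qed.

Lemma NoDup_flat_map {A B} (f : A -> list B) L :
  NoDup L -> (forall a, In a L -> NoDup (f a)) ->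
  (forall a b y, In a L -> In b L -> In y (f a) -> In y (f b) -> a = b) ->
  NoDup (flat_map f L).
Proof.
  induction L as [|a L IH]; simpl; intros HL Hf Hd; [constructor|].
  inversion HL as [|? ? Ha HL']; subst.
  apply NoDup_app; [auto | apply IH; eauto |].
  intros y Hy Hy'; apply in_flat_map in Hy' as (b & Hb & Hyb).
  apply Ha; rewrite (Hd a b y); auto.
Qed.

Lemma NoDup_lprod {A} (Ls : list (list A)) : Forall (@NoDup A) Ls -> NoDup (lprod Ls).
Proof.
  induction Ls as [|L Ls IH]; simpl; intro H.
  - constructor; [easy|constructor].
  - inversion H as [|? ? HL HLs]; subst; apply NoDup_flat_map; [easy| |].
    + intros a _; apply Injective_map_NoDup; [|auto].
      intros u v E; now injection E.
    + intros a b y _ _ Ha Hb.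
      apply in_map_iff in Ha as (u & <- & _); apply in_map_iff in Hb as (v & E & _).
      now injection E.
Qed.

Lemma length_lprod_repeat {A} (L : list A) n : length (lprod (repeat L n)) = (length L ^ n)%nat.
Proof.
  induction n as [|n IH]; simpl; [easy|].
  rewrite (flat_map_constant_length (c := (length L ^ n)%nat)); [lia|].
  intros a _; now rewrite length_map.
Qed.

Fixpoint prodn (n : nat) (f : nat -> R) : R :=
  match n with
  | O => 1
  | S m => f O * prodn m (fun j => f (S j))
  end.

Lemma prodn_ge0 n f : (forall j, (j < n)%nat -> 0 <= f j) -> 0 <= prodn n f.
Proof.
  revert f; induction n as [|n IH]; simpl; intros f H; [lra|].
  apply Rmult_le_pos; [apply H; lia|apply IH; intros; apply H; lia].
Qed.

Lemma prodn_le n f f' :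
  (forall j, (j < n)%nat -> 0 <= f j <= f' j) -> prodn n f <= prodn n f'.
Proof.
  revert f f'; induction n as [|n IH]; simpl; intros f f' H; [lra|].
  apply Rmult_le_compat; try (apply H; lia).
  - apply prodn_ge0; intros; apply H; lia.
  - apply IH; intros; apply H; lia.
Qed.

Lemma prodn_const n c : prodn n (fun _ => c) = c ^ n.
Proof. induction n as [|n IH]; simpl; congruence. Qed.

Lemma prodn_indic n (P : nat -> Prop) :
  prodn n (fun j => indic (P j)) = indic (forall j, (j < n)%nat -> P j).
Proof.
  revert P; induction n as [|n IH]; intro P; simpl.
  - rewrite indic_1; [easy|lia].
  - rewrite IH; destruct (classic (P O)) as [H0|H0].
    + rewrite (indic_1 (P O)) by easy; rewrite Rmult_1_l.
      apply Rle_antisym; apply indic_le; intros H j Hj.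
      * destruct j; [easy|apply H; lia].
      * apply H; lia.
    + rewrite (indic_0 (P O)) by easy.
      rewrite (indic_0 (forall j, (j < S n)%nat -> P j)) by (intro H; apply H0, H; lia); lra.
Qed.

(** Distributivity. It turns a product of [D] branch counts into a count of [D]-tuples of branches,
    and a sum over tuples of products of inverse derivatives back into a product of sums. *)
Lemma sumR_lprod {A} (d : A) (L : list A) n (f : nat -> A -> R) :
  sumR (fun u => prodn n (fun j => f j (nth j u d))) (lprod (repeat L n))
  = prodn n (fun j => sumR (f j) L).
Proof.
  revert f; induction n as [|n IH]; intro f; simpl; [lra|].
  rewrite sumR_flat_map, Rmult_comm.
  rewrite <- (IH (fun j => f (S j))), <- sumR_scal.
  apply sumR_ext; intros a _.
  rewrite sumR_map; simpl; rewrite sumR_scal; ring.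
Qed.

Lemma length_lprod_seq (K : nat -> nat) n :
  INR (length (lprod (map (fun j => seq 0 (K j)) (seq 0 n)))) = prodn n (fun j => INR (K j)).
Proof.
  revert K; induction n as [|n IH]; intro K; [simpl; easy|].
  simpl; rewrite <- seq_shift, map_map.
  rewrite (flat_map_constant_length
             (c := length (lprod (map (fun j => seq 0 (K (S j))) (seq 0 n))))).
  - rewrite mult_INR, (IH (fun j => K (S j))), length_seq; ring.
  - intros a _; now rewrite length_map.
Qed.

(* Some vertex has out-degree at most the average in-degree; keep it and discard its
   neighbours on both sides. *)
Lemma independent_set {A} (Rl : A -> A -> Prop) d D : forall L : list A,
  NoDup L ->
  (forall b, In b L -> (count (fun a => Rl a b) L <= d)%nat) ->
  ((2 * d + 1) * D <= length L)%nat ->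
  exists L', length L' = D /\ NoDup L' /\ incl L' L /\
    forall a b, In a L' -> In b L' -> a <> b -> ~ Rl a b.
Proof.
  induction D as [|D IH]; intros L HL Hin Hlen.
  - exists []; repeat split; [constructor|easy|easy].
  - assert (Hlow : exists a, In a L /\ (count (Rl a) L <= d)%nat).
    { apply NNPP; intro Hno.
      assert (Hsum : sumR (fun a => INR (count (Rl a) L)) L
                     <= INR (length L) * INR d).
      { rewrite (sumR_ext _ (fun a => sumR (fun b => indic (Rl a b)) L))
          by (intros; apply count_sumR).
        rewrite sumR_exchange, <- sumR_const.
        apply sumR_le; intros b Hb; rewrite <- (count_sumR (fun a => Rl a b)).
        apply le_INR, Hin, Hb. }
      assert (Hsum' : INR (length L) * (INR d + 1)
                      <= sumR (fun a => INR (count (Rl a) L)) L).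
      { rewrite <- sumR_const; apply sumR_le; intros a Ha.
        rewrite <- S_INR; apply le_INR.
        apply not_gt; intro; apply Hno; exists a; split; [easy|lia]. }
      assert (0 < INR (length L)) by (apply lt_0_INR; nia).
      nra. }
    destruct Hlow as (a & Ha & Hout).
    set (keep := fun x => x <> a /\ ~ Rl a x /\ ~ Rl x a).
    set (L1 := filter (fun x => dec (keep x)) L).
    assert (HL1 : (length L <= 1 + 2 * d + length L1)%nat).
    { change (length L1) with (count keep L).
      apply INR_le; rewrite !plus_INR, mult_INR, !count_sumR.
      assert (H1 : sumR (fun x => indic (x = a)) L <= 1).
      { clear - HL; induction L as [|b L IH]; simpl; [lra|].
        inversion HL; subst; destruct (classic (b = a)) as [->|Hb].
        - rewrite (indic_1 (a = a)) by easy.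
          rewrite (sumR_ext _ (fun _ => 0)), sumR_const; [lra|].
          intros c Hc; apply indic_0; congruence.
        - rewrite (indic_0 (b = a)) by easy; specialize (IH ltac:(easy)); lra. }
      assert (H2 : sumR (fun x => indic (Rl a x)) L <= INR d)
        by (rewrite <- count_sumR; apply le_INR, Hout).
      assert (H3 : sumR (fun x => indic (Rl x a)) L <= INR d)
        by (rewrite <- (count_sumR (fun x => Rl x a)); apply le_INR, Hin, Ha).
      assert (H4 : INR (length L) <= sumR (fun x => indic (x = a) + indic (Rl a x)
                    + indic (Rl x a) + indic (keep x)) L).
      { replace (INR (length L)) with (sumR (fun _ => 1) L) by (rewrite sumR_const; lra).
        apply sumR_le; intros x _.
        pose proof (indic_range (x = a)); pose proof (indic_range (Rl a x)).
        pose proof (indic_range (Rl x a)); pose proof (indic_range (keep x)).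
        destruct (classic (x = a)); [rewrite (indic_1 (x = a)) by easy; lra|].
        destruct (classic (Rl a x)); [rewrite (indic_1 (Rl a x)) by easy; lra|].
        destruct (classic (Rl x a)); [rewrite (indic_1 (Rl x a)) by easy; lra|].
        rewrite (indic_1 (keep x)) by easy; lra. }
      rewrite !sumR_plus in H4; simpl INR; lra. }
    assert (Hincl : incl L1 L) by (intros x Hx; apply filter_In in Hx; easy).
    destruct (IH L1) as (L' & Hlen' & HND & Hinc & Hind).
    + now apply NoDup_filter.
    + intros b Hb; eapply Nat.le_trans; [|apply Hin, Hincl, Hb].
      apply INR_le; rewrite !count_sumR; unfold L1; clear.
      induction L as [|x L IH]; simpl; [lra|].
      pose proof (indic_range (Rl x b)).
      destruct (dec (keep x)); simpl; lra.
    + nia.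
    + assert (Hk : forall x, In x L' -> keep x).
      { intros x Hx; apply Hinc, filter_In in Hx; now apply dec_true. }
      exists (a :: L'); repeat split.
      * simpl; lia.
      * constructor; [|easy]; intro H; now apply Hk in H as [].
      * intros x [<-|Hx]; auto.
      * intros x y [<-|Hx] [<-|Hy] Hne; [easy| | |auto].
        -- now apply Hk in Hy as (_ & ? & _).
        -- now apply Hk in Hx as (_ & _ & ?).
Qed.

(** Bernoulli's inequality for [sqrt q], once squared, gives quadratic growth of [q ^ n], which
    beats every linear function. *)
Lemma linear_lt_pow (q A B : R) : 1 < q ->
  exists N, forall n, (N <= n)%nat -> A + B * INR n < q ^ n.
Proof.
  intro Hq.
  set (s := sqrt q).
  assert (Hs : 1 < s) by (unfold s; rewrite <- sqrt_1; apply sqrt_lt_1; lra).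
  assert (Hss : s * s = q) by (apply sqrt_sqrt; lra).
  assert (Hb : forall n, 1 + INR n * (s - 1) <= s ^ n).
  { intro n; replace s with (1 + (s - 1)) at 2 by ring; apply poly; lra. }
  destruct (INR_unbounded ((Rabs A + Rabs B + 1) / ((s - 1) * (s - 1)) + 1)) as [N HN].
  exists N; intros n Hn.
  replace (q ^ n) with (s ^ n * s ^ n) by (rewrite <- Hss, Rpow_mult_distr; easy).
  apply le_INR in Hn; specialize (Hb n).
  set (d := s - 1) in *; assert (Hd : 0 < d) by (unfold d; lra).
  assert (Hn1 : (Rabs A + Rabs B + 1) / (d * d) <= INR n - 1) by lra.
  assert (Hn0 : Rabs A + Rabs B + 1 <= (INR n - 1) * (d * d)).
  { apply Rmult_le_compat_r with (r := d * d) in Hn1; [|nra].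
    replace ((Rabs A + Rabs B + 1) / (d * d) * (d * d)) with (Rabs A + Rabs B + 1) in Hn1
      by (field; lra); easy. }
  pose proof (Rle_abs A); pose proof (Rle_abs B).
  pose proof (Rabs_pos A); pose proof (Rabs_pos B).
  assert (Hn2 : 1 <= INR n) by nra.
  assert (H3 : (INR n * d) * (INR n * d) <= s ^ n * s ^ n).
  { apply Rmult_le_compat; nra. }
  assert (H4 : A + B * INR n <= (Rabs A + Rabs B) * INR n) by nra.
  assert (H5 : (Rabs A + Rabs B + 1) * INR n <= ((INR n - 1) * (d * d)) * INR n) by nra.
  nra.
Qed.

(** * Counting parameters *)

Definition nfloor (x : R) : nat := Z.to_nat (Int_part x).

Lemma nfloor_spec (x : R) : 0 <= x -> INR (nfloor x) <= x < INR (nfloor x) + 1.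
Proof.
  intro Hx; unfold nfloor; destruct (base_Int_part x) as [H1 H2].
  assert (Hz : (0 <= Int_part x)%Z).
  { assert (-1 < Int_part x)%Z by (apply lt_IZR; simpl; lra); lia. }
  rewrite INR_IZR_INZ, Z2Nat.id by easy; lra.
Qed.

Lemma sumR_perm {A} (f : A -> R) L L' : Permutation L L' -> sumR f L = sumR f L'.
Proof. induction 1; simpl; lra. Qed.

Lemma sumR_support {A} (f : A -> R) L I :
  NoDup L -> NoDup I -> incl I L -> (forall a, In a L -> ~ In a I -> f a = 0) ->
  sumR f L = sumR f I.
Proof.
  intros HL HI Hinc H0.
  rewrite (sumR_perm f L (I ++ filter (fun a => dec (~ In a I)) L)).
  - rewrite sumR_app, (sumR_ext f (fun _ => 0) (filter _ L)), sumR_const; [lra|].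
    intros a Ha; apply filter_In in Ha as [Ha Hd]; apply H0; [easy|now apply dec_true].
  - apply NoDup_Permutation; [easy| |].
    + apply NoDup_app; [easy|now apply NoDup_filter|].
      intros a Ha Hf; apply filter_In in Hf as [_ Hd]; now apply (dec_true (~ In a I)) in Hd.
    + intro a; rewrite in_app_iff, filter_In, dec_true.
      split; [intro; destruct (classic (In a I)); tauto | intros [?|?]; [auto|tauto]].
Qed.

Lemma finite_argmax (w : nat -> R) D :
  (0 < D)%nat -> exists j, (j < D)%nat /\ forall k, (k < D)%nat -> w k <= w j.
Proof.
  intro HD; destruct D as [|D]; [lia|clear HD].
  induction D as [|D (j & Hj & Hm)].
  - exists O; split; [lia|]; intros k Hk; replace k with O by lia; lra.
  - destruct (Rle_dec (w (S D)) (w j)) as [H|H].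
    + exists j; split; [lia|]; intros k Hk.
      destruct (Nat.eq_dec k (S D)) as [->|]; [easy|apply Hm; lia].
    + exists (S D); split; [lia|]; intros k Hk.
      destruct (Nat.eq_dec k (S D)) as [->|]; [lra|].
      assert (w k <= w j) by (apply Hm; lia); lra.
Qed.

(** Look at the row where [d] has its largest modulus: the diagonal contributes at least [3/8] of
    it, and the fewer than [D] other terms together at most [1/8]. *)
Lemma diagonally_dominant_lower_bound D (M : nat -> nat -> R) (d : nat -> R) :
  (0 < D)%nat ->
  (forall j, (j < D)%nat -> 3 / 8 <= M j j) ->
  (forall j i, (j < D)%nat -> (i < D)%nat -> i <> j -> INR D * Rabs (M j i) <= 1 / 8) ->
  exists j, (j < D)%nat /\ (forall k, (k < D)%nat -> Rabs (d k) <= Rabs (d j)) /\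
    1 / 4 * Rabs (d j) <= Rabs (sumR (fun i => d i * M j i) (seq 0 D)).
Proof.
  intros HD Hdiag Hoff.
  destruct (finite_argmax (fun j => Rabs (d j)) D HD) as (j & Hj & Hmax).
  exists j; split; [easy|]; split; [easy|].
  assert (HDpos : 0 < INR D) by (apply lt_0_INR; lia).
  assert (Hin : In j (seq 0 D)) by (apply in_seq; lia).
  apply in_split in Hin as (l1 & l2 & Hl).
  pose proof (seq_NoDup D 0) as HND; rewrite Hl in HND.
  apply NoDup_remove_2 in HND.
  assert (Hrest : forall l, incl l (seq 0 D) -> ~ In j l ->
      Rabs (sumR (fun i => d i * M j i) l) <= INR (length l) * (Rabs (d j) * (1 / 8 / INR D))).
  { intros l Hinc Hnj; eapply Rle_trans; [apply Rabs_sumR|].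
    rewrite <- sumR_const; apply sumR_le; intros i Hi.
    assert (HiD : (i < D)%nat) by (apply Hinc, in_seq in Hi; lia).
    rewrite Rabs_mult; apply Rmult_le_compat; try apply Rabs_pos; [auto|].
    apply Rmult_le_reg_l with (INR D); [easy|].
    replace (INR D * (1 / 8 / INR D)) with (1 / 8) by (field; lra).
    apply Hoff; [easy|easy|congruence]. }
  assert (Hlen : (length l1 + length l2 + 1 = D)%nat).
  { rewrite <- (length_seq D 0), Hl, length_app; simpl; lia. }
  apply (f_equal INR) in Hlen; rewrite !plus_INR in Hlen; simpl in Hlen.
  assert (H1 := Hrest l1); assert (H2 := Hrest l2).
  specialize (H1 ltac:(rewrite Hl; intros x Hx; apply in_app_iff; tauto)
                 ltac:(intro; apply HND, in_app_iff; tauto)).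
  specialize (H2 ltac:(rewrite Hl; intros x Hx; apply in_app_iff; simpl; tauto)
                 ltac:(intro; apply HND, in_app_iff; tauto)).
  rewrite Hl, sumR_app; simpl.
  set (s1 := sumR _ l1) in *; set (s2 := sumR _ l2) in *.
  assert (Hd : 3 / 8 * Rabs (d j) <= Rabs (d j * M j j)).
  { rewrite Rabs_mult; pose proof (Rabs_pos (d j)); pose proof (Rle_abs (M j j)).
    specialize (Hdiag j Hj); nra. }
  assert (Htot : (INR (length l1) + INR (length l2)) * (Rabs (d j) * (1 / 8 / INR D))
                 <= Rabs (d j) * (1 / 8)).
  { replace (INR (length l1) + INR (length l2)) with (INR D - 1) by lra.
    replace ((INR D - 1) * (Rabs (d j) * (1 / 8 / INR D)))
      with (Rabs (d j) * (1 / 8) - Rabs (d j) * (1 / 8) * / INR D) by (field; lra).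
    assert (0 <= Rabs (d j) * (1 / 8) * / INR D).
    { apply Rmult_le_pos; [pose proof (Rabs_pos (d j)); lra|].
      left; now apply Rinv_0_lt_compat. }
    lra. }
  assert (Hfin : Rabs (d j * M j j) <= Rabs (s1 + (d j * M j j + s2)) + (Rabs s1 + Rabs s2)).
  { replace (d j * M j j) with ((s1 + (d j * M j j + s2)) + (- s1 + - s2)) at 1 by ring.
    eapply Rle_trans; [apply Rabs_triang|]; apply Rplus_le_compat_l.
    eapply Rle_trans; [apply Rabs_triang|]; rewrite !Rabs_Ropp; lra. }
  lra.
Qed.

(** * The finite grid of parameters *)

Definition params (H G : nat) : list (list nat) := lprod (repeat (seq 0 H) G).

Lemma In_params H G c :
  In c (params H G) <-> length c = G /\ forall i, (i < G)%nat -> (nth i c 0 < H)%nat.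
Proof.
  unfold params; rewrite In_lprod; revert c; induction G as [|G IH]; intro c; simpl.
  - split; [intro F; inversion F; split; [easy|lia]|].
    intros [L _]; destruct c; [constructor|easy].
  - split.
    + intro F; inversion F as [|a L u Ls Ha Hu]; subst; apply IH in Hu as [Hl Hn].
      split; [simpl; lia|]; intros [|i] Hi; simpl; [apply in_seq in Ha; lia|apply Hn; lia].
    + intros [Hl Hn]; destruct c as [|a u]; [easy|]; constructor.
      * apply in_seq; specialize (Hn O); simpl in Hn; lia.
      * apply IH; split; [simpl in Hl; lia|]; intros i Hi; apply (Hn (S i)); lia.
Qed.

Lemma NoDup_params H G : NoDup (params H G).
Proof.
  apply NoDup_lprod, Forall_forall; intros L HL; apply repeat_spec in HL; subst.
  apply seq_NoDup.
Qed.

Lemma length_params H G : INR (length (params H G)) = INR H ^ G.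
Proof. unfold params; rewrite length_lprod_repeat, length_seq; apply pow_INR. Qed.

(** The entries of [c] at the indices [ix j] are forgotten and a free vector [s] is stored in their
    place. The choice of [s] accounts for the factor [INR H ^ D] on the left of
    [count_params_le]. *)
Definition splice (ix : nat -> nat) (D G : nat) (c s : list nat) : list nat :=
  map (fun i => match find (fun j => ix j =? i)%nat (seq 0 D) with
                | Some j => nth j s 0%nat
                | None => nth i c 0%nat
                end) (seq 0 G).

Lemma nth_splice_in ix D G c s j :
  (forall j k, (j < D)%nat -> (k < D)%nat -> ix j = ix k -> j = k) ->
  (forall j, (j < D)%nat -> (ix j < G)%nat) -> (j < D)%nat ->
  nth (ix j) (splice ix D G c s) 0%nat = nth j s 0%nat.
Proof.
  intros Hinj Hlt Hj; unfold splice.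
  rewrite (nth_indep _ 0%nat
    ((fun i => match find (fun j => ix j =? i)%nat (seq 0 D) with
                | Some j => nth j s 0%nat | None => nth i c 0%nat end) 0%nat))
    by (rewrite length_map, length_seq; auto).
  rewrite (map_nth (fun i => match find (fun j => ix j =? i)%nat (seq 0 D) with
                | Some j => nth j s 0%nat | None => nth i c 0%nat end)).
  rewrite seq_nth by auto; simpl.
  destruct (find _ _) as [k|] eqn:Ef.
  - apply find_some in Ef as [Hk Ek]; apply in_seq in Hk; apply Nat.eqb_eq in Ek.
    f_equal; apply Hinj; [lia|easy|easy].
  - assert (Hf := find_none _ _ Ef j ltac:(apply in_seq; lia)); simpl in Hf.
    now rewrite Nat.eqb_refl in Hf.
Qed.

Lemma nth_splice_out ix D G c s i :
  (forall j, (j < D)%nat -> ix j <> i) -> (i < G)%nat ->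
  nth i (splice ix D G c s) 0%nat = nth i c 0%nat.
Proof.
  intros Hout Hi; unfold splice.
  rewrite (nth_indep _ 0%nat
    ((fun i => match find (fun j => ix j =? i)%nat (seq 0 D) with
                | Some j => nth j s 0%nat | None => nth i c 0%nat end) 0%nat))
    by (rewrite length_map, length_seq; auto).
  rewrite (map_nth (fun i => match find (fun j => ix j =? i)%nat (seq 0 D) with
                | Some j => nth j s 0%nat | None => nth i c 0%nat end)).
  rewrite seq_nth by auto; simpl.
  destruct (find _ _) as [k|] eqn:Ef; [|easy].
  apply find_some in Ef as [Hk Ek]; apply in_seq in Hk; apply Nat.eqb_eq in Ek.
  now apply Hout in Ek; [|lia].
Qed.

(* Two parameters that differ only at the indices [ix j] and whose values fall in the same
   cells of side [h / 4] coincide, because the square system is diagonally dominant; this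
   makes [(c, s) |-> (splice c s, cells of c)] injective. *)
Lemma count_params_le (G H D : nat) (h : R) (al rr : nat -> R) (ze : nat -> nat -> R)
  (ix : nat -> nat) :
  (0 < D)%nat -> 0 < h ->
  (forall j, (j < D)%nat -> (ix j < G)%nat) ->
  (forall j k, (j < D)%nat -> (k < D)%nat -> ix j = ix k -> j = k) ->
  (forall j, (j < D)%nat -> h <= rr j) ->
  (forall j, (j < D)%nat -> 3 / 8 <= ze j (ix j)) ->
  (forall j i, (j < D)%nat -> (i < D)%nat -> i <> j ->
     INR D * Rabs (ze j (ix i)) <= 1 / 8) ->
  INR (count (fun c => forall j, (j < D)%nat ->
         Rabs (al j - sumR (fun i => INR (nth i c 0%nat) * h * ze j i) (seq 0 G)) <= rr j)
       (params H G)) * INR H ^ D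
  <= INR H ^ G * prodn D (fun j => 9 * rr j / h).
Proof.
  intros HD Hh Hlt Hinj Hrr Hdiag Hoff.
  set (val := fun c j => al j - sumR (fun i => INR (nth i c 0%nat) * h * ze j i) (seq 0 G)).
  set (Sol := fun c => forall j, (j < D)%nat -> Rabs (val c j) <= rr j).
  change (INR (count Sol (params H G)) * INR H ^ D
          <= INR H ^ G * prodn D (fun j => 9 * rr j / h)).
  set (cell := fun c j => nfloor ((val c j + rr j) / (h / 4))).
  (* The values fill an interval of length [2 * rr j], hence at most [8 * rr j / h + 1] cells of
     side [h / 4]; [h <= rr j] later bounds this by [9 * rr j / h]. *)
  set (K := fun j => S (nfloor (8 * rr j / h))).
  set (F := fun p : list nat * list nat =>
    (splice ix D G (fst p) (snd p), map (cell (fst p)) (seq 0 D))).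
  set (L1 := list_prod (filter (fun c => dec (Sol c)) (params H G)) (params H D)).
  set (L2 := list_prod (params H G) (lprod (map (fun j => seq 0 (K j)) (seq 0 D)))).
  assert (Hcell : forall c j, Sol c -> (j < D)%nat ->
      0 <= (val c j + rr j) / (h / 4) <= 8 * rr j / h).
  { intros c j Hc Hj; specialize (Hc j Hj).
    assert (Hv1 : - rr j <= val c j <= rr j).
    { unfold Rabs in Hc; destruct (Rcase_abs (val c j)); lra. }
    split.
    - apply Rmult_le_pos; [lra|left; apply Rinv_0_lt_compat; lra].
    - replace (8 * rr j / h) with ((2 * rr j) / (h / 4)) by (field; lra).
      apply Rmult_le_compat_r; [left; apply Rinv_0_lt_compat; lra|lra]. }
  assert (HN : NoDup (map F L1)).
  { apply Injective_map_NoDup_in.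
    - intros [c s] [c' s'] Hp Hp' HF; unfold F in HF; simpl in HF.
      apply in_prod_iff in Hp as [Hc Hs]; apply in_prod_iff in Hp' as [Hc' Hs'].
      apply filter_In in Hc as [Hc HSc]; apply filter_In in Hc' as [Hc' HSc'].
      apply (proj1 (dec_true _)) in HSc, HSc'.
      apply In_params in Hc as [Hlc Hcb]; apply In_params in Hc' as [Hlc' Hcb'].
      apply In_params in Hs as [Hls _]; apply In_params in Hs' as [Hls' _].
      injection HF as Hsp Hce.
      assert (Es : s = s').
      { apply (nth_ext _ _ 0%nat 0%nat); [congruence|]; intros j Hj; rewrite Hls in Hj.
        rewrite <- (nth_splice_in ix D G c s j), <- (nth_splice_in ix D G c' s' j) by auto.
        now rewrite Hsp. }
      assert (Hout : forall i, (i < G)%nat -> (forall j, (j < D)%nat -> ix j <> i) ->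
                nth i c 0%nat = nth i c' 0%nat).
      { intros i Hi Hno.
        rewrite <- (nth_splice_out ix D G c s i), <- (nth_splice_out ix D G c' s' i) by auto.
        now rewrite Hsp. }
      assert (Hsame : forall j, (j < D)%nat -> Rabs (val c j - val c' j) < h / 4).
      { intros j Hj.
        assert (Ec : cell c j = cell c' j).
        { assert (Hm : nth j (map (cell c) (seq 0 D)) (cell c 0%nat)
                       = nth j (map (cell c') (seq 0 D)) (cell c 0%nat))
            by now rewrite Hce.
          rewrite (nth_indep (map (cell c') _) _ (cell c' 0%nat)) in Hm
            by (rewrite length_map, length_seq; easy).
          rewrite !map_nth, !seq_nth in Hm by easy; exact Hm. }
        unfold cell in Ec.
        destruct (nfloor_spec _ (proj1 (Hcell c j HSc Hj))) as [A1 A2].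
        destruct (nfloor_spec _ (proj1 (Hcell c' j HSc' Hj))) as [B1 B2].
        rewrite Ec in A1, A2.
        set (q := INR _) in *.
        assert (Hdiff : -1 < (val c j - val c' j) / (h / 4) < 1).
        { replace ((val c j - val c' j) / (h / 4))
            with ((val c j + rr j) / (h / 4) - (val c' j + rr j) / (h / 4)) by (field; lra).
          lra. }
        apply Rabs_def1.
        - apply Rmult_lt_reg_r with (/ (h / 4)); [apply Rinv_0_lt_compat; lra|].
          replace (h / 4 * / (h / 4)) with 1 by (field; lra); apply Hdiff.
        - apply Rmult_lt_reg_r with (/ (h / 4)); [apply Rinv_0_lt_compat; lra|].
          replace (- (h / 4) * / (h / 4)) with (-1) by (field; lra); apply Hdiff. }
      set (d := fun i => INR (nth i c 0%nat) - INR (nth i c' 0%nat)).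
      assert (Hval : forall j, val c' j - val c j
                = h * sumR (fun k => d (ix k) * ze j (ix k)) (seq 0 D)).
      { intro j; unfold val.
        rewrite <- (sumR_map ix (fun i => d i * ze j i)).
        rewrite <- (sumR_support (fun i => d i * ze j i) (seq 0 G) (map ix (seq 0 D))).
        - rewrite <- sumR_scal.
          replace (sumR (fun a => h * (d a * ze j a)) (seq 0 G)) with
            (sumR (fun a => INR (nth a c 0%nat) * h * ze j a
                  + (-1) * (INR (nth a c' 0%nat) * h * ze j a)) (seq 0 G)).
          + rewrite sumR_plus, sumR_scal; ring.
          + apply sumR_ext; intros; unfold d; ring.
        - apply seq_NoDup.
        - apply Injective_map_NoDup_in; [|apply seq_NoDup].
          intros a b Ha Hb; apply in_seq in Ha, Hb; apply Hinj; lia.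
        - intros i Hi; apply in_map_iff in Hi as (k & <- & Hk); apply in_seq in Hk.
          apply in_seq; specialize (Hlt k); lia.
        - intros i Hi Hno; unfold d; rewrite (Hout i).
          + ring.
          + apply in_seq in Hi; lia.
          + intros k Hk E; apply Hno; rewrite <- E; apply in_map, in_seq; lia. }
      destruct (diagonally_dominant_lower_bound D (fun j i => ze j (ix i)) (fun k => d (ix k)))
        as (j & Hj & Hmax & Hbig); [easy|easy|easy|].
      (* The side [h / 4] matches the constant [1 / 4] of the dominance bound: the largest
         difference of coordinates is below 1, and the coordinates are integers. *)
      assert (Hdj : Rabs (d (ix j)) < 1).
      { specialize (Hsame j Hj).
        replace (val c j - val c' j) with (- (val c' j - val c j)) in Hsame by ring.
        rewrite Rabs_Ropp, Hval, Rabs_mult, (Rabs_right h) in Hsame by lra.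
        apply Rmult_le_compat_l with (r := h) in Hbig; [|lra]; nra. }
      assert (Hzero : forall k, (k < D)%nat -> nth (ix k) c 0%nat = nth (ix k) c' 0%nat).
      { intros k Hk.
        assert (Hdk : Rabs (d (ix k)) < 1) by (specialize (Hmax k Hk); simpl in Hmax; lra).
        unfold d in Hdk; apply Rabs_def2 in Hdk; rewrite !INR_IZR_INZ in Hdk.
        rewrite <- minus_IZR in Hdk; destruct Hdk as [U1 U2].
        apply lt_IZR in U1; apply (lt_IZR (-1)) in U2; lia. }
      f_equal; [|easy].
      apply (nth_ext _ _ 0%nat 0%nat); [congruence|]; intros i Hi; rewrite Hlc in Hi.
      destruct (classic (exists j, (j < D)%nat /\ ix j = i)) as [(k & Hk & <-)|Hno]; [auto|].
      apply Hout; [easy|]; intros k Hk E; apply Hno; eauto.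
    - clear; unfold L1.
      assert (Hlp : forall (A B : list (list nat)), NoDup A -> NoDup B -> NoDup (list_prod A B)).
      { intros A B HA HB; induction HA as [|a A Ha HA IH]; simpl; [constructor|].
        apply NoDup_app; [|easy|].
        - apply Injective_map_NoDup; [|easy]; intros u v E; now injection E.
        - intros [u v] Hu Hv; apply in_map_iff in Hu as (w & E & _); injection E as <- <-.
          now apply in_prod_iff in Hv as [Hv _]. }
      apply Hlp; [apply NoDup_filter|]; apply NoDup_params. }
  assert (Hinc : incl (map F L1) L2).
  { intros p Hp; apply in_map_iff in Hp as ([c s] & <- & Hp).
    apply in_prod_iff in Hp as [Hc Hs]; apply filter_In in Hc as [Hc HSc].
    apply (proj1 (dec_true _)) in HSc; apply In_params in Hc as [Hlc Hcb].
    apply In_params in Hs as [Hls Hsb].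
    unfold F, L2; apply in_prod_iff; simpl; split.
    - apply In_params; split; [unfold splice; now rewrite length_map, length_seq|].
      intros i Hi.
      destruct (classic (exists j, (j < D)%nat /\ ix j = i)) as [(k & Hk & <-)|Hno].
      + rewrite nth_splice_in; auto.
      + rewrite nth_splice_out; auto; intros k Hk E; apply Hno; eauto.
    - apply In_lprod.
      assert (Hall : forall l, (forall j, In j l -> (j < D)%nat) ->
        Forall2 (@In nat) (map (cell c) l) (map (fun j => seq 0 (K j)) l)).
      { induction l as [|j l IH]; simpl; intro Hl; constructor; [|apply IH; auto].
        apply (proj2 (in_seq (K j) 0 (cell c j))); split; [lia|]; unfold cell, K; simpl.
        assert (Hj : (j < D)%nat) by auto.
        destruct (Hcell c j HSc Hj) as [P1 P2].
        destruct (nfloor_spec _ P1) as [Q1 Q2].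
        destruct (nfloor_spec (8 * rr j / h)) as [Q3 Q4]; [lra|].
        apply INR_lt; rewrite S_INR; lra. }
      apply Hall; intros j Hj; apply in_seq in Hj; lia. }
  assert (Hcard := NoDup_incl_length HN Hinc).
  unfold L1, L2 in Hcard; rewrite length_map, !length_prod in Hcard.
  apply le_INR in Hcard; rewrite !mult_INR, !length_params, length_lprod_seq in Hcard.
  eapply Rle_trans; [exact Hcard|].
  apply Rmult_le_compat_l; [apply pow_le, pos_INR|].
  apply prodn_le; intros j Hj; split; [apply pos_INR|].
  unfold K; rewrite S_INR.
  specialize (Hrr j Hj).
  assert (1 <= rr j / h).
  { apply Rmult_le_reg_r with h; [easy|].
    replace (rr j / h * h) with (rr j) by (field; lra); lra. }
  replace (9 * rr j / h) with (8 * rr j / h + rr j / h) by (field; lra).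
  destruct (nfloor_spec (8 * rr j / h)) as [Q3 Q4].
  { replace (8 * rr j / h) with (8 * (rr j / h)) by (field; lra); lra. }
  lra.
Qed.

(** * Inverse branches *)

(** Here [e] is the derivative of the lift [E] and [g] its global inverse, so the inverse branches
    of the circle map are [x |-> g (x + j)] for [j < l]. The Lipschitz constant [CE] of [e] is what
    bounded distortion needs. *)
Record expanding (l : nat) (E e g : R -> R) (lam Lam CE : R) : Prop := {
  exp_l : (2 <= l)%nat;
  exp_lam : 1 < lam;
  exp_e : forall x, lam <= e x <= Lam;
  exp_der : forall x, derivable_pt_lim E x (e x);
  exp_per : forall x, E (x + 1) = E x + INR l;
  exp_eper : forall x, e (x + 1) = e x;
  exp_CE : 0 <= CE;
  exp_lip : forall a b, Rabs (e a - e b) <= CE * Rabs (a - b);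
  exp_g : forall x, E (g x) = x }.

Definition words (l n : nat) : list (list nat) := lprod (repeat (seq 0 l) n).

(** [pt g x u], [dr g e x u], [sl g e f x t u] describe the inverse branch of [E^n] coded by
    the digits [u]: its endpoint over [x], the derivative of [E^n] there, and the slope that
    [Df^n] maps to the slope [t] when [tau' = f]. *)
Fixpoint pt (g : R -> R) (x : R) (u : list nat) : R :=
  match u with
  | [] => x
  | j :: v => pt g (g (x + INR j)) v
  end.

Fixpoint dr (g e : R -> R) (x : R) (u : list nat) : R :=
  match u with
  | [] => 1
  | j :: v => e (g (x + INR j)) * dr g e (g (x + INR j)) v
  end.

Fixpoint sl (g e f : R -> R) (x t : R) (u : list nat) : R :=
  match u with
  | [] => t
  | j :: v => sl g e f (g (x + INR j)) (e (g (x + INR j)) * t - f (g (x + INR j))) v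
  end.

Fixpoint orb (g : R -> R) (x : R) (u : list nat) : list R :=
  match u with
  | [] => []
  | j :: v => g (x + INR j) :: orb g (g (x + INR j)) v
  end.

Definition cnt (l : nat) (g e f : R -> R) (th : R) (n : nat) (x t : R) : nat :=
  count (fun u => Rabs (sl g e f x t u) <= th) (words l n).

(** [far d a b]: the points of the circle represented by [a] and [b] have distance
    at least [d]. *)
Definition far (d a b : R) : Prop := forall n : Z, d <= Rabs (a - b - IZR n).

Lemma In_words l n u : In u (words l n) <-> length u = n /\ forall j, In j u -> (j < l)%nat.
Proof.
  unfold words; rewrite In_lprod; revert u; induction n as [|n IH]; intro u; simpl.
  - split; [intro F; inversion F; split; [easy|intros ? []]|].
    intros [L _]; destruct u; [constructor|easy].
  - split.
    + intro F; inversion F as [|a L v Ls Ha Hv]; subst; apply IH in Hv as [Hl Hn].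
      split; [simpl; lia|]; intros j [<-|Hj]; [apply in_seq in Ha; lia|auto].
    + intros [Hl Hn]; destruct u as [|a v]; [easy|]; constructor.
      * apply in_seq; specialize (Hn a (or_introl eq_refl)); lia.
      * apply IH; split; [simpl in Hl; lia|]; intros j Hj; apply Hn; now right.
Qed.

Lemma NoDup_words l n : NoDup (words l n).
Proof.
  apply NoDup_lprod, Forall_forall; intros L HL; apply repeat_spec in HL; subst.
  apply seq_NoDup.
Qed.

Lemma length_words l n : length (words l n) = (l ^ n)%nat.
Proof. unfold words; now rewrite length_lprod_repeat, length_seq. Qed.

Lemma sumR_words_S l n (F : list nat -> R) :
  sumR F (words l (S n)) = sumR (fun j => sumR (fun u => F (j :: u)) (words l n)) (seq 0 l).
Proof.
  unfold words; simpl; rewrite sumR_flat_map; apply sumR_ext; intros; apply sumR_map.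
Qed.

Lemma sumR_words_add l n m (F : list nat -> R) :
  sumR F (words l (n + m))
  = sumR (fun p => sumR (fun q => F (p ++ q)) (words l m)) (words l n).
Proof.
  revert F; induction n as [|n IH]; intro F.
  - change (words l 0) with [@nil nat]; simpl; rewrite Rplus_0_r; reflexivity.
  - simpl plus; rewrite !sumR_words_S; apply sumR_ext; intros j _; apply IH.
Qed.

Lemma pt_app g x p q : pt g x (p ++ q) = pt g (pt g x p) q.
Proof. revert x; induction p; simpl; auto. Qed.

Lemma sl_app g e f x t p q :
  sl g e f x t (p ++ q) = sl g e f (pt g x p) (sl g e f x t p) q.
Proof. revert x t; induction p; simpl; auto. Qed.

Lemma dr_app g e x p q : dr g e x (p ++ q) = dr g e x p * dr g e (pt g x p) q.
Proof. revert x; induction p; simpl; intros; [lra|]. rewrite IHp; ring. Qed.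

Lemma length_orb g x u : length (orb g x u) = length u.
Proof. revert x; induction u; simpl; auto. Qed.

Lemma orb_app g x p q : orb g x (p ++ q) = orb g x p ++ orb g (pt g x p) q.
Proof. revert x; induction p; simpl; intros; congruence. Qed.

Lemma pt_In_orb g x u : u <> [] -> In (pt g x u) (orb g x u).
Proof.
  revert x; induction u as [|j u IH]; [easy|]; intros x _; simpl.
  destruct u as [|k u]; [now left|right; now apply IH].
Qed.

Section Expanding.

Context {l : nat} {E e g : R -> R} {lam Lam CE : R} (HE : expanding l E e g lam Lam CE).

Lemma Lam_gt1 : 1 < Lam.
Proof. pose proof (exp_e _ _ _ _ _ _ _ HE 0); pose proof (exp_lam _ _ _ _ _ _ _ HE); lra. Qed.

Lemma e_pos x : 0 < e x.
Proof. pose proof (exp_e _ _ _ _ _ _ _ HE x); pose proof (exp_lam _ _ _ _ _ _ _ HE); lra. Qed.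

Lemma E_mvt a b : a <= b -> exists c, a <= c <= b /\ E b - E a = e c * (b - a).
Proof.
  intros [H| ->].
  - destruct (MVT_cor2 E e a b H) as (c & Hc & Hab).
    + intros; apply (exp_der _ _ _ _ _ _ _ HE).
    + exists c; split; lra.
  - exists b; split; [lra|ring].
Qed.

Lemma E_bounds a b : a <= b -> lam * (b - a) <= E b - E a <= Lam * (b - a).
Proof.
  intro H; destruct (E_mvt a b H) as (c & _ & ->).
  pose proof (exp_e _ _ _ _ _ _ _ HE c); split; apply Rmult_le_compat_r; lra.
Qed.

Lemma E_bounds_abs a b : lam * Rabs (a - b) <= Rabs (E a - E b) <= Lam * Rabs (a - b).
Proof.
  assert (Hlam := exp_lam _ _ _ _ _ _ _ HE).
  destruct (Rle_dec a b) as [H|H].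
  - pose proof (E_bounds a b H); rewrite !Rabs_left1; nra.
  - pose proof (E_bounds b a ltac:(lra)); rewrite !Rabs_right; nra.
Qed.

Lemma E_inj a b : E a = E b -> a = b.
Proof.
  intro H; pose proof (E_bounds_abs a b) as [H1 _].
  rewrite H, Rminus_diag, Rabs_R0 in H1.
  assert (Hlam := exp_lam _ _ _ _ _ _ _ HE); pose proof (Rabs_pos (a - b)).
  assert (H2 : Rabs (a - b) = 0) by nra.
  destruct (Req_dec (a - b) 0) as [H3|H3]; [lra|now apply Rabs_no_R0 in H3].
Qed.

Lemma periodic_IZR (F : R -> R) (c : R) :
  (forall x, F (x + 1) = F x + c) -> forall (n : Z) x, F (x + IZR n) = F x + IZR n * c.
Proof.
  intros HF.
  assert (Hnat : forall (n : nat) x, F (x + INR n) = F x + INR n * c).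
  { induction n as [|n IH]; intro x; [simpl; rewrite Rplus_0_r; ring|].
    rewrite S_INR, <- Rplus_assoc, HF, IH; ring. }
  intros n x; destruct (Z_le_gt_dec 0 n) as [Hn|Hn].
  - rewrite <- (Z2Nat.id n Hn), <- INR_IZR_INZ; apply Hnat.
  - specialize (Hnat (Z.to_nat (- n)) (x + IZR n)).
    rewrite INR_IZR_INZ, Z2Nat.id, opp_IZR in Hnat by lia.
    replace (x + IZR n + - IZR n) with x in Hnat by ring; lra.
Qed.

Lemma E_shift n x : E (x + IZR n) = E x + INR l * IZR n.
Proof.
  rewrite (periodic_IZR E (INR l)); [ring|apply (exp_per _ _ _ _ _ _ _ HE)].
Qed.

Lemma g_shift n x : g (x + INR l * IZR n) = g x + IZR n.
Proof. apply E_inj; rewrite E_shift, !(exp_g _ _ _ _ _ _ _ HE); easy. Qed.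

Lemma g_shift1 x : g (x + INR l) = g x + 1.
Proof. rewrite <- (g_shift 1); f_equal; simpl; ring. Qed.

Lemma g_bounds a b : Rabs (a - b) <= Lam * Rabs (g a - g b) /\ lam * Rabs (g a - g b) <= Rabs (a - b).
Proof.
  pose proof (E_bounds_abs (g a) (g b)) as H; rewrite !(exp_g _ _ _ _ _ _ _ HE) in H; lra.
Qed.

Lemma g_mono a b : a <= b -> g a <= g b.
Proof.
  intro H; destruct (Rle_dec (g a) (g b)) as [|Hn]; [easy|exfalso].
  pose proof (E_bounds (g b) (g a) ltac:(lra)) as [H1 _].
  rewrite !(exp_g _ _ _ _ _ _ _ HE) in H1; pose proof (exp_lam _ _ _ _ _ _ _ HE); nra.
Qed.

Lemma dr_bounds x u : lam ^ length u <= dr g e x u <= Lam ^ length u.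
Proof.
  pose proof (exp_lam _ _ _ _ _ _ _ HE) as Hlam.
  revert x; induction u as [|j u IH]; intro x; simpl; [lra|].
  specialize (IH (g (x + INR j))); pose proof (exp_e _ _ _ _ _ _ _ HE (g (x + INR j))).
  assert (0 < lam ^ length u) by (apply pow_lt; lra).
  split; apply Rmult_le_compat; lra.
Qed.

Lemma dr_pos x u : 0 < dr g e x u.
Proof.
  eapply Rlt_le_trans; [|apply dr_bounds]; apply pow_lt.
  pose proof (exp_lam _ _ _ _ _ _ _ HE); lra.
Qed.

Lemma sumR_cyclic_shift (phi : nat -> R) n :
  phi n = phi 0%nat -> sumR (fun j => phi (S j)) (seq 0 n) = sumR phi (seq 0 n).
Proof.
  intro H.
  rewrite <- (sumR_map S phi), seq_shift.
  assert (H1 : sumR phi (seq 0 (S n)) = phi 0%nat + sumR phi (seq 1 n)) by easy.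
  assert (H2 : sumR phi (seq 0 (S n)) = sumR phi (seq 0 n) + phi n).
  { rewrite seq_S, sumR_app; simpl; ring. }
  lra.
Qed.

(** Moving [x] to [x + 1] permutes the branches cyclically: digit [j] over [x + 1] is digit [j + 1]
    over [x], and digit [l] yields [g x + 1], which the induction hypothesis identifies with digit
    [0]. *)
Lemma sumR_branches_periodic f (F : R -> R -> R) n :
  (forall x, f (x + 1) = f x) -> (forall x t, F (x + 1) t = F x t) ->
  forall x t, sumR (fun u => F (pt g (x + 1) u) (sl g e f (x + 1) t u)) (words l n)
              = sumR (fun u => F (pt g x u) (sl g e f x t u)) (words l n).
Proof.
  intros Hf HF; induction n as [|n IH]; intros x t.
  - unfold words; simpl; now rewrite HF.
  - rewrite !sumR_words_S; simpl.
    set (phi := fun j : nat => sumR (fun u => F (pt g (g (x + INR j)) u)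
       (sl g e f (g (x + INR j)) (e (g (x + INR j)) * t - f (g (x + INR j))) u)) (words l n)).
    change (sumR (fun j => sumR (fun u => F (pt g (g (x + 1 + INR j)) u)
       (sl g e f (g (x + 1 + INR j)) (e (g (x + 1 + INR j)) * t - f (g (x + 1 + INR j))) u))
       (words l n)) (seq 0 l) = sumR phi (seq 0 l)).
    rewrite <- (sumR_cyclic_shift phi l).
    + apply sumR_ext; intros j _; unfold phi; rewrite S_INR.
      replace (x + (INR j + 1)) with (x + 1 + INR j) by ring; easy.
    + unfold phi; rewrite g_shift1, Hf, (exp_eper _ _ _ _ _ _ _ HE).
      rewrite IH; simpl; now rewrite Rplus_0_r.
Qed.

(** The images of [[x, x + 1]] under the inverse branches tile one period, so their lengths add up
    to 1. The proof is a telescoping sum, by [g (x + l) = g x + 1]. *)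
Lemma sumR_pt_increment n x :
  sumR (fun u => pt g (x + 1) u - pt g x u) (words l n) = 1.
Proof.
  assert (Hs : forall n x, sumR (pt g (x + 1)) (words l n) = sumR (pt g x) (words l n) + 1).
  { clear n x; induction n as [|n IH]; intro x; [unfold words; simpl; ring|].
    rewrite !sumR_words_S; simpl.
    set (phi := fun j : nat => sumR (pt g (g (x + INR j))) (words l n)).
    assert (Hl : phi l = phi 0%nat + 1).
    { unfold phi; rewrite g_shift1, IH; simpl; now rewrite Rplus_0_r. }
    change (sumR (fun j => sumR (fun u => pt g (g (x + INR j)) u) (words l n)) (seq 0 l))
      with (sumR phi (seq 0 l)).
    rewrite (sumR_ext _ (fun j => phi (S j))).
    - rewrite <- (sumR_map S phi), seq_shift.
      assert (H1 : sumR phi (seq 0 (S l)) = phi 0%nat + sumR phi (seq 1 l)) by easy.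
      assert (H2 : sumR phi (seq 0 (S l)) = sumR phi (seq 0 l) + phi l).
      { rewrite seq_S, sumR_app; simpl; ring. }
      lra.
    - intros j _; unfold phi; rewrite S_INR.
      replace (x + (INR j + 1)) with (x + 1 + INR j) by ring; easy. }
  rewrite (sumR_ext _ (fun u => pt g (x + 1) u + (-1) * pt g x u)) by (intros; ring).
  rewrite sumR_plus, sumR_scal.
  rewrite (Hs n x); ring.
Qed.

(** Each inverse step shortens the interval by the factor [lam], so the distortion factors
    [exp (CE * L / lam ^ k)], [k >= 1], multiply to [exp (CE * L / (lam - 1))]. *)
Lemma branch_distortion u : forall a b L, 0 <= b - a <= L ->
  b - a <= dr g e a u * (pt g b u - pt g a u) * exp (CE * L / (lam - 1)).
Proof.
  pose proof (exp_lam _ _ _ _ _ _ _ HE) as Hlam; pose proof (exp_CE _ _ _ _ _ _ _ HE) as HC.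
  induction u as [|j u IH]; intros a b L Hab; simpl.
  - assert (1 <= exp (CE * L / (lam - 1))).
    { eapply Rle_trans; [|apply exp_ineq1_le].
      apply Rplus_le_reg_l with (-1); ring_simplify (-1 + 1).
      replace (-1 + (1 + CE * L / (lam - 1))) with (CE * L * / (lam - 1)) by (unfold Rdiv; ring).
      apply Rmult_le_pos; [apply Rmult_le_pos; lra|left; apply Rinv_0_lt_compat; lra]. }
    nra.
  - set (a1 := g (a + INR j)); set (b1 := g (b + INR j)).
    assert (Hm : a1 <= b1) by (apply g_mono; lra).
    assert (HEa : E a1 = a + INR j) by apply (exp_g _ _ _ _ _ _ _ HE).
    assert (HEb : E b1 = b + INR j) by apply (exp_g _ _ _ _ _ _ _ HE).
    pose proof (E_bounds a1 b1 Hm) as [Hb _].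
    assert (Hb1 : 0 <= b1 - a1 <= L / lam).
    { split; [lra|]; apply Rmult_le_reg_l with lam; [lra|].
      replace (lam * (L / lam)) with L by (field; lra); lra. }
    specialize (IH a1 b1 (L / lam) Hb1).
    destruct (E_mvt a1 b1 Hm) as (c & Hc & Hcv).
    assert (He : e c <= e a1 * exp (CE * (L / lam))).
    { assert (H1 : e c <= e a1 + CE * (L / lam)).
      { pose proof (exp_lip _ _ _ _ _ _ _ HE c a1) as H2; pose proof (Rle_abs (e c - e a1)).
        rewrite (Rabs_right (c - a1)) in H2 by lra.
        assert (CE * (c - a1) <= CE * (L / lam)) by (apply Rmult_le_compat_l; lra); lra. }
      assert (H3 : 1 + CE * (L / lam) <= exp (CE * (L / lam))) by apply exp_ineq1_le.
      pose proof (exp_e _ _ _ _ _ _ _ HE a1).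
      assert (0 <= CE * (L / lam)) by (apply Rmult_le_pos; lra).
      nra. }
    replace (CE * L / (lam - 1)) with (CE * (L / lam) + CE * (L / lam) / (lam - 1))
      by (field; lra).
    rewrite exp_plus.
    set (X1 := exp (CE * (L / lam))) in *; set (X2 := exp (CE * (L / lam) / (lam - 1))) in *.
    assert (HX1 : 0 < X1) by apply exp_pos.
    replace (b - a) with (e c * (b1 - a1)) by lra.
    assert (H4 : e c * (b1 - a1) <= e a1 * X1 * (b1 - a1)) by (apply Rmult_le_compat_r; lra).
    assert (H5 : e a1 * X1 * (b1 - a1)
       <= e a1 * X1 * (dr g e a1 u * (pt g b1 u - pt g a1 u) * X2)).
    { apply Rmult_le_compat_l; [|easy]; apply Rmult_le_pos; pose proof (e_pos a1); lra. }
    lra.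
Qed.

(** By distortion, each inverse derivative is at most a constant times the length of the image of
    [[x, x + 1]], and these lengths add up to 1. The bound is uniform in [n], which keeps the
    moments bounded. *)
Lemma sumR_inv_dr_le n x :
  sumR (fun u => / dr g e x u) (words l n) <= exp (CE / (lam - 1)).
Proof.
  set (K := exp (CE / (lam - 1))); rewrite <- (Rmult_1_r K).
  replace (K * 1) with (K * sumR (fun u => pt g (x + 1) u - pt g x u) (words l n))
    by now rewrite sumR_pt_increment.
  rewrite <- sumR_scal.
  apply sumR_le; intros u _.
  pose proof (branch_distortion u x (x + 1) 1 ltac:(lra)) as H.
  rewrite Rmult_1_r in H; fold K in H; pose proof (dr_pos x u).
  apply Rmult_le_reg_l with (dr g e x u); [easy|].
  rewrite Rinv_r by lra; lra.
Qed.


(** Only translations by multiples of [l] have to be excluded before applying [g], because these are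
    the ones that [g] turns into integer translations. *)
Lemma far_branch a b d (i j : nat) :
  (forall n : Z, d <= Rabs (a + INR i - (b + INR j) - INR l * IZR n)) ->
  far (d / Lam) (g (a + INR i)) (g (b + INR j)).
Proof.
  intros H n; specialize (H n); pose proof Lam_gt1.
  destruct (g_bounds (a + INR i) (b + INR j + INR l * IZR n)) as [H1 _].
  rewrite g_shift in H1.
  replace (g (a + INR i) - (g (b + INR j) + IZR n))
    with (g (a + INR i) - g (b + INR j) - IZR n) in H1 by ring.
  replace (a + INR i - (b + INR j + INR l * IZR n))
    with (a + INR i - (b + INR j) - INR l * IZR n) in H1 by ring.
  apply Rmult_le_reg_l with Lam; [lra|].
  replace (Lam * (d / Lam)) with d by (field; lra); lra.
Qed.

Lemma far_pt u : forall v a b d, length u = length v -> far d a b ->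
  far (d / Lam ^ length u) (pt g a u) (pt g b v).
Proof.
  pose proof Lam_gt1 as HL.
  induction u as [|i u IH]; intros [|j v] a b d Hlen Hf; try easy; simpl.
  - now replace (d / 1) with d by field.
  - replace (d / (Lam * Lam ^ length u)) with (d / Lam / Lam ^ length u)
      by (field; split; [apply pow_nonzero|]; lra).
    apply IH; [simpl in Hlen; lia|]; apply far_branch; intro n.
    replace (a + INR i - (b + INR j) - INR l * IZR n)
      with (a - b - IZR (Z.of_nat l * n + Z.of_nat j - Z.of_nat i)); [apply Hf|].
    rewrite minus_IZR, plus_IZR, mult_IZR, <- !INR_IZR_INZ; ring.
Qed.

(** At the first digit where the words differ, the two arguments of [g] differ by an integer that is
    not a multiple of [l], so they are at distance at least 1 modulo [l]; each inverse step shrinks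
    this by at most [Lam]. *)
Lemma far_words n : forall u v x, In u (words l n) -> In v (words l n) -> u <> v ->
  far (/ Lam ^ n) (pt g x u) (pt g x v).
Proof.
  pose proof Lam_gt1 as HL.
  assert (Hp : forall n, 0 < Lam ^ n) by (intro; apply pow_lt; lra).
  induction n as [|n IH]; intros u v x Hu Hv Hne;
    apply In_words in Hu as [Hlu Hu]; apply In_words in Hv as [Hlv Hv].
  - destruct u, v; easy.
  - destruct u as [|i u]; [easy|]; destruct v as [|j v]; [easy|]; simpl in *.
    injection Hlu as Hlu; injection Hlv as Hlv.
    destruct (Nat.eq_dec i j) as [<-|Hij].
    + assert (Huv : u <> v) by congruence.
      intro k; eapply Rle_trans; [|apply (IH u v (g (x + INR i)))].
      * pose proof (Hp n); apply Rinv_le_contravar; [easy|]; nra.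
      * apply In_words; auto.
      * apply In_words; auto.
      * easy.
    + replace (/ (Lam * Lam ^ n)) with (1 / Lam / Lam ^ length u)
        by (rewrite Hlu; field; split; [pose proof (Hp n)|]; lra).
      apply far_pt; [congruence|]; apply far_branch; intro k.
      assert (Hz : (Z.of_nat i - Z.of_nat j - Z.of_nat l * k <> 0)%Z).
      { assert (Z.of_nat i < Z.of_nat l)%Z by (specialize (Hu i); lia).
        assert (Z.of_nat j < Z.of_nat l)%Z by (specialize (Hv j); lia).
        destruct (Z.eq_dec k 0) as [->|]; [lia|]; nia. }
      replace (x + INR i - (x + INR j) - INR l * IZR k)
        with (IZR (Z.of_nat i - Z.of_nat j - Z.of_nat l * k))
        by (rewrite !minus_IZR, mult_IZR, <- !INR_IZR_INZ; ring).
      rewrite <- abs_IZR; apply IZR_le; lia.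
Qed.

(** The radius [Rc / (lam - 1)] is the fixed point of [t |-> lam * t - Rc]: a slope outside the cone
    stays outside under further pull back. *)
Lemma sl_in_cone f Rc u : 0 <= Rc -> (forall y, Rabs (f y) <= Rc) -> forall x t,
  Rabs (sl g e f x t u) <= Rc / (lam - 1) -> Rabs t <= Rc / (lam - 1).
Proof.
  intros HR Hf; pose proof (exp_lam _ _ _ _ _ _ _ HE) as Hlam.
  induction u as [|j u IH]; intros x t; simpl; [easy|]; intro H; apply IH in H.
  set (y := g (x + INR j)) in *.
  set (th := Rc / (lam - 1)) in *.
  assert (Hth : Rc = th * (lam - 1)) by (unfold th; field; lra).
  specialize (Hf y); pose proof (exp_e _ _ _ _ _ _ _ HE y).
  assert (H1 : Rabs (e y * t) <= lam * th).
  { replace (e y * t) with ((e y * t - f y) + f y) by ring.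
    eapply Rle_trans; [apply Rabs_triang|]; lra. }
  rewrite Rabs_mult, (Rabs_right (e y)) in H1 by lra.
  pose proof (Rabs_pos t); nra.
Qed.

(** The difference of the factors [e] is multiplied by the current slope, which is unbounded in
    general. If the final slope lies in the cone, so do all intermediate ones by [sl_in_cone]; this
    is needed for one of the two orbits only. *)
Lemma sl_lipschitz f Rc Cf B u : 0 <= Rc -> 0 <= Cf -> (forall y, Rabs (f y) <= Rc) ->
  (forall a b, Rabs (f a - f b) <= Cf * Rabs (a - b)) ->
  Lam + Rc / (lam - 1) * CE + Cf <= B ->
  forall x t x' t' d, Rabs (x - x') <= d -> Rabs (t - t') <= d ->
  Rabs (sl g e f x t u) <= Rc / (lam - 1) ->
  Rabs (sl g e f x t u - sl g e f x' t' u) <= B ^ length u * d.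
Proof.
  intros HR HCf Hf Hlip HB; pose proof (exp_lam _ _ _ _ _ _ _ HE) as Hlam.
  pose proof (exp_CE _ _ _ _ _ _ _ HE) as HC.
  assert (Hth : 0 <= Rc / (lam - 1))
    by (apply Rmult_le_pos; [easy|left; apply Rinv_0_lt_compat; lra]).
  pose proof Lam_gt1 as HL.
  induction u as [|j u IH]; intros x t x' t' d Hx Ht Hs.
  - simpl; lra.
  - assert (Hcone := sl_in_cone f Rc (j :: u) HR Hf x t Hs).
    simpl in *.
    set (y := g (x + INR j)) in *; set (y' := g (x' + INR j)) in *.
    assert (Hd : 0 <= d) by (pose proof (Rabs_pos (x - x')); lra).
    assert (Hy : Rabs (y - y') <= d).
    { destruct (g_bounds (x + INR j) (x' + INR j)) as [_ H].
      replace (x + INR j - (x' + INR j)) with (x - x') in H by ring.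
      fold y y' in H; pose proof (Rabs_pos (y - y')); nra. }
    assert (HBp : 1 <= B) by (assert (0 <= Rc / (lam - 1) * CE) by (now apply Rmult_le_pos); lra).
    replace (B * B ^ length u * d) with (B ^ length u * (B * d)) by ring.
    apply IH; [nra| |easy].
    replace (e y * t - f y - (e y' * t' - f y'))
      with (e y' * (t - t') + (e y - e y') * t + - (f y - f y')) by ring.
    eapply Rle_trans; [apply Rabs_triang|]; rewrite Rabs_Ropp.
    eapply Rle_trans; [apply Rplus_le_compat_r, Rabs_triang|]; rewrite !Rabs_mult.
    pose proof (exp_e _ _ _ _ _ _ _ HE y') as He; rewrite (Rabs_right (e y')) by lra.
    assert (H1 : e y' * Rabs (t - t') <= Lam * d)
      by (apply Rmult_le_compat; try apply Rabs_pos; lra).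
    assert (H2 : Rabs (e y - e y') * Rabs t <= (CE * d) * (Rc / (lam - 1))).
    { apply Rmult_le_compat; try apply Rabs_pos; [|easy].
      eapply Rle_trans; [apply (exp_lip _ _ _ _ _ _ _ HE)|].
      apply Rmult_le_compat_l; lra. }
    assert (H3 : Rabs (f y - f y') <= Cf * d).
    { eapply Rle_trans; [apply Hlip|]; apply Rmult_le_compat_l; lra. }
    assert (H4 : (Lam + Rc / (lam - 1) * CE + Cf) * d <= B * d)
      by (apply Rmult_le_compat_r; lra).
    lra.
Qed.

(** Both slopes are pulled back along the same orbit, so the factors [e] agree and no cone condition
    is needed. *)
Lemma sl_perturb f f' ep u : (forall y, Rabs (f y - f' y) <= ep) ->
  forall x t t' d, Rabs (t - t') <= d ->
  Rabs (sl g e f x t u - sl g e f' x t' u) <= Lam ^ length u * (d + INR (length u) * ep).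
Proof.
  intro Hf; pose proof Lam_gt1 as HL.
  assert (Hep : 0 <= ep) by (pose proof (Hf 0); pose proof (Rabs_pos (f 0 - f' 0)); lra).
  induction u as [|j u IH]; intros x t t' d Ht; [simpl; lra|].
  simpl sl; set (y := g (x + INR j)).
  assert (Hd : 0 <= d) by (pose proof (Rabs_pos (t - t')); lra).
  eapply Rle_trans.
  - apply (IH y _ _ (Lam * d + ep)).
    replace (e y * t - f y - (e y * t' - f' y))
      with (e y * (t - t') + - (f y - f' y)) by ring.
    eapply Rle_trans; [apply Rabs_triang|]; rewrite Rabs_Ropp, Rabs_mult.
    pose proof (exp_e _ _ _ _ _ _ _ HE y) as He; pose proof (exp_lam _ _ _ _ _ _ _ HE).
    rewrite (Rabs_right (e y)) by lra.
    apply Rplus_le_compat; [|apply Hf].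
    apply Rmult_le_compat; try apply Rabs_pos; lra.
  - simpl length; rewrite S_INR; simpl.
    assert (0 < Lam ^ length u) by (apply pow_lt; lra).
    replace (Lam * Lam ^ length u * (d + (INR (length u) + 1) * ep))
      with (Lam ^ length u * (Lam * d + Lam * ((INR (length u) + 1) * ep))) by ring.
    apply Rmult_le_compat_l; [lra|].
    assert (0 <= (INR (length u) + 1) * ep)
      by (apply Rmult_le_pos; [pose proof (pos_INR (length u)); lra|easy]).
    nra.
Qed.

Lemma sl_surjective f x u s : exists t, sl g e f x t u = s.
Proof.
  revert x; induction u as [|j u IH]; intro x; simpl; [now exists s|].
  set (y := g (x + INR j)); destruct (IH y) as [t Ht]; pose proof (e_pos y).
  exists ((t + f y) / e y).
  replace (e y * ((t + f y) / e y) - f y) with t by (field; lra); easy.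
Qed.

End Expanding.

(** * Dependence of slopes on the perturbation *)

(** [zf g e b x u] is minus the derivative of [sl g e f x t u] when [f] moves in the direction
    [b]; [zn] is the same quantity divided by [dr g e x u]. *)
Fixpoint zf (g e b : R -> R) (x : R) (u : list nat) : R :=
  match u with
  | [] => 0
  | j :: v => dr g e (g (x + INR j)) v * b (g (x + INR j)) + zf g e b (g (x + INR j)) v
  end.

Fixpoint zn (g e b : R -> R) (x : R) (u : list nat) : R :=
  match u with
  | [] => 0
  | j :: v => (b (g (x + INR j)) + zn g e b (g (x + INR j)) v) / e (g (x + INR j))
  end.

Lemma sl_shift g e f x t s u : sl g e f x (t + s) u = sl g e f x t u + dr g e x u * s.
Proof.
  revert x t s; induction u as [|j u IH]; intros x t s; simpl; [ring|].
  set (y := g (x + INR j)).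
  replace (e y * (t + s) - f y) with (e y * t - f y + e y * s) by ring.
  rewrite IH; ring.
Qed.

(** Pulled back slopes are affine in [f], so the formula has no error term and hitting the cone
    becomes a linear condition on the parameters. *)
Lemma sl_combination {I} g e f (c : I -> R) (b : I -> R -> R) (L : list I) u : forall x t,
  sl g e (fun y => f y + sumR (fun i => c i * b i y) L) x t u
  = sl g e f x t u - sumR (fun i => c i * zf g e (b i) x u) L.
Proof.
  induction u as [|j u IH]; intros x t; simpl.
  - rewrite (sumR_ext _ (fun _ => 0)), sumR_const by (intros; ring); ring.
  - set (y := g (x + INR j)); rewrite IH.
    replace (e y * t - (f y + sumR (fun i => c i * b i y) L))
      with (e y * t - f y + - sumR (fun i => c i * b i y) L) by ring.
    rewrite sl_shift.
    rewrite (sumR_ext (fun i => c i * (dr g e y u * b i y + zf g e (b i) y u))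
      (fun i => dr g e y u * (c i * b i y) + c i * zf g e (b i) y u)) by (intros; ring).
    rewrite sumR_plus, sumR_scal; ring.
Qed.

Section Sensitivity.

Context {l : nat} {E e g : R -> R} {lam Lam CE : R} (HE : expanding l E e g lam Lam CE).

(** Dividing by the derivative along [q] leaves the prefix with its unscaled sensitivity, while each
    point of [q] is weighted by the inverse derivative up to it; the latter weights decay
    geometrically. *)
Lemma zf_app b x p q :
  zf g e b x (p ++ q) = dr g e (pt g x p) q * (zf g e b x p + zn g e b (pt g x p) q).
Proof.
  revert x; induction p as [|j p IH]; intro x; simpl.
  - rewrite Rplus_0_l; revert x; induction q as [|j q IH]; intro x; simpl; [ring|].
    rewrite IH; set (y := g (x + INR j)); pose proof (e_pos HE y); field; lra.
  - rewrite IH, dr_app; ring.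
Qed.

(** Off-diagonal entries: the bump is small along the controlled stretch [p], and along the
    uncontrolled rest [q] the weights already carry [lam ^ (- length p)]. *)
Lemma zn_small b et x p q : 0 <= et ->
  (forall y, Rabs (b y) <= 1) -> (forall y, In y (orb g x p) -> Rabs (b y) <= et) ->
  Rabs (zn g e b x (p ++ q)) <= et / (lam - 1) + (/ lam) ^ length p / (lam - 1).
Proof.
  intros Het Hb; pose proof (exp_lam _ _ _ _ _ _ _ HE) as Hlam.
  assert (Hi : 0 < / (lam - 1)) by (apply Rinv_0_lt_compat; lra).
  assert (Hstep : forall y z B1 B2, Rabs (b y) <= B1 -> Rabs z <= B2 ->
     Rabs ((b y + z) / e y) <= (B1 + B2) / lam).
  { intros y z B1 B2 H1 H2; pose proof (exp_e _ _ _ _ _ _ _ HE y).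
    unfold Rdiv; rewrite Rabs_mult, (Rabs_right (/ e y))
      by (apply Rle_ge; left; apply Rinv_0_lt_compat; lra).
    apply Rmult_le_compat; [apply Rabs_pos|left; apply Rinv_0_lt_compat; lra| |].
    - eapply Rle_trans; [apply Rabs_triang|]; lra.
    - apply Rinv_le_contravar; lra. }
  revert x; induction p as [|j p IH]; intros x Hp; simpl.
  - assert (H : Rabs (zn g e b x q) <= / (lam - 1)).
    { clear Hp; revert x; induction q as [|j q IH]; intro x; simpl; [rewrite Rabs_R0; lra|].
      replace (/ (lam - 1)) with ((1 + / (lam - 1)) / lam) by (field; lra); auto. }
    assert (0 <= et / (lam - 1)) by (apply Rmult_le_pos; lra); lra.
  - replace (et / (lam - 1) + / lam * (/ lam) ^ length p / (lam - 1))
      with ((et + (et / (lam - 1) + (/ lam) ^ length p / (lam - 1))) / lam) by (field; lra).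
    simpl in Hp; apply Hstep; [apply Hp; now left|].
    apply IH; intros; apply Hp; now right.
Qed.

(** Diagonal entries: nothing prevents a branch from returning to its own bump, but such returns
    push in the same direction, so a one-sided bound suffices. *)
Lemma zn_ge b c x q : 0 <= c -> (forall y, - c <= b y) -> - c / (lam - 1) <= zn g e b x q.
Proof.
  intros Hc Hb; pose proof (exp_lam _ _ _ _ _ _ _ HE) as Hlam.
  assert (Hi : 0 < / (lam - 1)) by (apply Rinv_0_lt_compat; lra).
  assert (Hq : 0 <= c * / (lam - 1)) by (apply Rmult_le_pos; lra).
  revert x; induction q as [|j q IH]; intro x; simpl; [unfold Rdiv; lra|].
  set (y := g (x + INR j)); specialize (IH y); specialize (Hb y).
  pose proof (exp_e _ _ _ _ _ _ _ HE y).
  apply Rmult_le_reg_r with (e y); [lra|].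
  replace ((b y + zn g e b y q) / e y * e y) with (b y + zn g e b y q) by (field; lra).
  assert (H1 : c * / (lam - 1) * lam = c + c * / (lam - 1)) by (field; lra).
  assert (H2 : c * / (lam - 1) * lam <= c * / (lam - 1) * e y)
    by (apply Rmult_le_compat_l; lra).
  unfold Rdiv in *; nra.
Qed.

Lemma zf_small b et x p : 0 <= et ->
  (forall y, In y (orb g x p) -> Rabs (b y) <= et) ->
  Rabs (zf g e b x p) <= et * (INR (length p) * Lam ^ length p).
Proof.
  intro Het; pose proof (Lam_gt1 HE) as HL.
  revert x; induction p as [|j p IH]; intros x Hp; [simpl; rewrite Rabs_R0; lra|].
  simpl length; rewrite S_INR; simpl in *; set (y := g (x + INR j)) in *.
  assert (H1 : Rabs (zf g e b y p) <= et * (INR (length p) * Lam ^ length p)) by auto.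
  assert (H2 : Rabs (dr g e y p * b y) <= Lam ^ length p * et).
  { rewrite Rabs_mult; pose proof (dr_bounds HE y p); pose proof (dr_pos HE y p).
    rewrite Rabs_right by lra.
    apply Rmult_le_compat; [lra|apply Rabs_pos|easy|auto]. }
  assert (H3 : 0 <= et * ((INR (length p) + 1) * Lam ^ length p)).
  { apply Rmult_le_pos; [easy|]; apply Rmult_le_pos;
      [pose proof (pos_INR (length p)); lra|apply pow_le; lra]. }
  eapply Rle_trans; [apply Rabs_triang|].
  replace (et * ((INR (length p) + 1) * (Lam * Lam ^ length p)))
    with (Lam * (et * ((INR (length p) + 1) * Lam ^ length p))) by ring.
  nra.
Qed.

(** The last point of [p] enters with weight 1 and supplies [be]; each point has weight at most
    [Lam ^ length p] and can lose at most [c] times that. *)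
Lemma zf_ge b c be x p : 0 <= c -> (forall y, - c <= b y) -> p <> [] -> be <= b (pt g x p) ->
  be - c * (INR (length p) * Lam ^ length p) <= zf g e b x p.
Proof.
  intros Hc Hb; pose proof (Lam_gt1 HE) as HL.
  revert x; induction p as [|j p IH]; [easy|]; intros x _ Hbe.
  simpl length; rewrite S_INR; simpl in *; set (y := g (x + INR j)) in *.
  assert (Hpow : 0 < Lam ^ length p) by (apply pow_lt; lra).
  assert (H3 : 0 <= c * ((INR (length p) + 1) * Lam ^ length p)).
  { apply Rmult_le_pos; [easy|]; apply Rmult_le_pos;
      [pose proof (pos_INR (length p)); lra|lra]. }
  assert (H4 : c * ((INR (length p) + 1) * Lam ^ length p)
     <= c * ((INR (length p) + 1) * (Lam * Lam ^ length p))).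
  { replace (c * ((INR (length p) + 1) * (Lam * Lam ^ length p)))
    with (Lam * (c * ((INR (length p) + 1) * Lam ^ length p))) by ring; nra. }
  destruct p as [|k p].
  - simpl in *; lra.
  - assert (H1 : be - c * (INR (length (k :: p)) * Lam ^ length (k :: p))
                 <= zf g e b y (k :: p)) by (apply IH; easy).
    assert (H2 : - c * Lam ^ length (k :: p) <= dr g e y (k :: p) * b y).
    { pose proof (dr_bounds HE y (k :: p)); pose proof (dr_pos HE y (k :: p)).
      specialize (Hb y); nra. }
    lra.
Qed.

End Sensitivity.

(** * Trigonometric bumps *)

(** Trigonometric polynomials in [PI * (y - a)] as syntax: they are closed under differentiation,
    and induction bounds every derivative uniformly in the centre [a]. *)
Inductive trig : Type :=
| Cst (c : R) | Cos | Sin | Add (p q : trig) | Mul (p q : trig).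

Fixpoint teval (p : trig) (a y : R) : R :=
  match p with
  | Cst c => c
  | Cos => cos (PI * (y - a))
  | Sin => sin (PI * (y - a))
  | Add p q => teval p a y + teval q a y
  | Mul p q => teval p a y * teval q a y
  end.

Fixpoint tderiv (p : trig) : trig :=
  match p with
  | Cst c => Cst 0
  | Cos => Mul (Cst (- PI)) Sin
  | Sin => Mul (Cst PI) Cos
  | Add p q => Add (tderiv p) (tderiv q)
  | Mul p q => Add (Mul (tderiv p) q) (Mul p (tderiv q))
  end.

Lemma teval_deriv p a y : derivable_pt_lim (teval p a) y (teval (tderiv p) a y).
Proof.
  assert (Hl : derivable_pt_lim (fun y => PI * (y - a)) y PI).
  { enough (H : derivable_pt_lim (fun y => PI * (y - a)) y (PI * (1 - 0)))
      by now rewrite Rminus_0_r, Rmult_1_r in H.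
    apply (derivable_pt_lim_scal (fun y => y - a)).
    apply (derivable_pt_lim_minus id (fun _ => a));
      [apply derivable_pt_lim_id|apply derivable_pt_lim_const]. }
  induction p as [c| | |p IHp q IHq|p IHp q IHq]; simpl.
  - apply derivable_pt_lim_const.
  - replace (- PI * sin (PI * (y - a))) with (- sin (PI * (y - a)) * PI) by ring.
    apply (derivable_pt_lim_comp (fun y => PI * (y - a)) cos); [easy|].
    apply derivable_pt_lim_cos.
  - replace (PI * cos (PI * (y - a))) with (cos (PI * (y - a)) * PI) by ring.
    apply (derivable_pt_lim_comp (fun y => PI * (y - a)) sin); [easy|].
    apply derivable_pt_lim_sin.
  - now apply (derivable_pt_lim_plus (teval p a) (teval q a)).
  - now apply (derivable_pt_lim_mult (teval p a) (teval q a)).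
Qed.

Lemma teval_bounded p : exists M, 0 <= M /\ forall a y, Rabs (teval p a y) <= M.
Proof.
  induction p as [c| | |p (M & HM & Hp) q (N & HN & Hq)|p (M & HM & Hp) q (N & HN & Hq)]; simpl.
  - exists (Rabs c); split; [apply Rabs_pos|intros; lra].
  - exists 1; split; [lra|]; intros; apply Rabs_le, COS_bound.
  - exists 1; split; [lra|]; intros; apply Rabs_le, SIN_bound.
  - exists (M + N); split; [lra|]; intros; eapply Rle_trans; [apply Rabs_triang|].
    now apply Rplus_le_compat.
  - exists (M * N); split; [now apply Rmult_le_pos|]; intros; rewrite Rabs_mult.
    apply Rmult_le_compat; auto using Rabs_pos.
Qed.

Fixpoint tpow (p : trig) (n : nat) : trig :=
  match n with O => Cst 1 | S m => Mul p (tpow p m) end.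

Lemma teval_tpow p n a y : teval (tpow p n) a y = teval p a y ^ n.
Proof. induction n; simpl; congruence. Qed.

(* The mean of [cos ^ (2 K)] over a period. *)
Fixpoint wal (K : nat) : R :=
  match K with
  | O => 1
  | S k => wal k * ((2 * INR k + 1) / (2 * INR k + 2))
  end.

(* Integration by parts: a primitive of [PI * (cos ^ (2 K) - wal K)]. *)
Fixpoint tprim (K : nat) : trig :=
  match K with
  | O => Cst 0
  | S k => Add (Mul (Cst (/ (2 * INR k + 2))) (Mul (tpow Cos (2 * k + 1)) Sin))
               (Mul (Cst ((2 * INR k + 1) / (2 * INR k + 2))) (tprim k))
  end.

(** The mean is subtracted so that the bump has a periodic primitive, which is what perturbs [tau].
    The price is negative values, down to [- wal K]. *)
Definition bmp (K : nat) (a y : R) : R := cos (PI * (y - a)) ^ (2 * K) - wal K.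

Lemma teval_tderiv_tpow n a y :
  teval (tderiv (tpow Cos (S n))) a y
  = - PI * INR (S n) * sin (PI * (y - a)) * cos (PI * (y - a)) ^ n.
Proof.
  induction n as [|n IH]; [simpl; ring|].
  change (tderiv (tpow Cos (S (S n)))) with
    (Add (Mul (tderiv Cos) (tpow Cos (S n))) (Mul Cos (tderiv (tpow Cos (S n))))).
  cbn [teval]; rewrite IH, teval_tpow, !S_INR; simpl; ring.
Qed.

Lemma teval_tderiv_tprim K a y : teval (tderiv (tprim K)) a y = PI * bmp K a y.
Proof.
  unfold bmp; induction K as [|k IH]; [simpl; ring|].
  cbn [tprim tderiv]; cbn [teval]; rewrite IH.
  replace (2 * k + 1)%nat with (S (2 * k)) by lia.
  rewrite teval_tderiv_tpow, teval_tpow.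
  cbn [tderiv teval wal]; replace (2 * S k)%nat with (S (S (2 * k))) by lia.
  rewrite S_INR, mult_INR; simpl (INR 2).
  pose proof (pos_INR k); pose proof (sin2_cos2 (PI * (y - a))) as Hsc; unfold Rsqr in Hsc.
  set (c := cos _) in *; set (s := sin _) in *.
  assert (Hs : s * s = 1 - c * c) by lra.
  replace (/ (2 * INR k + 2) *
    (- PI * ((1 + 1) * INR k + 1) * s * c ^ (2 * k) * s
      + c ^ S (2 * k) * (PI * c)))
  with (/ (2 * INR k + 2) *
    (- PI * (2 * INR k + 1) * (s * s) * c ^ (2 * k) + c ^ S (2 * k) * (PI * c))) by ring.
  rewrite Hs; simpl; field_simplify; [|lra|lra]; try easy.
Qed.

(** Cosine and sine both change sign under [y |-> y + 1], and they occur with even total degree. *)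
Lemma tprim_periodic K a y : teval (tprim K) a (y + 1) = teval (tprim K) a y.
Proof.
  induction K as [|k IH]; [easy|].
  cbn [tprim teval]; rewrite IH, !teval_tpow; cbn [teval].
  replace (PI * (y + 1 - a)) with (PI * (y - a) + PI) by ring.
  rewrite neg_cos, neg_sin.
  replace (2 * k + 1)%nat with (S (2 * k)) by lia.
  replace ((- cos (PI * (y - a))) ^ S (2 * k)) with (- cos (PI * (y - a)) ^ S (2 * k)); [ring|].
  rewrite <- !tech_pow_Rmult, !pow_mult.
  replace ((- cos (PI * (y - a))) ^ 2) with (cos (PI * (y - a)) ^ 2) by ring; ring.
Qed.

(** The square of [wal K <= 1 / sqrt (K + 1)], a form that passes through the recursion and shows
    that [wal K] tends to 0. *)
Lemma wal_bounds K : 0 < wal K /\ wal K * wal K * (INR K + 1) <= 1.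
Proof.
  induction K as [|k [IH1 IH2]]; [simpl; lra|].
  cbn [wal]; rewrite S_INR; pose proof (pos_INR k) as Hk; set (w := wal k) in *.
  set (n := INR k) in *; split.
  - apply Rmult_lt_0_compat; [easy|]; apply Rmult_lt_0_compat; [lra|].
    apply Rinv_0_lt_compat; lra.
  - replace (w * ((2 * n + 1) / (2 * n + 2)) * (w * ((2 * n + 1) / (2 * n + 2))) * (n + 1 + 1))
      with ((w * w * (n + 1)) * ((2 * n + 1) * (2 * n + 1) * (n + 2)
             / ((2 * n + 2) * (2 * n + 2) * (n + 1)))) by (field; lra).
    apply Rle_trans with (1 * 1); [apply Rmult_le_compat|lra].
    + apply Rmult_le_pos; [apply Rmult_le_pos|]; lra.
    + apply Rmult_le_pos; [repeat apply Rmult_le_pos; lra|].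
      left; apply Rinv_0_lt_compat; repeat apply Rmult_lt_0_compat; lra.
    + easy.
    + assert (Hden : 0 < (2 * n + 2) * (2 * n + 2) * (n + 1))
        by (repeat apply Rmult_lt_0_compat; lra).
      apply Rmult_le_reg_r with ((2 * n + 2) * (2 * n + 2) * (n + 1)); [easy|].
      unfold Rdiv; rewrite Rmult_assoc, Rinv_l by lra; nra.
Qed.

Lemma bmp_bounds K a y : - wal K <= bmp K a y /\ Rabs (bmp K a y) <= 1.
Proof.
  unfold bmp; destruct (wal_bounds K) as [H1 H2].
  assert (Hw : wal K <= 1).
  { pose proof (pos_INR K); destruct (Rle_dec (wal K) 1); [easy|exfalso]; nra. }
  rewrite pow_mult.
  assert (Hc : 0 <= cos (PI * (y - a)) ^ 2 <= 1).
  { pose proof (COS_bound (PI * (y - a))); nra. }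
  set (z := cos (PI * (y - a)) ^ 2) in *.
  assert (Hz : 0 <= z ^ K <= 1).
  { split; [now apply pow_le|]; rewrite <- (pow1 K); now apply pow_incr. }
  split; [lra|]; apply Rabs_le; lra.
Qed.

Lemma cos2_IZR z (n : Z) : cos (z + IZR n * PI) ^ 2 = cos z ^ 2.
Proof.
  assert (H := periodic_IZR (fun u => cos (u * PI) ^ 2) 0).
  assert (HP := PI_RGT_0).
  replace (z + IZR n * PI) with ((z / PI + IZR n) * PI) by (field; lra).
  rewrite H.
  - replace (z / PI * PI) with z by (field; lra); ring.
  - intro x; rewrite Rmult_plus_distr_r, Rmult_1_l, neg_cos; ring.
Qed.

Lemma cos2_far d y a : 0 < d <= 1 / 2 -> far d y a ->
  cos (PI * (y - a)) ^ 2 <= 1 - sin (PI * d) ^ 2.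
Proof.
  intros Hd Hf; pose proof PI_RGT_0 as HP.
  destruct (base_Int_part (y - a)) as [H1 H2].
  set (n := Int_part (y - a)) in *; set (z := y - a - IZR n).
  replace (PI * (y - a)) with (PI * z + IZR n * PI) by (unfold z; ring).
  rewrite cos2_IZR.
  assert (Hz1 : d <= z).
  { specialize (Hf n); rewrite Rabs_right in Hf; unfold z; lra. }
  assert (Hz2 : z <= 1 - d).
  { specialize (Hf (n + 1)%Z); rewrite plus_IZR, Rabs_left1 in Hf; unfold z; lra. }
  assert (Hs0 : 0 <= sin (PI * d)) by (apply sin_ge_0; nra).
  assert (Hs : sin (PI * d) <= sin (PI * z)).
  { destruct (Rle_dec z (1 / 2)) as [H|H].
    - apply sin_incr_1; nra.
    - replace (sin (PI * z)) with (sin (PI * (1 - z))).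
      + apply sin_incr_1; nra.
      + replace (PI * (1 - z)) with (PI - PI * z) by ring; apply sin_PI_x. }
  pose proof (sin2_cos2 (PI * z)) as Hsc; unfold Rsqr in Hsc; nra.
Qed.

(** A large [K] makes both the mean and the values away from the centre small. Only after [K] is
    fixed does continuity of [cos ^ (2 K)] at 0 provide the radius [ka] on which it stays above
    [1 / 2]. *)
Lemma bump_exists et d : 0 < et -> 0 < d <= 1 / 2 -> exists K, wal K <= et /\
  (forall a y, far d y a -> Rabs (bmp K a y) <= et) /\
  exists ka, 0 < ka /\ forall a y n, Rabs (y - a - IZR n) <= ka -> 1 / 2 - et <= bmp K a y.
Proof.
  intros Het Hd; pose proof PI_RGT_0 as HP.
  set (q := 1 - sin (PI * d) ^ 2).
  assert (Hs : 0 < sin (PI * d)) by (apply sin_gt_0; nra).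
  assert (Hq : 0 <= q < 1) by (unfold q; pose proof (SIN_bound (PI * d)); nra).
  destruct (pow_lt_1_zero q ltac:(rewrite Rabs_right; lra) et Het) as [K1 HK1].
  destruct (INR_unbounded (/ (et * et))) as [K2 HK2].
  set (K := Nat.max K1 K2).
  assert (Hw : wal K <= et).
  { destruct (wal_bounds K) as [W1 W2].
    assert (HK : INR K2 <= INR K) by (apply le_INR; unfold K; lia).
    destruct (Rle_dec (wal K) et) as [|Hn]; [easy|exfalso].
    assert (H1 : 1 < et * et * (INR K + 1)).
    { apply Rmult_lt_reg_l with (/ (et * et)); [apply Rinv_0_lt_compat; nra|].
      rewrite <- Rmult_assoc, Rinv_l by nra; lra. }
    assert (et * et <= wal K * wal K) by nra.
    pose proof (pos_INR K); nra. }
  exists K; split; [easy|]; split.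
  - intros a y Hf; destruct (wal_bounds K) as [W1 _].
    assert (Hc := cos2_far d y a Hd Hf); fold q in Hc.
    unfold bmp; rewrite pow_mult.
    assert (Hp : 0 <= (cos (PI * (y - a)) ^ 2) ^ K <= q ^ K).
    { split; [apply pow_le; apply pow2_ge_0|apply pow_incr; split; [apply pow2_ge_0|easy]]. }
    specialize (HK1 K ltac:(unfold K; lia)).
    pose proof (Rle_abs (q ^ K)); apply Rabs_le; lra.
  - assert (Hcont : continuity_pt (fun z => cos z ^ (2 * K)) 0).
    { apply derivable_continuous_pt.
      apply (derivable_pt_comp cos (fun x => x ^ (2 * K)));
        [apply derivable_pt_cos|apply derivable_pt_pow]. }
    destruct (Hcont (1 / 2) ltac:(lra)) as (al & Hal & Hc).
    exists (al / (2 * PI)); split; [apply Rmult_lt_0_compat; [lra|apply Rinv_0_lt_compat; lra]|].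
    intros a y n Hn; unfold bmp.
    set (z := y - a - IZR n) in *.
    replace (PI * (y - a)) with (PI * z + IZR n * PI) by (unfold z; ring).
    rewrite pow_mult, cos2_IZR, <- pow_mult.
    enough (1 / 2 <= cos (PI * z) ^ (2 * K)) by lra.
    destruct (Req_dec (PI * z) 0) as [Hz|Hz].
    + rewrite Hz, cos_0, pow1; lra.
    + specialize (Hc (PI * z)); simpl in Hc; unfold Rdist in Hc.
      rewrite cos_0, pow1 in Hc.
      assert (Hlt : Rabs (cos (PI * z) ^ (K + (K + 0)) - 1) < 1 / 2).
      { apply Hc; split; [split; [exact I|congruence]|].
        rewrite Rminus_0_r, Rabs_mult, (Rabs_right PI) by lra.
        apply Rle_lt_trans with (PI * (al / (2 * PI))); [apply Rmult_le_compat_l; lra|].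
        replace (PI * (al / (2 * PI))) with (al / 2) by (field; lra); lra. }
      apply Rabs_def2 in Hlt; simpl (2 * K)%nat; lra.
Qed.

(** [P 0] is added to [tau], [P 1] is the bump that acts on slopes, and the higher [P k] control the
    distance in the [C^r] topology. *)
Lemma bump_primitive K : exists P : nat -> R -> R -> R,
  (forall k a y, derivable_pt_lim (P k a) y (P (S k) a y)) /\
  (forall a y, P 1%nat a y = bmp K a y) /\
  (forall a y, P 0%nat a (y + 1) = P 0%nat a y) /\
  (forall k, exists M, 0 <= M /\ forall a y, Rabs (P k a y) <= M).
Proof.
  pose proof PI_RGT_0 as HP.
  exists (fun k a y => teval (Nat.iter k tderiv (Mul (Cst (/ PI)) (tprim K))) a y).
  repeat split.
  - intros; apply teval_deriv.
  - intros; simpl; rewrite teval_tderiv_tprim; field; lra.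
  - intros; simpl; now rewrite tprim_periodic.
  - intro k; apply teval_bounded.
Qed.

(** * The moment estimate *)

(** Noninterference: no branch [PP_j] passes within [de] of the [nu]-th point of
    another branch [PP_k]. *)
Definition nonconf (g : R -> R) (x : R) (nu : nat) (de : R) (D : nat) (PP : list (list nat)) :=
  forall j k, (j < D)%nat -> (k < D)%nat -> j <> k ->
  forall y, In y (orb g x (nth j PP [])) -> far de y (pt g x (firstn nu (nth k PP []))).

Definition good (l : nat) (g e f : R -> R) (th q : R) (n : nat) (x t : R) (P : list nat) : Prop :=
  q ^ n <= INR (cnt l g e f th n (pt g x P) (sl g e f x t P)).

Lemma near_grid_index (G : nat) y : (0 < G)%nat ->
  exists i, (i < G)%nat /\ exists n, Rabs (y - INR i / INR G - IZR n) <= / INR G.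
Proof.
  intro HG; assert (HG' : 0 < INR G) by (apply lt_0_INR; lia).
  destruct (base_Int_part y) as [H1 H2]; set (n := Int_part y) in *.
  destruct (nfloor_spec (INR G * (y - IZR n))) as [H3 H4]; [apply Rmult_le_pos; lra|].
  set (i := nfloor _) in *; exists i; split.
  - apply INR_lt; nra.
  - exists n.
    replace (y - INR i / INR G - IZR n) with ((INR G * (y - IZR n) - INR i) * / INR G)
      by (field; lra).
    assert (Hi : 0 < / INR G) by now apply Rinv_0_lt_compat.
    rewrite Rabs_mult, (Rabs_right (/ INR G)) by lra.
    rewrite <- (Rmult_1_l (/ INR G)) at 2; apply Rmult_le_compat_r; [lra|].
    apply Rabs_le; lra.
Qed.

Lemma far_near d r a b c n : far d a b -> Rabs (b - c - IZR n) <= r -> far (d - r) a c.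
Proof.
  intros Hf Hr m; specialize (Hf (m - n)%Z); rewrite minus_IZR in Hf.
  replace (a - b - (IZR m - IZR n)) with ((a - c - IZR m) + - (b - c - IZR n)) in Hf by ring.
  pose proof (Rabs_triang (a - c - IZR m) (- (b - c - IZR n))) as H.
  rewrite Rabs_Ropp in H; lra.
Qed.

Section Moments.

Context {l : nat} {E e g : R -> R} {lam Lam CE : R} (HE : expanding l E e g lam Lam CE).

Lemma cnt_add f th n m x t :
  INR (cnt l g e f th (n + m) x t)
  = sumR (fun p => INR (cnt l g e f th m (pt g x p) (sl g e f x t p))) (words l n).
Proof.
  unfold cnt; rewrite count_sumR, sumR_words_add; apply sumR_ext; intros p _.
  rewrite count_sumR; apply sumR_ext; intros q _; now rewrite sl_app.
Qed.

Lemma cnt_periodic f th n x t : (forall y, f (y + 1) = f y) ->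
  cnt l g e f th n (x + 1) t = cnt l g e f th n x t.
Proof.
  intro Hf; apply INR_eq; unfold cnt; rewrite !count_sumR.
  exact (sumR_branches_periodic HE f (fun _ s => indic (Rabs s <= th)) n Hf
           ltac:(easy) x t).
Qed.

Lemma cnt_le_pow f th n x t : INR (cnt l g e f th n x t) <= INR l ^ n.
Proof.
  rewrite <- pow_INR, <- length_words; apply le_INR, count_le_length.
Qed.

Lemma count_good_periodic f th q n m x t (k : Z) : (forall y, f (y + 1) = f y) ->
  count (good l g e f th q n (x + IZR k) t) (words l m)
  = count (good l g e f th q n x t) (words l m).
Proof.
  intro Hf; apply INR_eq; rewrite !count_sumR; unfold good.
  rewrite (periodic_IZR (fun x => sumR (fun P =>
     indic (q ^ n <= INR (cnt l g e f th n (pt g x P) (sl g e f x t P)))) (words l m)) 0).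
  - ring.
  - intro y; rewrite Rplus_0_r.
    apply (sumR_branches_periodic HE f (fun y s => indic (q ^ n <= INR (cnt l g e f th n y s))) m Hf).
    intros; now rewrite cnt_periodic.
Qed.

(** Split off the first [N] digits. The prefixes that are not good contribute less than [q ^ n]
    each; the good ones, fewer than [D <= q ^ N], contribute at most the previous bound each. The
    exponential rate is thus [q], with a factor linear in [i]. *)
Lemma cnt_growth f th q n0 N D I : 1 < q -> INR D <= q ^ N ->
  (forall i x t, (i < I)%nat ->
     (count (good l g e f th q (n0 + i * N) x t) (words l N) < D)%nat) ->
  forall i, (i <= I)%nat -> forall x t,
  INR (cnt l g e f th (n0 + i * N) x t)
  <= q ^ (i * N) * (INR l ^ n0 + INR i * (INR l ^ N * q ^ n0)).
Proof.
  intros Hq HD Hgood; induction i as [|i IH]; intros Hi x t.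
  - simpl; replace (n0 + 0)%nat with n0 by lia; pose proof (cnt_le_pow f th n0 x t); lra.
  - specialize (IH ltac:(lia)); specialize (Hgood i x t ltac:(lia)).
    set (n := (n0 + i * N)%nat) in *.
    set (M := q ^ (i * N) * (INR l ^ n0 + INR i * (INR l ^ N * q ^ n0))) in *.
    assert (HM : 0 <= M).
    { apply Rle_trans with (INR (cnt l g e f th n x t)); [apply pos_INR|apply IH]. }
    replace (n0 + S i * N)%nat with (N + n)%nat by (unfold n; lia).
    rewrite cnt_add.
    apply Rle_trans with
      (sumR (fun P => M * indic (good l g e f th q n x t P) + q ^ n) (words l N)).
    { apply sumR_le; intros P _.
      assert (Hqn : 0 < q ^ n) by (apply pow_lt; lra).
      destruct (classic (good l g e f th q n x t P)) as [H|H].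
      - rewrite indic_1 by easy; specialize (IH (pt g x P) (sl g e f x t P)); lra.
      - rewrite indic_0 by easy; unfold good in H; lra. }
    rewrite sumR_plus, sumR_scal, sumR_const, <- count_sumR, length_words, pow_INR.
    assert (H1 : M * INR (count (good l g e f th q n x t) (words l N)) <= M * q ^ N).
    { apply Rmult_le_compat_l; [easy|].
      eapply Rle_trans; [|exact HD]; apply le_INR; lia. }
    assert (H2 : q ^ n <= q ^ (S i * N) * q ^ n0).
    { rewrite <- pow_add; apply Rle_pow; [lra|unfold n; lia]. }
    assert (HlN : 0 <= INR l ^ N) by apply pow_le, pos_INR.
    assert (H3 : INR l ^ N * q ^ n <= INR l ^ N * (q ^ (S i * N) * q ^ n0))
      by (now apply Rmult_le_compat_l).
    assert (H4 : M * q ^ N = q ^ (S i * N) * (INR l ^ n0 + INR i * (INR l ^ N * q ^ n0))).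
    { unfold M; replace (S i * N)%nat with (i * N + N)%nat by lia; rewrite pow_add; ring. }
    rewrite S_INR; lra.
Qed.

(* Many good branches over a point force [D] good branches that do not interfere, over a
   point of a fixed finite grid; the radius [th] is doubled to absorb the discretization. *)
Lemma good_branches_on_grid f Rc Cf B nu Q D n q s gx gt :
  0 < Rc -> 0 <= Cf -> (forall y, Rabs (f y) <= Rc) ->
  (forall a b, Rabs (f a - f b) <= Cf * Rabs (a - b)) ->
  (forall y, f (y + 1) = f y) ->
  Lam + Rc / (lam - 1) * CE + Cf <= B ->
  (0 < D)%nat -> 1 < q -> 0 < s ->
  B ^ (nu + Q + n) * s <= Rc / (lam - 1) -> 1 <= INR gx * s -> 2 * (Rc / (lam - 1)) < INR gt * s ->
  (exists x t, (((2 * (nu + Q) + 1) * D) * l ^ Q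
     <= count (good l g e f (Rc / (lam - 1)) q n x t) (words l (nu + Q)))%nat) ->
  exists i j PP, (i < gx)%nat /\ (j < gt)%nat /\
    In PP (lprod (repeat (words l (nu + Q)) D)) /\
    nonconf g (INR i * s) nu (/ Lam ^ nu / 2) D PP /\
    q ^ (n * D) <= prodn D (fun k => sumR (fun u =>
      indic (Rabs (sl g e f (INR i * s) (- (Rc / (lam - 1)) + INR j * s) (nth k PP [] ++ u))
           <= 2 * (Rc / (lam - 1)))) (words l n)).
Proof.
  intros HR HCf Hf Hlip Hper HB HD Hq Hs HBs Hgx Hgt (x0 & t & Hcount).
  pose proof (exp_lam _ _ _ _ _ _ _ HE) as Hlam; pose proof (Lam_gt1 HE) as HLam.
  pose proof (exp_l _ _ _ _ _ _ _ HE) as Hl2.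
  set (th := Rc / (lam - 1)) in *.
  assert (Hth : 0 < th) by (apply Rmult_lt_0_compat; [easy|apply Rinv_0_lt_compat; lra]).
  set (N := (nu + Q)%nat) in *.
  assert (Hx : exists x, 0 <= x < 1 /\
    (((2 * N + 1) * D) * l ^ Q <= count (good l g e f th q n x t) (words l N))%nat).
  { destruct (base_Int_part x0) as [A1 A2]; exists (x0 - IZR (Int_part x0)); split; [lra|].
    rewrite <- (count_good_periodic f th q n N _ t (Int_part x0) Hper).
    now replace (x0 - IZR (Int_part x0) + IZR (Int_part x0)) with x0 by ring. }
  clear x0 Hcount; destruct Hx as (x & Hx & Hcount).
  assert (HlQ : (0 < l ^ Q)%nat) by (apply Nat.neq_0_lt_0, Nat.pow_nonzero; lia).
  assert (Hqn : 1 <= q ^ n) by (apply pow_R1_Rle; lra).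
  (* One good branch already has a continuation that ends in the cone, so [t] itself lies in the
     cone and a bounded range of slopes has to be discretized. *)
  assert (Ht : Rabs t <= th).
  { destruct (count_pos (good l g e f th q n x t) (words l N)) as (P & _ & HP); [nia|].
    unfold good in HP.
    destruct (count_pos (fun u => Rabs (sl g e f (pt g x P) (sl g e f x t P) u) <= th) (words l n))
      as (u & _ & Hu).
    { apply INR_lt; simpl; unfold cnt in HP; lra. }
    rewrite <- sl_app in Hu; apply (sl_in_cone HE f Rc (P ++ u)) in Hu; [easy|lra|easy]. }
  assert (Ht' : - th <= t <= th) by (unfold Rabs in Ht; destruct (Rcase_abs t); lra).
  assert (Hgrid : forall z, 0 <= z -> INR (nfloor (z / s)) * s <= z /\ z - INR (nfloor (z / s)) * s <= s).
  { intros z Hz.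
    assert (Hzs : 0 <= z / s) by (apply Rmult_le_pos; [easy|left; now apply Rinv_0_lt_compat]).
    destruct (nfloor_spec (z / s) Hzs) as [A1 A2].
    assert (Ez : z = z / s * s) by (field; lra); split; nra. }
  destruct (Hgrid x ltac:(lra)) as [X1 X2]; destruct (Hgrid (t + th) ltac:(lra)) as [T1 T2].
  set (i := nfloor (x / s)) in *; set (j := nfloor ((t + th) / s)) in *.
  set (xg := INR i * s) in *; set (tg := - th + INR j * s).
  (* The Lipschitz bound over length [N + n] costs at most [th], by the choice of the mesh [s]. *)
  assert (Hclose : forall P u, In P (words l N) -> In u (words l n) ->
    Rabs (sl g e f x t (P ++ u)) <= th -> Rabs (sl g e f xg tg (P ++ u)) <= 2 * th).
  { intros P u HP Hu Hsl.
    apply In_words in HP as [HP _]; apply In_words in Hu as [Hu _].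
    assert (Hd := sl_lipschitz HE f Rc Cf B (P ++ u) ltac:(lra) HCf Hf Hlip HB x t xg tg s
      ltac:(apply Rabs_le; lra) ltac:(unfold tg; apply Rabs_le; lra) Hsl).
    rewrite length_app, HP, Hu in Hd.
    replace (sl g e f xg tg (P ++ u))
      with (sl g e f x t (P ++ u) + - (sl g e f x t (P ++ u) - sl g e f xg tg (P ++ u))) by ring.
    eapply Rle_trans; [apply Rabs_triang|]; rewrite Rabs_Ropp; lra. }
  set (Lg := filter (fun P => dec (good l g e f th q n x t P)) (words l N)).
  assert (HLg : forall P, In P Lg <-> In P (words l N) /\ good l g e f th q n x t P).
  { intro P; unfold Lg; rewrite filter_In, dec_true; easy. }
  (* Prefixes of length [nu] are separated, which whole words need not be at the scale of the bumps.
     A prefix has at most [l ^ Q] good extensions, whence the factor [l ^ Q] in the hypothesis. *)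
  set (Lp := nodup (list_eq_dec Nat.eq_dec) (map (firstn nu) Lg)).
  assert (HLp : forall p, In p Lp -> exists v, In (p ++ v) Lg /\ length p = nu).
  { intros p Hp; unfold Lp in Hp; apply nodup_In, in_map_iff in Hp as (P & <- & HP).
    exists (skipn nu P); rewrite firstn_skipn; split; [easy|].
    apply HLg in HP as [HP _]; apply In_words in HP as [HP _].
    apply firstn_length_le; unfold N in HP; lia. }
  assert (HLplen : ((2 * N + 1) * D <= length Lp)%nat).
  { assert (Hinc : incl Lg (flat_map (fun p => map (app p) (words l Q)) Lp)).
    { intros P HP; apply in_flat_map; exists (firstn nu P); split.
      - apply nodup_In, in_map, HP.
      - apply in_map_iff; exists (skipn nu P); rewrite firstn_skipn; split; [easy|].
        apply HLg in HP as [HP _]; apply In_words in HP as [HP1 HP2].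
        apply In_words; split; [rewrite length_skipn; unfold N in HP1; lia|].
        intros k Hk; apply HP2; rewrite <- (firstn_skipn nu P); apply in_app_iff; now right. }
    apply NoDup_incl_length in Hinc; [|apply NoDup_filter, NoDup_words].
    rewrite (flat_map_constant_length (c := (l ^ Q)%nat)) in Hinc
      by (intros; now rewrite length_map, length_words).
    change (length Lg) with (count (good l g e f th q n x t) (words l N)) in Hinc.
    nia. }
  set (ext := fun p => epsilon (inhabits []) (fun v => In (p ++ v) Lg)).
  assert (Hext : forall p, In p Lp -> In (p ++ ext p) Lg /\ length p = nu).
  { intros p Hp; destruct (HLp p Hp) as (v & Hv & Hlen); split; [|easy].
    apply (epsilon_spec (inhabits []) (fun v => In (p ++ v) Lg)); eauto. }
  assert (Hpw : forall p, In p Lp -> In p (words l nu)).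
  { intros p Hp; destruct (Hext p Hp) as [H1 H2]; apply HLg in H1 as [H1 _].
    apply In_words in H1 as [_ H1]; apply In_words; split; [easy|].
    intros k Hk; apply H1, in_app_iff; now left. }
  set (de := / Lam ^ nu / 2) in *.
  assert (Hpow : 0 < / Lam ^ nu) by (apply Rinv_0_lt_compat, pow_lt; lra).
  (* Goodness is known over [x], but noninterference is arranged over the grid point [xg], where the
     parameters will be counted. *)
  set (conf := fun p p' => p <> p' /\
    exists y, In y (orb g xg (p' ++ ext p')) /\ ~ far de y (pt g xg p)).
  destruct (independent_set conf N D Lp) as (L' & HL'len & HL'nd & HL'inc & HL'indic).
  - apply NoDup_nodup.
  - intros p' Hp'.
    set (wit := fun p => epsilon (inhabits 0)
      (fun y => In y (orb g xg (p' ++ ext p')) /\ ~ far de y (pt g xg p))).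
    assert (Hwit : forall p, conf p p' ->
      In (wit p) (orb g xg (p' ++ ext p')) /\ ~ far de (wit p) (pt g xg p)).
    { intros p [_ Hp]; unfold wit.
      now apply (epsilon_spec (inhabits 0)
        (fun y => In y (orb g xg (p' ++ ext p')) /\ ~ far de y (pt g xg p))). }
    set (F := filter (fun p => dec (conf p p')) Lp).
    assert (HF : forall p, In p F -> In p Lp /\ conf p p')
      by (intros p Hp; apply filter_In in Hp; now rewrite dec_true in Hp).
    (* The endpoints of the prefixes are at mutual distance at least [2 * de], so one point of the
       orbit of [p'] is close to at most one of them. At most [N] prefixes thus interfere with [p'],
       which is the in-degree bound. *)
    assert (HN : NoDup (map wit F)).
    { apply Injective_map_NoDup_in; [|apply NoDup_filter, NoDup_nodup].
      intros p1 p2 Hp1 Hp2 Ew.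
      apply HF in Hp1 as [Hp1 Hc1]; apply HF in Hp2 as [Hp2 Hc2].
      destruct (Hwit p1 Hc1) as [_ W1]; destruct (Hwit p2 Hc2) as [_ W2].
      apply NNPP; intro Hne; rewrite Ew in W1; set (y := wit p2) in *.
      apply not_all_ex_not in W1 as [n1 W1]; apply not_all_ex_not in W2 as [n2 W2].
      apply Rnot_le_lt in W1, W2.
      assert (Hsep := far_words HE nu p1 p2 xg (Hpw _ Hp1) (Hpw _ Hp2) Hne (n2 - n1)%Z).
      rewrite minus_IZR in Hsep.
      replace (pt g xg p1 - pt g xg p2 - (IZR n2 - IZR n1))
        with ((y - pt g xg p2 - IZR n2) + - (y - pt g xg p1 - IZR n1)) in Hsep by ring.
      pose proof (Rabs_triang (y - pt g xg p2 - IZR n2) (- (y - pt g xg p1 - IZR n1))) as Htri.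
      rewrite Rabs_Ropp in Htri; unfold de in *; lra. }
    assert (Hinc : incl (map wit F) (orb g xg (p' ++ ext p'))).
    { intros y Hy; apply in_map_iff in Hy as (p & <- & Hp); apply HF in Hp as [_ Hp].
      now apply Hwit. }
    apply NoDup_incl_length in Hinc; [|easy].
    rewrite length_map, length_orb in Hinc.
    destruct (Hext p' Hp') as [H1 _]; apply HLg in H1 as [H1 _].
    apply In_words in H1 as [H1 _]; unfold count; fold F; lia.
  - exact HLplen.
  - set (full := fun p => p ++ ext p).
    set (PP := map full L').
    assert (Hnth : forall k, (k < D)%nat -> nth k PP [] = full (nth k L' [])
                     /\ In (nth k L' []) Lp).
    { intros k Hk; split.
      - unfold PP; rewrite (nth_indep _ [] (full [])) by (rewrite length_map; lia).
        apply map_nth.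
      - apply HL'inc, nth_In; lia. }
    assert (Hgood : forall k, (k < D)%nat -> In (nth k PP []) Lg).
    { intros k Hk; destruct (Hnth k Hk) as [-> Hp]; now apply Hext. }
    exists i, j, PP; split; [|split; [|split; [|split]]].
    + apply INR_lt; apply Rmult_lt_reg_r with s; [easy|]; fold xg; lra.
    + apply INR_lt; apply Rmult_lt_reg_r with s; [easy|]; lra.
    + apply In_lprod; unfold PP.
      assert (Hgen : forall L, incl L Lp ->
        Forall2 (@In (list nat)) (map full L) (repeat (words l N) (length L))).
      { induction L as [|p L IH]; simpl; intro Hinc; constructor.
        - apply HLg, Hext, Hinc; now left.
        - apply IH; intros z Hz; apply Hinc; now right. }
      rewrite <- HL'len; now apply Hgen.
    + intros k m Hk Hm Hkm y Hy.
      destruct (Hnth k Hk) as [Ek Hpk]; destruct (Hnth m Hm) as [Em Hpm].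
      rewrite Ek in Hy; rewrite Em; unfold full at 1.
      replace (firstn nu (nth m L' [] ++ ext (nth m L' []))) with (nth m L' []).
      * apply NNPP; intro Hn.
        assert (Hne : nth m L' [] <> nth k L' []).
        { intro Heq; apply Hkm; symmetry.
          apply (proj1 (NoDup_nth L' []) HL'nd); [lia|lia|easy]. }
        apply (HL'indic (nth m L' []) (nth k L' [])); [apply nth_In; lia|apply nth_In; lia|easy|].
        split; [easy|]; exists y; split; [exact Hy|exact Hn].
      * destruct (Hext _ Hpm) as [_ Hlen].
        rewrite firstn_app, Hlen, Nat.sub_diag, firstn_O, app_nil_r.
        symmetry; apply firstn_all2; lia.
    + rewrite pow_mult, <- prodn_const; apply prodn_le; intros k Hk; split; [lra|].
      pose proof (Hgood k Hk) as HP; set (P := nth k PP []) in *.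
      apply HLg in HP as [HP HPg]; eapply Rle_trans; [exact HPg|].
      unfold cnt; rewrite count_sumR; apply sumR_le; intros u Hu; apply indic_le; intro Hsl.
      rewrite <- sl_app in Hsl; fold xg tg; now apply Hclose.
Qed.

(** * The family of perturbations by bumps and its sensitivity matrix *)

Section Family.

Context (G : nat) (b : nat -> R -> R) (et de h : R) (nu Q D : nat).

Context (HG : (0 < G)%nat).
Context (Hde : / INR G <= de / 4).
Context (Hde0 : 0 < de).
Context (Het : 0 <= et).
Context (Hb1 : forall i y, Rabs (b i y) <= 1).
Context (Hb2 : forall i y, - et <= b i y).
Context (Hb3 : forall i y, far (de / 2) y (INR i / INR G) -> Rabs (b i y) <= et).
Context (Hb4 : forall i y n, Rabs (y - INR i / INR G - IZR n) <= / INR G -> 1 / 2 - et <= b i y).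
Context (HD : (0 < D)%nat).
Context (Hnu : (0 < nu)%nat).
(** Two budgets of [1/16] make up the off-diagonal allowance [1/8]; the first one alone keeps the
    diagonal above [1/2 - 1/16], hence above [3/8]. *)
Context (Heta : INR D * (et * (1 + INR nu * Lam ^ nu + / (lam - 1))) <= 1 / 16).
Context (HQ : INR D * ((/ lam) ^ Q / (lam - 1)) <= 1 / 16).

Definition perturbed (f0 : R -> R) (h : R) (c : list nat) (y : R) : R :=
  f0 y + sumR (fun i => INR (nth i c 0%nat) * h * b i y) (seq 0 G).

(** Divide the [k]-th condition by the derivative [dk k] past depth [nu]. The bump nearest to the
    [nu]-th point of branch [k] gives the diagonal entry of row [k], and the radius becomes
    [r / dk k]. Only the derivative along the last [n] digits is kept, since those digits are summed
    over afterwards. *)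
Lemma count_params_hitting f0 H x t r n PP U :
  0 < h -> 0 < r -> h * Lam ^ (Q + n) <= r ->
  In PP (lprod (repeat (words l (nu + Q)) D)) -> nonconf g x nu de D PP ->
  In U (lprod (repeat (words l n) D)) ->
  INR (count (fun c => forall k, (k < D)%nat ->
         Rabs (sl g e (perturbed f0 h c) x t (nth k PP [] ++ nth k U [])) <= r)
       (params H G)) * INR H ^ D
  <= INR H ^ G * prodn D (fun k => 9 * r / h * / dr g e (pt g x (nth k PP [])) (nth k U [])).
Proof.
  intros Hh Hr Hhr HPP Hnc HU.
  pose proof (exp_lam _ _ _ _ _ _ _ HE) as Hlam; pose proof (Lam_gt1 HE) as HLam.
  assert (Hi1 : 0 < / (lam - 1)) by (apply Rinv_0_lt_compat; lra).
  assert (HPw : forall k, (k < D)%nat -> In (nth k PP []) (words l (nu + Q))).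
  { clear - HPP; apply In_lprod in HPP; revert PP HPP; induction D as [|D' IH]; intros PP HPP k Hk; [lia|].
    simpl in HPP; inversion HPP as [|a L PP' Ls Ha HPP']; subst.
    destruct k; simpl; [easy|apply IH; [easy|lia]]. }
  assert (HUw : forall k, (k < D)%nat -> In (nth k U []) (words l n)).
  { clear - HU; apply In_lprod in HU; revert U HU; induction D as [|D' IH]; intros U HU k Hk; [lia|].
    simpl in HU; inversion HU as [|a L U' Ls Ha HU']; subst.
    destruct k; simpl; [easy|apply IH; [easy|lia]]. }
  set (p := fun k => firstn nu (nth k PP [])).
  set (w := fun k => skipn nu (nth k PP [])).
  set (u := fun k => nth k U []).
  assert (Hpw : forall k, nth k PP [] = p k ++ w k) by (intro; symmetry; apply firstn_skipn).
  assert (Hlp : forall k, (k < D)%nat -> length (p k) = nu).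
  { intros k Hk; specialize (HPw k Hk); apply In_words in HPw as [HPw _].
    apply firstn_length_le; lia. }
  assert (Hlw : forall k, (k < D)%nat -> length (w k) = Q).
  { intros k Hk; specialize (HPw k Hk); apply In_words in HPw as [HPw _].
    unfold w; rewrite length_skipn; lia. }
  assert (Hlu : forall k, (k < D)%nat -> length (u k) = n).
  { intros k Hk; specialize (HUw k Hk); now apply In_words in HUw. }
  set (z := fun k => pt g x (p k)).
  set (ix := fun k => epsilon (inhabits 0%nat) (fun i => (i < G)%nat /\
     exists n, Rabs (z k - INR i / INR G - IZR n) <= / INR G)).
  assert (Hix : forall k, (ix k < G)%nat /\
     exists n, Rabs (z k - INR (ix k) / INR G - IZR n) <= / INR G).
  { intro k; unfold ix; apply (epsilon_spec (inhabits 0%nat) (fun i => (i < G)%nat /\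
     exists n, Rabs (z k - INR i / INR G - IZR n) <= / INR G)); now apply near_grid_index. }
  set (dk := fun k => dr g e (z k) (w k ++ u k)).
  assert (Hdk : forall k, 0 < dk k) by (intro; apply (dr_pos HE)).
  set (ze := fun k i => zf g e (b i) x (p k) + zn g e (b i) (z k) (w k ++ u k)).
  assert (Hfar : forall j k y, (j < D)%nat -> (k < D)%nat -> k <> j ->
     In y (orb g x (nth j PP [])) -> far (de / 2) y (INR (ix k) / INR G)).
  { intros j k y Hj Hk Hkj Hy; destruct (Hix k) as [_ [m Hm]].
    intro m'; eapply Rle_trans; [|apply (far_near de (/ INR G) y (z k) _ m)]; [lra| |easy].
    now apply (Hnc j k). }
  assert (Hzin : forall k, (k < D)%nat -> In (z k) (orb g x (nth k PP []))).
  { intros k Hk; rewrite Hpw, orb_app; apply in_app_iff; left; apply pt_In_orb.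
    intro Hnil; specialize (Hlp k Hk); rewrite Hnil in Hlp; simpl in Hlp; lia. }
  assert (HS : 0 <= INR nu * Lam ^ nu)
    by (apply Rmult_le_pos; [apply pos_INR|apply pow_le; lra]).
  set (S := INR nu * Lam ^ nu) in *.
  assert (HD1 : 1 <= INR D) by (change 1 with (INR 1); apply le_INR; lia).
  assert (HetS : 0 <= et * (1 + S + / (lam - 1))) by (apply Rmult_le_pos; lra).
  assert (HQ0 : 0 <= (/ lam) ^ Q / (lam - 1)).
  { apply Rmult_le_pos; [apply pow_le; left; apply Rinv_0_lt_compat; lra|lra]. }
  eapply Rle_trans; [apply Rmult_le_compat_r; [apply pow_le, pos_INR|]|
    eapply Rle_trans; [apply (count_params_le G H D h
      (fun k => sl g e f0 x t (nth k PP [] ++ u k) / dk k) (fun k => r / dk k) ze ix)|]].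
  - apply le_INR, count_le; intros c _ Hc k Hk; specialize (Hc k Hk).
    unfold perturbed in Hc; rewrite sl_combination in Hc.
    fold (u k) in Hc.
    rewrite (sumR_ext _ (fun i => dk k * (INR (nth i c 0%nat) * h * ze k i))) in Hc.
    + rewrite sumR_scal in Hc; pose proof (Hdk k) as Hd.
      set (al := sl g e f0 x t _) in *; set (sm := sumR _ _) in *.
      replace (al - dk k * sm) with ((al / dk k - sm) * dk k) in Hc by (field; lra).
      rewrite Rabs_mult, (Rabs_right (dk k)) in Hc by lra.
      apply Rmult_le_reg_r with (dk k); [easy|].
      replace (r / dk k * dk k) with r by (field; lra); easy.
    + intros i _; rewrite Hpw, <- app_assoc, (zf_app HE); unfold ze, dk, z; ring.
  - easy.
  - easy.
  - intros k _; apply Hix.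
  (* The point [z j] lies on its own orbit, so it is at distance at least [de / 2] from the bump
     chosen for [k]; a shared index would put it within [de / 4]. *)
  - intros j k Hj Hk Ejk; apply NNPP; intro Hne.
    assert (Hf := Hfar j k (z j) Hj Hk ltac:(congruence) (Hzin j Hj)).
    destruct (Hix j) as [_ [m Hm]]; rewrite Ejk in Hm; specialize (Hf m); lra.
  (* The mesh [h] must not exceed any of the normalized radii; [dk k] involves [Q + n] steps. *)
  - intros k Hk.
    assert (Hb : dk k <= Lam ^ (Q + n)).
    { unfold dk; eapply Rle_trans; [apply (dr_bounds HE)|].
      rewrite length_app, Hlw, Hlu by easy; lra. }
    specialize (Hdk k); apply Rmult_le_reg_r with (dk k); [easy|].
    replace (r / dk k * dk k) with r by (field; lra); nra.
  - intros k Hk; destruct (Hix k) as [_ [m Hm]].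
    assert (H1 := zf_ge HE (b (ix k)) et (1 / 2 - et) x (p k) Het (Hb2 (ix k))).
    rewrite Hlp in H1 by easy; fold S in H1.
    specialize (H1 ltac:(intro Hnil; specialize (Hlp k Hk); rewrite Hnil in Hlp; simpl in Hlp; lia)
                   ltac:(apply (Hb4 _ _ m); exact Hm)).
    assert (H2 := zn_ge HE (b (ix k)) et (z k) (w k ++ u k) Het (Hb2 (ix k))).
    unfold ze; unfold Rdiv in H2.
    assert (H3 : et * (1 + S + / (lam - 1)) <= 1 / 16) by nra.
    lra.
  - intros j k Hj Hk Hkj.
    assert (Horb : forall y, In y (orb g x (nth j PP [])) -> Rabs (b (ix k) y) <= et).
    { intros y Hy; apply Hb3, (Hfar j k); easy. }
    rewrite Hpw, orb_app in Horb.
    assert (H1 : Rabs (zf g e (b (ix k)) x (p j)) <= et * S).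
    { assert (H0 := zf_small HE (b (ix k)) et x (p j) Het); rewrite Hlp in H0 by easy.
      apply H0; intros y Hy; apply Horb, in_app_iff; now left. }
    assert (H2 : Rabs (zn g e (b (ix k)) (z j) (w j ++ u j))
        <= et / (lam - 1) + (/ lam) ^ Q / (lam - 1)).
    { rewrite <- (Hlw j Hj); apply (zn_small HE); [easy|easy|].
      intros y Hy; apply Horb, in_app_iff; now right. }
    unfold ze.
    assert (H3 := Rabs_triang (zf g e (b (ix k)) x (p j)) (zn g e (b (ix k)) (z j) (w j ++ u j))).
    assert (H4 : Rabs (zf g e (b (ix k)) x (p j) + zn g e (b (ix k)) (z j) (w j ++ u j))
      <= et * (1 + S + / (lam - 1)) + (/ lam) ^ Q / (lam - 1)).
    { unfold Rdiv in *; lra. }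
    apply Rmult_le_compat_l with (r := INR D) in H4; [|lra]; lra.
  - apply Rmult_le_compat_l; [apply pow_le, pos_INR|]; apply prodn_le; intros k Hk.
    assert (Hrh : 0 < 9 * r / h) by (apply Rmult_lt_0_compat; [lra|now apply Rinv_0_lt_compat]).
    fold (u k).
    assert (Hdu : 0 < dr g e (pt g x (nth k PP [])) (u k)) by apply (dr_pos HE).
    assert (Hle : dr g e (pt g x (nth k PP [])) (u k) <= dk k).
    { unfold dk; rewrite dr_app, Hpw, pt_app; fold (z k) .
      assert (H1 := dr_bounds HE (z k) (w k)).
      assert (1 <= lam ^ length (w k)) by (apply pow_R1_Rle; lra).
      rewrite Hpw, pt_app in Hdu; fold (z k) in Hdu; nra. }
    specialize (Hdk k).
    replace (9 * (r / dk k) / h) with (9 * r / h * / dk k) by (field; lra).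
    split.
    + apply Rmult_le_pos; [lra|left; now apply Rinv_0_lt_compat].
    + apply Rmult_le_compat_l; [lra|]; now apply Rinv_le_contravar.
Qed.

(* The [D]-th moment bound: the expected number of [D]-tuples of good branches over a grid
   point is bounded independently of [n], while a bad parameter produces [q ^ (n D)] of them. *)
Lemma count_bad_params f0 Rc Cf B H n q s gx gt :
  de = / Lam ^ nu / 2 -> 0 < h -> 0 < Rc -> 0 <= Cf ->
  (forall c, In c (params H G) ->
    (forall y, Rabs (perturbed f0 h c y) <= Rc) /\
    (forall a b', Rabs (perturbed f0 h c a - perturbed f0 h c b') <= Cf * Rabs (a - b')) /\
    (forall y, perturbed f0 h c (y + 1) = perturbed f0 h c y)) ->
  Lam + Rc / (lam - 1) * CE + Cf <= B -> 1 < q -> 0 < s ->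
  B ^ (nu + Q + n) * s <= Rc / (lam - 1) -> 1 <= INR gx * s -> 2 * (Rc / (lam - 1)) < INR gt * s ->
  h * Lam ^ (Q + n) <= 2 * (Rc / (lam - 1)) ->
  INR (count (fun c => exists x t, (((2 * (nu + Q) + 1) * D) * l ^ Q
      <= count (good l g e (perturbed f0 h c) (Rc / (lam - 1)) q n x t) (words l (nu + Q)))%nat)
    (params H G)) * q ^ (n * D) * INR H ^ D
  <= INR gx * INR gt * (INR l ^ (nu + Q)) ^ D * INR H ^ G
     * (18 * (Rc / (lam - 1)) * exp (CE / (lam - 1)) / h) ^ D.
Proof.
  intros Hdeq Hh HR HCf Hfam HB Hq Hs HBs Hgx Hgt Hhs.
  pose proof (exp_lam _ _ _ _ _ _ _ HE) as Hlam.
  set (th := Rc / (lam - 1)) in *.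
  assert (Hth : 0 < th) by (apply Rmult_lt_0_compat; [easy|apply Rinv_0_lt_compat; lra]).
  set (bad := fun c => exists x t, (((2 * (nu + Q) + 1) * D) * l ^ Q
      <= count (good l g e (perturbed f0 h c) th q n x t) (words l (nu + Q)))%nat).
  set (LP := lprod (repeat (words l (nu + Q)) D)).
  set (LU := lprod (repeat (words l n) D)).
  set (xg := fun i : nat => INR i * s); set (tg := fun j : nat => - th + INR j * s).
  set (hit := fun c i j PP U => forall k, (k < D)%nat ->
    Rabs (sl g e (perturbed f0 h c) (xg i) (tg j) (nth k PP [] ++ nth k U [])) <= 2 * th).
  (* The weight discards interfering tuples, for which no estimate on the parameters is
     available. *)
  set (nc := fun i PP => indic (nonconf g (xg i) nu de D PP)).
  (* [18] is [9 * 2]: the count of cells is applied with radius [2 * th]. *)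
  set (X := 18 * th * exp (CE / (lam - 1)) / h).
  assert (HX : 0 <= X).
  { apply Rmult_le_pos; [|left; now apply Rinv_0_lt_compat].
    apply Rmult_le_pos; [lra|left; apply exp_pos]. }
  (* Markov's inequality at a single parameter: a bad one is responsible for at least [q ^ (n * D)]
     hits. *)
  assert (Hone : forall c, In c (params H G) -> indic (bad c) * q ^ (n * D) <=
    sumR (fun i => sumR (fun j => sumR (fun PP => sumR (fun U =>
      nc i PP * indic (hit c i j PP U)) LU) LP) (seq 0 gt)) (seq 0 gx)).
  { intros c Hc.
    assert (Hnn : forall i j PP, 0 <= sumR (fun U => nc i PP * indic (hit c i j PP U)) LU).
    { intros; apply sumR_ge0; intros; apply Rmult_le_pos; apply indic_range. }
    assert (Hnn2 : forall i j, 0 <= sumR (fun PP => sumR (fun U => nc i PP * indic (hit c i j PP U)) LU) LP)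
      by (intros; apply sumR_ge0; auto).
    destruct (classic (bad c)) as [Hbad|Hbad].
    - rewrite indic_1, Rmult_1_l by easy.
      destruct (Hfam c Hc) as (F1 & F2 & F3).
      destruct (good_branches_on_grid (perturbed f0 h c) Rc Cf B nu Q D n q s gx gt)
        as (i & j & PP & Hi & Hj & HPP & Hnc & Hprod); try easy.
      fold th in Hprod; fold (xg i) in Hprod, Hnc; fold (tg j) in Hprod.
      rewrite <- Hdeq in Hnc.
      rewrite <- (sumR_lprod [] (words l n) D (fun k u =>
        indic (Rabs (sl g e (perturbed f0 h c) (xg i) (tg j) (nth k PP [] ++ u)) <= 2 * th))) in Hprod.
      eapply Rle_trans; [exact Hprod|].
      eapply Rle_trans; [|apply (sumR_member (fun i => sumR (fun j => sumR (fun PP => sumR (fun U =>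
        nc i PP * indic (hit c i j PP U)) LU) LP) (seq 0 gt)) _ i)];
        [|intros; apply sumR_ge0; auto|apply in_seq; lia].
      eapply Rle_trans; [|apply (sumR_member (fun j => sumR (fun PP => sumR (fun U =>
        nc i PP * indic (hit c i j PP U)) LU) LP) _ j)]; [|auto|apply in_seq; lia].
      eapply Rle_trans; [|apply (sumR_member (fun PP => sumR (fun U =>
        nc i PP * indic (hit c i j PP U)) LU) _ PP)]; [|auto|exact HPP].
      apply sumR_le; intros U _; unfold nc; rewrite indic_1, Rmult_1_l by easy.
      rewrite prodn_indic; apply indic_le; easy.
    - rewrite indic_0, Rmult_0_l by easy; apply sumR_ge0; intros; apply sumR_ge0; auto. }
  (* For fixed prefixes, the sum over their continuations factors into [D] sums of inverse
     derivatives, each bounded by distortion. *)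
  assert (Hinner : forall i j PP, In PP LP ->
    sumR (fun U => sumR (fun c => nc i PP * indic (hit c i j PP U)) (params H G)) LU * INR H ^ D
    <= INR H ^ G * X ^ D).
  { intros i j PP HPP; unfold nc.
    assert (HHG : 0 <= INR H ^ G) by apply pow_le, pos_INR.
    destruct (classic (nonconf g (xg i) nu de D PP)) as [Hnc|Hnc].
    - rewrite indic_1 by easy.
      apply Rle_trans with (sumR (fun U => INR H ^ G * prodn D (fun k =>
        9 * (2 * th) / h * / dr g e (pt g (xg i) (nth k PP [])) (nth k U []))) LU).
      + rewrite Rmult_comm, <- sumR_scal; apply sumR_le; intros U HU.
        rewrite sumR_scal, Rmult_1_l, <- (count_sumR (fun c => hit c i j PP U)), Rmult_comm.
        apply (count_params_hitting f0 H (xg i) (tg j) (2 * th) n PP U); try easy; lra.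
      + rewrite sumR_scal; apply Rmult_le_compat_l; [easy|].
        unfold LU; rewrite (sumR_lprod [] (words l n) D (fun k u =>
          9 * (2 * th) / h * / dr g e (pt g (xg i) (nth k PP [])) u)).
        rewrite <- prodn_const; apply prodn_le; intros k _.
        assert (Hc0 : 0 <= 9 * (2 * th) / h).
        { apply Rmult_le_pos; [lra|left; now apply Rinv_0_lt_compat]. }
        rewrite sumR_scal; split.
        * apply Rmult_le_pos; [easy|]; apply sumR_ge0; intros u _.
          left; apply Rinv_0_lt_compat, (dr_pos HE).
        * replace X with (9 * (2 * th) / h * exp (CE / (lam - 1))) by (unfold X; field; lra).
          apply Rmult_le_compat_l; [easy|]; apply (sumR_inv_dr_le HE).
    - rewrite indic_0 by easy.
      rewrite (sumR_ext _ (fun _ => 0)), sumR_const.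
      + rewrite Rmult_0_r, Rmult_0_l; apply Rmult_le_pos; [easy|now apply pow_le].
      + intros U _; rewrite (sumR_ext _ (fun _ => 0)), sumR_const; [ring|intros; ring]. }
  change (INR (count bad (params H G)) * q ^ (n * D) * INR H ^ D
    <= INR gx * INR gt * (INR l ^ (nu + Q)) ^ D * INR H ^ G * X ^ D).
  apply Rle_trans with (INR H ^ D * sumR (fun i => sumR (fun j => sumR (fun PP => sumR (fun U =>
      sumR (fun c => nc i PP * indic (hit c i j PP U)) (params H G)) LU) LP) (seq 0 gt)) (seq 0 gx)).
  - rewrite Rmult_comm; apply Rmult_le_compat_l; [apply pow_le, pos_INR|].
    rewrite count_sumR, Rmult_comm, <- sumR_scal.
    eapply Rle_trans; [apply sumR_le; intros c Hc; rewrite Rmult_comm; now apply Hone|].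
    right; rewrite sumR_exchange; apply sumR_ext; intros i _.
    rewrite sumR_exchange; apply sumR_ext; intros j _.
    rewrite sumR_exchange; apply sumR_ext; intros PP _.
    apply sumR_exchange.
  - replace (INR gx * INR gt * (INR l ^ (nu + Q)) ^ D * INR H ^ G * X ^ D)
      with (INR gx * (INR gt * ((INR l ^ (nu + Q)) ^ D * (INR H ^ G * X ^ D)))) by ring.
    rewrite <- sumR_scal.
    rewrite <- (length_seq gx 0) at 2; rewrite <- sumR_const; apply sumR_le; intros i _.
    rewrite <- sumR_scal.
    rewrite <- (length_seq gt 0) at 2; rewrite <- sumR_const; apply sumR_le; intros j _.
    rewrite <- sumR_scal.
    replace ((INR l ^ (nu + Q)) ^ D) with (INR (length LP)).
    + rewrite <- sumR_const; apply sumR_le; intros PP HPP.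
      rewrite Rmult_comm; now apply Hinner.
    + unfold LP; rewrite length_lprod_repeat, length_words, !pow_INR; easy.
Qed.

End Family.

End Moments.

(** * The growth rate *)

Lemma nat_bounded_max (P : nat -> Prop) b :
  (exists m, P m) -> (forall m, P m -> (m <= b)%nat) ->
  exists m, P m /\ forall k, P k -> (k <= m)%nat.
Proof.
  induction b as [|b IH]; intros [m Hm] Hb.
  - exists m; split; [easy|]; intros k Hk; apply Hb in Hk; lia.
  - destruct (classic (P (S b))) as [HS|HS]; [now exists (S b)|].
    apply IH; [now exists m|]; intros k Hk; specialize (Hb k Hk).
    destruct (Nat.eq_dec k (S b)) as [->|]; [easy|lia].
Qed.

(** * From cone counts on the torus to counts of inverse branches *)

Section Dynamics.

Context {l : nat} {E e g : R -> R} {lam Lam CE : R} (HE : expanding l E e g lam Lam CE).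
Context (tau f : R -> R) (Htau : forall y, tau (y + 1) = tau y)
  (Hf : forall y, f (y + 1) = f y).

Lemma periodic0_IZR (F : R -> R) : (forall x, F (x + 1) = F x) ->
  forall (n : Z) x, F (x + IZR n) = F x.
Proof.
  intros HF n x; rewrite (periodic_IZR F 0); [ring|]; intro; rewrite HF; ring.
Qed.

Lemma Fiter_fst n p : fst (Fiter E tau n p) = Nat.iter n E (fst p).
Proof.
  revert p; induction n as [|n IH]; intro p; [easy|].
  simpl Fiter; rewrite IH, Nat.iter_succ_r; easy.
Qed.

Lemma Fiter_snd n y s : snd (Fiter E tau n (y, s)) = s + snd (Fiter E tau n (y, 0)).
Proof.
  revert y s; induction n as [|n IH]; intros y s; simpl; [ring|].
  unfold Flift; simpl; rewrite IH, (IH _ (0 + tau y)); ring.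
Qed.

Lemma Fiter_snd_periodic n y k :
  snd (Fiter E tau n (y + IZR k, 0)) = snd (Fiter E tau n (y, 0)).
Proof.
  revert y k; induction n as [|n IH]; intros y k; simpl; [easy|].
  unfold Flift; simpl; rewrite Fiter_snd, (Fiter_snd n (E y)), (periodic0_IZR tau Htau).
  rewrite (E_shift HE), INR_IZR_INZ, <- mult_IZR, IH; easy.
Qed.

Lemma Dfn_periodic n y k w : Dfn E e f n (y + IZR k) w = Dfn E e f n y w.
Proof.
  revert y k w; induction n as [|n IH]; intros y k w; simpl; [easy|].
  rewrite (periodic0_IZR f Hf), (periodic0_IZR e (exp_eper _ _ _ _ _ _ _ HE)).
  rewrite (E_shift HE), INR_IZR_INZ, <- mult_IZR, IH; easy.
Qed.

Lemma Dfn_S n y w : Dfn E e f (S n) y w =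
  (e (Nat.iter n E y) * fst (Dfn E e f n y w),
   f (Nat.iter n E y) * fst (Dfn E e f n y w) + snd (Dfn E e f n y w)).
Proof.
  revert y w; induction n as [|n IH]; intros y w; [easy|].
  rewrite Nat.iter_succ_r.
  change (Dfn E e f (S (S n)) y w)
    with (Dfn E e f (S n) (E y) (e y * fst w, f y * fst w + snd w)).
  rewrite IH; easy.
Qed.

Lemma iter_pt u : forall x, exists k, Nat.iter (length u) E (pt g x u) = x + IZR k.
Proof.
  induction u as [|j u IH]; intro x; simpl; [exists 0%Z; simpl; ring|].
  destruct (IH (g (x + INR j))) as [k Hk]; rewrite Hk, (E_shift HE), (exp_g _ _ _ _ _ _ _ HE).
  exists (Z.of_nat j + Z.of_nat l * k)%Z; rewrite plus_IZR, mult_IZR, <- !INR_IZR_INZ; ring.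
Qed.

(** The integer [k] encodes the branch: its residue modulo [l] is the first digit, and the quotient
    is left for the remaining steps because [E] turns a translation by [m] into one by [l * m]. *)
Lemma iter_pt_complete n : forall x y k, Nat.iter n E y = x + IZR k ->
  exists u, In u (words l n) /\ eqmod1 y (pt g x u).
Proof.
  pose proof (exp_l _ _ _ _ _ _ _ HE) as Hl.
  induction n as [|n IH]; intros x y k Hy.
  - exists []; split; [now left|]; exists k; simpl in *; lra.
  - set (j := (k mod Z.of_nat l)%Z); set (m := (k / Z.of_nat l)%Z).
    assert (Hj : (0 <= j < Z.of_nat l)%Z) by (apply Z.mod_pos_bound; lia).
    assert (Hk : k = (Z.of_nat l * m + j)%Z) by (apply Z.div_mod; lia).
    destruct (IH (g (x + INR (Z.to_nat j))) y m) as (u & Hu & Heq).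
    + simpl in Hy; apply (E_inj HE); rewrite Hy, (E_shift HE), (exp_g _ _ _ _ _ _ _ HE), Hk.
      rewrite plus_IZR, mult_IZR, !INR_IZR_INZ, Z2Nat.id by lia; ring.
    + exists (Z.to_nat j :: u); split; [|exact Heq].
      apply In_words in Hu as [Hu1 Hu2]; apply In_words; split; [simpl; lia|].
      intros i [<-|Hi]; [lia|auto].
Qed.

(** [Df] fixes vertical vectors, so the vertical deviation of a vector from the line of slope
    [sl g e f x t u] is carried unchanged to its deviation from the line of slope [t]. *)
Lemma Dfn_branch u : forall x t xi eta,
  Dfn E e f (length u) (pt g x u) (xi, eta)
  = (dr g e x u * xi, t * (dr g e x u * xi) + (eta - sl g e f x t u * xi)).
Proof.
  induction u as [|j u IH]; intros x t xi eta; [simpl; f_equal; ring|].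
  simpl length; rewrite Dfn_S; simpl pt; simpl sl; simpl dr.
  set (y := g (x + INR j)).
  destruct (iter_pt u y) as [k Hk]; rewrite Hk.
  rewrite (periodic0_IZR f Hf), (periodic0_IZR e (exp_eper _ _ _ _ _ _ _ HE)).
  rewrite (IH y (e y * t - f y)); simpl; f_equal; ring.
Qed.

Lemma qualifies_branch Rc n z v zeta : UnitVec v ->
  Qualifies E e tau f lam Rc n z v zeta ->
  exists u, In u (words l n) /\ eqmod1 (fst zeta) (pt g (fst z) u) /\
    Rabs (sl g e f (fst z) (snd v / fst v) u) <= Rc / (lam - 1).
Proof.
  intros Hv [[[k Hk] _] ([xi eta] & Hcone & HD)].
  rewrite Fiter_fst in Hk.
  destruct (iter_pt_complete n (fst z) (fst zeta) k ltac:(lra)) as (u & Hu & m & Hm).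
  exists u; split; [easy|]; split; [now exists m|].
  assert (Hlen : length u = n) by now apply In_words in Hu.
  replace (fst zeta) with (pt g (fst z) u + IZR m) in HD by lra.
  rewrite Dfn_periodic, <- Hlen, (Dfn_branch u _ (snd v / fst v)) in HD.
  unfold InCone in Hcone; simpl in Hcone.
  set (th := Rc / (lam - 1)) in *; set (s := sl _ _ _ _ _ _) in *.
  assert (Hd := dr_pos HE (fst z) u); set (d := dr g e (fst z) u) in *.
  (* A vertical vector in the cone is zero, and [v] is a unit vector; hence the slope of [v] makes
     sense. *)
  assert (Hv1 : fst v <> 0).
  { intro H0; rewrite <- HD in H0; simpl in H0.
    assert (Hxi : xi = 0) by nra; rewrite Hxi, Rabs_R0, Rmult_0_r in Hcone.
    assert (Heta : eta = 0).
    { destruct (Req_dec eta 0) as [|Hn]; [easy|].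
      apply Rabs_pos_lt in Hn; lra. }
    unfold UnitVec in Hv; rewrite <- HD in Hv; simpl in Hv; rewrite Hxi, Heta in Hv; nra. }
  assert (Hfst : fst v = d * xi) by now rewrite <- HD.
  assert (Hsnd : snd v = snd v / fst v * (d * xi) + (eta - s * xi)).
  { transitivity (snd (d * xi, snd v / fst v * (d * xi) + (eta - s * xi)));
      [now rewrite HD|easy]. }
  rewrite <- Hfst in Hsnd.
  replace (snd v / fst v * fst v) with (snd v) in Hsnd by (field; easy).
  assert (Heta : eta = s * xi) by lra.
  assert (Hxi : xi <> 0) by (intro H0; apply Hv1; rewrite Hfst, H0; ring).
  rewrite Heta, Rabs_mult in Hcone; apply Rabs_pos_lt in Hxi; nra.
Qed.

Lemma goodlist_length_le Rc n z v L : GoodList E e tau f lam Rc n z v L ->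
  (length L <= cnt l g e f (Rc / (lam - 1)) n (fst z) (snd v / fst v))%nat.
Proof.
  intros (Hv & HFO & HQ); rewrite Forall_forall in HQ.
  set (br := fun zeta : R * R => epsilon (inhabits []) (fun u => In u (words l n) /\
    eqmod1 (fst zeta) (pt g (fst z) u) /\
    Rabs (sl g e f (fst z) (snd v / fst v) u) <= Rc / (lam - 1))).
  assert (Hbr : forall zeta, In zeta L -> In (br zeta) (words l n) /\
    eqmod1 (fst zeta) (pt g (fst z) (br zeta)) /\
    Rabs (sl g e f (fst z) (snd v / fst v) (br zeta)) <= Rc / (lam - 1)).
  { intros zeta Hz; unfold br; apply (epsilon_spec (inhabits []) (fun u => In u (words l n) /\
    eqmod1 (fst zeta) (pt g (fst z) u) /\
    Rabs (sl g e f (fst z) (snd v / fst v) u) <= Rc / (lam - 1))).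
    now apply (qualifies_branch Rc n z v zeta), HQ. }
  (* Once the first coordinate is known modulo 1, the second one is determined modulo 1 by the image
     point. *)
  assert (Hinj : forall a b, In a L -> In b L -> br a = br b -> torus_eq a b).
  { intros a b Ha Hb Hab.
    destruct (Hbr a Ha) as (_ & [k Hk] & _); destruct (Hbr b Hb) as (_ & [m Hm] & _).
    rewrite Hab in Hk.
    assert (Hfst : fst a = fst b + IZR (k - m)) by (rewrite minus_IZR; lra).
    split; [exists (k - m)%Z; lra|].
    destruct (HQ a Ha) as [[_ [i Hi]] _]; destruct (HQ b Hb) as [[_ [j Hj]] _].
    destruct a as [a1 a2]; destruct b as [b1 b2]; simpl in *; subst a1.
    rewrite Fiter_snd, Fiter_snd_periodic in Hi; rewrite Fiter_snd in Hj.
    exists (i - j)%Z; rewrite minus_IZR; lra. }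
  assert (HN : NoDup (map br L)).
  { clear HQ Hbr; induction HFO as [|a L Ha HFO IH]; simpl; constructor.
    - intro Hin; apply in_map_iff in Hin as (b & Hb & HbL).
      rewrite Forall_forall in Ha; apply (Ha b HbL), Hinj; [now left|now right|easy].
    - apply IH; intros; apply Hinj; [now right|now right|easy]. }
  rewrite <- (length_map br L); unfold cnt, count; apply NoDup_incl_length; [easy|].
  intros u Hu; apply in_map_iff in Hu as (zeta & <- & Hz).
  apply filter_In; rewrite dec_true; split; now apply Hbr.
Qed.

Lemma goodlist_exists Rc n x t : exists z v L, GoodList E e tau f lam Rc n z v L /\
  length L = cnt l g e f (Rc / (lam - 1)) n x t.
Proof.
  set (nrm := sqrt (1 + t ^ 2)).
  assert (Hp : 0 < 1 + t ^ 2) by (pose proof (pow2_ge_0 t); lra).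
  assert (Hn : 0 < nrm) by now apply sqrt_lt_R0.
  assert (Hnn : nrm * nrm = 1 + t ^ 2) by (apply sqrt_sqrt; lra).
  set (F := filter (fun u => dec (Rabs (sl g e f x t u) <= Rc / (lam - 1))) (words l n)).
  (* The second coordinate cancels the accumulated translation, so that the image is [(x, 0)] modulo
     1. *)
  set (zt := fun u => (pt g x u, - snd (Fiter E tau n (pt g x u, 0)))).
  exists (x, 0), (/ nrm, t / nrm), (map zt F).
  split; [|now rewrite length_map].
  split; [|split].
  - unfold UnitVec; simpl.
    replace (/ nrm * (/ nrm * 1) + t / nrm * (t / nrm * 1)) with ((1 + t ^ 2) / (nrm * nrm))
      by (simpl; field; lra).
    rewrite Hnn; field; lra.
  - assert (HF : NoDup F) by apply NoDup_filter, NoDup_words.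
    assert (Hw : forall u, In u F -> In u (words l n)) by (intros u Hu; now apply filter_In in Hu).
    clearbody F; induction HF as [|u F Hu HF IH]; simpl; constructor.
    + apply Forall_forall; intros p Hp' [[k Hk] _].
      apply in_map_iff in Hp' as (u' & <- & Hu'); simpl in Hk.
      assert (Hfar := far_words HE n u u' x ltac:(apply Hw; now left) ltac:(apply Hw; now right)
        ltac:(congruence) k).
      rewrite Hk, Rminus_diag, Rabs_R0 in Hfar.
      assert (0 < / Lam ^ n) by (apply Rinv_0_lt_compat, pow_lt; pose proof (Lam_gt1 HE); lra).
      lra.
    + apply IH; intros; apply Hw; now right.
  - apply Forall_forall; intros p Hp'; apply in_map_iff in Hp' as (u & <- & Hu).
    apply filter_In in Hu as [Hu Hs]; apply (proj1 (dec_true _)) in Hs.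
    assert (Hlen : length u = n) by now apply In_words in Hu.
    assert (Hd := dr_pos HE x u).
    split.
    + unfold zt; split.
      * rewrite Fiter_fst; simpl; rewrite <- Hlen.
        destruct (iter_pt u x) as [k Hk]; exists k; rewrite Hk; ring.
      * rewrite Fiter_snd; simpl; exists 0%Z; simpl; ring.
    + set (xi := / nrm / dr g e x u).
      exists (xi, sl g e f x t u * xi); split.
      * unfold InCone; simpl; rewrite Rabs_mult.
        apply Rmult_le_compat_r; [apply Rabs_pos|easy].
      * simpl; rewrite <- Hlen, (Dfn_branch u x t).
        f_equal; unfold xi; field; split; lra.
Qed.

Definition is_max_cnt (th : R) (n m : nat) : Prop :=
  (exists x t, cnt l g e f th n x t = m) /\ forall x t, (cnt l g e f th n x t <= m)%nat.

Lemma is_max_cnt_IsNcount Rc n m :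
  is_max_cnt (Rc / (lam - 1)) n m -> IsNcount E e tau f lam Rc n m.
Proof.
  intros [(x & t & Hm) Hmax]; split.
  - destruct (goodlist_exists Rc n x t) as (z & v & L & HL & Hlen).
    exists z, v, L; split; [easy|congruence].
  - intros z v L HL; eapply Nat.le_trans; [exact (goodlist_length_le Rc n z v L HL)|apply Hmax].
Qed.

Lemma is_max_cnt_exists th n : exists m, is_max_cnt th n m.
Proof.
  destruct (nat_bounded_max (fun m => exists x t, cnt l g e f th n x t = m) (l ^ n)%nat)
    as (m & Hm & Hmax).
  - now exists (cnt l g e f th n 0 0), 0, 0.
  - intros m (x & t & <-); rewrite <- length_words; apply count_le_length.
  - exists m; split; [easy|]; intros x t; apply Hmax; eauto.
Qed.

Definition max_cnt (th : R) (n : nat) : nat := epsilon (inhabits 0%nat) (is_max_cnt th n).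

Lemma max_cnt_spec th n : is_max_cnt th n (max_cnt th n).
Proof. apply (epsilon_spec (inhabits 0%nat) (is_max_cnt th n)), is_max_cnt_exists. Qed.

Lemma max_cnt_pos th n : 0 <= th -> (1 <= max_cnt th n)%nat.
Proof.
  intro Hth; destruct (max_cnt_spec th n) as [_ Hmax].
  pose proof (exp_l _ _ _ _ _ _ _ HE) as Hl.
  (* The slope [t] is chosen so that the branch with all digits 0 pulls it back to slope 0. *)
  destruct (sl_surjective HE f 0 (repeat 0%nat n) 0) as [t Ht].
  eapply Nat.le_trans; [|apply (Hmax 0 t)].
  apply (count_In_pos _ _ (repeat 0%nat n)).
  - apply In_words; split; [apply repeat_length|].
    intros j Hj; apply repeat_spec in Hj; lia.
  - rewrite Ht, Rabs_R0; easy.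
Qed.

(** A branch whose slope has left the cone after [n] steps never returns to it, so only the prefixes
    counted at time [n] have counted continuations. *)
Lemma max_cnt_submult Rc n m : 0 <= Rc -> (forall y, Rabs (f y) <= Rc) ->
  (max_cnt (Rc / (lam - 1)) (n + m)
   <= max_cnt (Rc / (lam - 1)) n * max_cnt (Rc / (lam - 1)) m)%nat.
Proof.
  intros HR Hb; set (th := Rc / (lam - 1)).
  destruct (max_cnt_spec th (n + m)) as [(x & t & <-) _].
  destruct (max_cnt_spec th n) as [_ Hn]; destruct (max_cnt_spec th m) as [_ Hm].
  apply INR_le; rewrite (cnt_add f th n m x t), mult_INR.
  apply Rle_trans with (sumR (fun p => INR (max_cnt th m) * indic (Rabs (sl g e f x t p) <= th)) (words l n)).
  - apply sumR_le; intros p _.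
    destruct (classic (Rabs (sl g e f x t p) <= th)) as [H|H].
    + rewrite indic_1, Rmult_1_r by easy; apply le_INR, Hm.
    + rewrite indic_0, Rmult_0_r by easy; right.
      change 0 with (INR 0); f_equal.
      destruct (Nat.eq_dec (cnt l g e f th m (pt g x p) (sl g e f x t p)) 0) as [|Hne]; [easy|].
      destruct (count_pos (fun u => Rabs (sl g e f (pt g x p) (sl g e f x t p) u) <= th) (words l m))
        as (u & _ & Hu); [unfold cnt in Hne; lia|].
      apply (sl_in_cone HE f Rc u HR Hb) in Hu; easy.
  - rewrite sumR_scal, <- count_sumR, Rmult_comm.
    apply Rmult_le_compat_r; [apply pos_INR|]; apply le_INR, Hn.
Qed.

(** Read forwards, one step sends a slope [s] to [(s + f y) / e y]: slopes contract by [lam] up to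
    the geometric series [R0 / (lam - 1)]. *)
Lemma sl_contract R0 u : 0 <= R0 -> (forall y, Rabs (f y) <= R0) -> forall x t,
  Rabs t <= R0 / (lam - 1) + Rabs (sl g e f x t u) * (/ lam) ^ length u.
Proof.
  intros HR Hb; pose proof (exp_lam _ _ _ _ _ _ _ HE) as Hlam.
  assert (Hth : 0 <= R0 / (lam - 1))
    by (apply Rmult_le_pos; [easy|left; apply Rinv_0_lt_compat; lra]).
  induction u as [|j u IH]; intros x t; simpl; [lra|].
  set (y := g (x + INR j)); specialize (IH y (e y * t - f y)).
  set (X := Rabs (sl g e f y (e y * t - f y) u) * (/ lam) ^ length u) in *.
  pose proof (exp_e _ _ _ _ _ _ _ HE y) as He; specialize (Hb y).
  assert (H1 : Rabs (e y * t) <= R0 / (lam - 1) + X + R0).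
  { replace (e y * t) with ((e y * t - f y) + f y) by ring.
    eapply Rle_trans; [apply Rabs_triang|]; lra. }
  rewrite Rabs_mult, (Rabs_right (e y)) in H1 by lra.
  assert (H2 : lam * Rabs t <= e y * Rabs t)
    by (apply Rmult_le_compat_r; [apply Rabs_pos|lra]).
  apply Rmult_le_reg_l with lam; [lra|].
  replace (lam * (R0 / (lam - 1) + Rabs (sl g e f y (e y * t - f y) u) * (/ lam * (/ lam) ^ length u)))
    with (R0 / (lam - 1) + X + R0) by (unfold X; field; lra).
  lra.
Qed.

(** By contraction, [k] forward steps map the cone of radius [th'] into that of radius [th].
    Dropping [k] digits costs at most the factor [l ^ k], which does not change the exponential
    rate; the limit is thus independent of [Rc]. *)
Lemma max_cnt_cone_change R0 th th' : 0 <= R0 -> (forall y, Rabs (f y) <= R0) ->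
  R0 / (lam - 1) < th -> 0 <= th' ->
  exists k, forall n, (max_cnt th' (n + k) <= max_cnt th n * l ^ k)%nat.
Proof.
  intros HR Hb Hth Hth'; pose proof (exp_lam _ _ _ _ _ _ _ HE) as Hlam.
  assert (Hil : 0 < / lam < 1).
  { split; [apply Rinv_0_lt_compat; lra|]; rewrite <- Rinv_1; apply Rinv_lt_contravar; lra. }
  destruct (pow_lt_1_zero (/ lam) ltac:(rewrite Rabs_right; lra)
    ((th - R0 / (lam - 1)) / (th' + 1))) as [k Hk].
  { apply Rmult_lt_0_compat; [lra|apply Rinv_0_lt_compat; lra]. }
  exists k; intro n.
  destruct (max_cnt_spec th' (n + k)) as [(x & t & <-) _].
  destruct (max_cnt_spec th n) as [_ Hn].
  apply INR_le; rewrite (cnt_add f th' n k x t), mult_INR.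
  apply Rle_trans with
    (sumR (fun p => INR (l ^ k) * indic (Rabs (sl g e f x t p) <= th)) (words l n)).
  - apply sumR_le; intros p _.
    destruct (classic (Rabs (sl g e f x t p) <= th)) as [H|H].
    + rewrite indic_1, Rmult_1_r by easy; apply le_INR; rewrite <- length_words.
      apply count_le_length.
    + rewrite indic_0, Rmult_0_r by easy; right.
      change 0 with (INR 0); f_equal.
      destruct (Nat.eq_dec (cnt l g e f th' k (pt g x p) (sl g e f x t p)) 0) as [|Hne]; [easy|].
      destruct (count_pos (fun u => Rabs (sl g e f (pt g x p) (sl g e f x t p) u) <= th') (words l k))
        as (u & Hu & Hs); [unfold cnt in Hne; lia|].
      exfalso; apply H; clear H; apply In_words in Hu as [Hu _].
      eapply Rle_trans; [apply (sl_contract R0 u HR Hb (pt g x p))|].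
      rewrite Hu; specialize (Hk k (Nat.le_refl k)).
      assert (Hp : 0 < (/ lam) ^ k) by (apply pow_lt; lra).
      rewrite Rabs_right in Hk by lra.
      assert (H1 : (/ lam) ^ k * (th' + 1) < th - R0 / (lam - 1)).
      { apply Rmult_lt_compat_r with (r := th' + 1) in Hk; [|lra].
        replace ((th - R0 / (lam - 1)) / (th' + 1) * (th' + 1))
          with (th - R0 / (lam - 1)) in Hk by (field; lra); easy. }
      assert (H2 : Rabs (sl g e f (pt g x p) (sl g e f x t p) u) * (/ lam) ^ k
                   <= th' * (/ lam) ^ k) by (apply Rmult_le_compat_r; lra).
      lra.
  - rewrite sumR_scal, <- count_sumR, Rmult_comm.
    apply Rmult_le_compat_r; [apply pos_INR|]; apply le_INR, Hn.
Qed.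

End Dynamics.

(** Fekete's lemma. Besides convergence, the lower bound by [L] at every single [n] is recorded,
    because it lets one finite count control the limit. *)
Lemma fekete (b : nat -> R) : (forall n, 0 <= b n) ->
  (forall n m, b (n + m)%nat <= b n + b m) ->
  exists L, 0 <= L /\ (forall n, (0 < n)%nat -> L * INR n <= b n) /\
    Un_cv (fun n => b (S n) / INR (S n)) L.
Proof.
  intros Hpos Hsub.
  (* [completeness] yields suprema, so the infimum of [b n / n] is obtained through the
     negatives. *)
  set (Sl := fun y => exists n, (0 < n)%nat /\ y = - (b n / INR n)).
  assert (Hq : forall n, (0 < n)%nat -> 0 <= b n / INR n).
  { intros n Hn; apply Rmult_le_pos; [easy|left; apply Rinv_0_lt_compat, lt_0_INR; lia]. }
  destruct (completeness Sl) as [M [HM1 HM2]].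
  - exists 0; intros y (n & Hn & ->); specialize (Hq n Hn); lra.
  - exists (- (b 1%nat / INR 1)), 1%nat; split; [lia|easy].
  - assert (HL : forall n, (0 < n)%nat -> - M <= b n / INR n).
    { intros n Hn; assert (H := HM1 (- (b n / INR n)) ltac:(now exists n)); lra. }
    exists (- M); split; [|split].
    + assert (M <= 0); [|lra].
      apply HM2; intros y (n & Hn & ->); specialize (Hq n Hn); lra.
    + intros n Hn; specialize (HL n Hn); assert (0 < INR n) by (apply lt_0_INR; lia).
      apply Rmult_le_compat_r with (r := INR n) in HL; [|lra].
      replace (b n / INR n * INR n) with (b n) in HL by (field; lra); easy.
    + intros ep Hep.
      assert (Hm : exists m, (0 < m)%nat /\ b m / INR m < - M + ep / 2).
      { apply NNPP; intro Hno.
        assert (M <= M - ep / 2); [|lra].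
        apply HM2; intros y (n & Hn & ->).
        destruct (Rlt_dec (b n / INR n) (- M + ep / 2)) as [H|H]; [exfalso; eauto|lra]. }
      destruct Hm as (m & Hm & Hbm).
      set (C := sumR b (seq 0 m)).
      assert (HC : forall r, (r < m)%nat -> b r <= C).
      { intros r Hr; apply (sumR_member b); [auto|apply in_seq; lia]. }
      assert (HC0 : 0 <= C) by (apply sumR_ge0; auto).
      assert (Hmult : forall k r, b (k * m + r)%nat <= INR k * b m + b r).
      { induction k as [|k IH]; intro r; [simpl; lra|].
        replace (S k * m + r)%nat with (m + (k * m + r))%nat by lia.
        rewrite S_INR; specialize (Hsub m (k * m + r)%nat); specialize (IH r); lra. }
      destruct (INR_unbounded (2 * C / ep)) as [N HN].
      exists N; intros n Hn; unfold Rdist.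
      assert (HSn : 0 < INR (S n)) by (apply lt_0_INR; lia).
      assert (Hm' : 0 < INR m) by (apply lt_0_INR; lia).
      assert (Hup : b (S n) / INR (S n) < - M + ep).
      { assert (Hdm := Nat.div_mod (S n) m ltac:(lia)).
        set (k := (S n / m)%nat) in *; set (r := (S n mod m)%nat) in *.
        assert (Hr : (r < m)%nat) by (apply Nat.mod_upper_bound; lia).
        specialize (Hmult k r); replace (k * m + r)%nat with (S n) in Hmult by lia.
        specialize (HC r Hr).
        assert (Hkm : INR k * INR m <= INR (S n)) by (rewrite <- mult_INR; apply le_INR; lia).
        assert (H1 : INR k * b m <= INR (S n) * (b m / INR m)).
        { replace (INR k * b m) with ((INR k * INR m) * (b m / INR m)) by (field; lra).
          apply Rmult_le_compat_r; [apply Hq; lia|easy]. }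
        assert (H2 : C < INR (S n) * (ep / 2)).
        { apply le_INR in Hn; rewrite S_INR.
          assert (H3 : 2 * C / ep < INR n + 1) by lra.
          apply Rmult_lt_compat_r with (r := ep / 2) in H3; [|lra].
          replace (2 * C / ep * (ep / 2)) with C in H3 by (field; lra); easy. }
        assert (H4 : INR (S n) * (b m / INR m) < INR (S n) * (- M + ep / 2))
          by (apply Rmult_lt_compat_l; lra).
        apply Rmult_lt_reg_r with (INR (S n)); [easy|].
        replace (b (S n) / INR (S n) * INR (S n)) with (b (S n)) by (field; lra); lra. }
      specialize (HL (S n) ltac:(lia)).
      rewrite Rabs_right; lra.
Qed.

Lemma periodic_abs_max (f : R -> R) : continuity f -> (forall x, f (x + 1) = f x) ->
  exists m, forall x, Rabs (f x) <= Rabs (f m).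
Proof.
  intros Hc Hp.
  destruct (continuity_ab_maj (fun x => Rabs (f x)) 0 1 ltac:(lra)) as (m & Hm & _).
  { intros x _; apply (continuity_pt_comp f Rabs); [apply Hc|apply Rcontinuity_abs]. }
  exists m; intro x; destruct (base_Int_part x) as [A1 A2].
  replace (f x) with (f (x - IZR (Int_part x))).
  - apply Hm; lra.
  - rewrite <- (periodic0_IZR f Hp (Int_part x)); f_equal; ring.
Qed.

Lemma periodic_continuous_lt (f : R -> R) c : continuity f -> (forall x, f (x + 1) = f x) ->
  (forall x, Rabs (f x) < c) -> exists c0, 0 <= c0 < c /\ forall x, Rabs (f x) <= c0.
Proof.
  intros Hc Hp Hlt; destruct (periodic_abs_max f Hc Hp) as [m Hm].
  exists (Rabs (f m)); split; [split; [apply Rabs_pos|apply Hlt]|easy].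
Qed.

Lemma periodic_continuous_bounded (f : R -> R) : continuity f -> (forall x, f (x + 1) = f x) ->
  exists M, 0 <= M /\ forall x, Rabs (f x) <= M.
Proof.
  intros Hc Hp; destruct (periodic_abs_max f Hc Hp) as [m Hm].
  exists (Rabs (f m)); split; [apply Rabs_pos|easy].
Qed.

(* The exponential rate is an infimum over [n], hence bounded by every single count. *)
Lemma growth_limit {l : nat} {E e g : R -> R} {lam Lam CE : R}
  (HE : expanding l E e g lam Lam CE) (tau f : R -> R) :
  (forall x, derivable_pt_lim tau x (f x)) -> continuity f ->
  (forall x, tau (x + 1) = tau x) -> (forall x, f (x + 1) = f x) ->
  exists Lim, 1 <= Lim /\ NLimit E e tau lam Lim /\
    forall rho Rc n, (0 < n)%nat -> 0 < rho -> (forall x, Rabs (f x) < Rc) ->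
      (forall x t, INR (cnt l g e f (Rc / (lam - 1)) n x t) < rho ^ n) -> Lim < rho.
Proof.
  intros Hder Hcont Htau Hf.
  pose proof (exp_lam _ _ _ _ _ _ _ HE) as Hlam; pose proof (exp_l _ _ _ _ _ _ _ HE) as Hl.
  set (b := fun Rc n => ln (INR (@max_cnt l e g f (Rc / (lam - 1)) n))).
  assert (Hth : forall Rc, 0 < Rc -> 0 < Rc / (lam - 1)).
  { intros Rc HR; apply Rmult_lt_0_compat; [easy|apply Rinv_0_lt_compat; lra]. }
  assert (HRpos : forall Rc, (forall x, Rabs (f x) < Rc) -> 0 < Rc).
  { intros Rc H; specialize (H 0); pose proof (Rabs_pos (f 0)); lra. }
  assert (Hge1 : forall Rc n, 0 < Rc -> 1 <= INR (@max_cnt l e g f (Rc / (lam - 1)) n)).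
  { intros Rc n HR; change 1 with (INR 1); apply le_INR, (max_cnt_pos HE).
    left; auto. }
  assert (Hb0 : forall Rc n, 0 < Rc -> 0 <= b Rc n).
  { intros Rc n HR; unfold b; rewrite <- ln_1.
    destruct (Hge1 Rc n HR) as [H|H]; [left; apply ln_increasing; lra|rewrite <- H; lra]. }
  assert (Hfek : forall Rc, (forall x, Rabs (f x) < Rc) ->
    exists L, 0 <= L /\ (forall n, (0 < n)%nat -> L * INR n <= b Rc n) /\
    Un_cv (fun n => b Rc (S n) / INR (S n)) L).
  { intros Rc HR; assert (HRp := HRpos Rc HR); apply fekete; [auto|].
    intros n m; unfold b.
    assert (Hs := max_cnt_submult HE f Rc n m ltac:(lra) ltac:(intro; left; apply HR)).
    apply le_INR in Hs; rewrite mult_INR in Hs.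
    pose proof (Hge1 Rc n HRp); pose proof (Hge1 Rc m HRp); pose proof (Hge1 Rc (n + m)%nat HRp).
    rewrite <- ln_mult by lra.
    destruct Hs as [Hs|Hs]; [left; apply ln_increasing; lra|rewrite Hs; lra]. }
  (* Applied in both directions, this shows that two admissible values of [Rc] give the same
     limit. *)
  assert (Hcomp : forall Rc Rc' L L', (forall x, Rabs (f x) < Rc) -> (forall x, Rabs (f x) < Rc') ->
    Un_cv (fun n => b Rc (S n) / INR (S n)) L -> 0 <= L' ->
    (forall n, (0 < n)%nat -> L' * INR n <= b Rc' n) -> L' <= L).
  { intros Rc Rc' L L' HR HR' Hcv HL' Hlow.
    destruct (periodic_continuous_lt f Rc Hcont Hf HR) as (R0 & HR0 & Hb).
    destruct (max_cnt_cone_change HE f R0 (Rc / (lam - 1)) (Rc' / (lam - 1)) ltac:(lra) Hb)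
      as [k Hk].
    { apply Rmult_lt_compat_r; [apply Rinv_0_lt_compat|]; lra. }
    { left; auto. }
    assert (Hbk : forall n, b Rc' (n + k)%nat <= b Rc n + ln (INR (l ^ k))).
    { intro n; specialize (Hk n); apply le_INR in Hk; rewrite mult_INR in Hk.
      pose proof (Hge1 Rc n (HRpos Rc HR)); pose proof (Hge1 Rc' (n + k)%nat (HRpos Rc' HR')).
      assert (0 < INR (l ^ k)) by (apply lt_0_INR, Nat.neq_0_lt_0, Nat.pow_nonzero; lia).
      unfold b; rewrite <- ln_mult by lra.
      destruct Hk as [Hk|Hk]; [left; apply ln_increasing; lra|rewrite Hk; lra]. }
    destruct (Rle_dec L' L) as [|Hgt]; [easy|exfalso].
    set (ep := (L' - L) / 2); assert (Hep : 0 < ep) by (unfold ep; lra).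
    destruct (Hcv ep Hep) as [N HN].
    set (C := ln (INR (l ^ k))) in *.
    destruct (INR_unbounded (C / ep)) as [N2 HN2].
    set (n := Nat.max N N2); specialize (HN n ltac:(unfold n; lia)).
    unfold Rdist in HN; apply Rabs_def2 in HN.
    assert (HSn : 0 < INR (S n)) by (apply lt_0_INR; lia).
    assert (H1 : b Rc (S n) < (L + ep) * INR (S n)).
    { apply Rmult_lt_reg_r with (/ INR (S n)); [now apply Rinv_0_lt_compat|].
      replace ((L + ep) * INR (S n) * / INR (S n)) with (L + ep) by (field; lra).
      unfold Rdiv in HN; lra. }
    specialize (Hbk (S n)); specialize (Hlow (S n + k)%nat ltac:(lia)).
    rewrite plus_INR in Hlow; pose proof (pos_INR k).
    assert (H2 : L' * INR (S n) < (L + ep) * INR (S n) + C) by nra.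
    assert (H3 : INR N2 < INR (S n)) by (apply lt_INR; unfold n; lia).
    assert (H4 : C < ep * INR (S n)).
    { apply Rmult_lt_reg_r with (/ ep); [now apply Rinv_0_lt_compat|].
      replace (ep * INR (S n) * / ep) with (INR (S n)) by (field; lra).
      unfold Rdiv in HN2; lra. }
    unfold ep in *; nra. }
  assert (HRex : exists Rc0, forall x, Rabs (f x) < Rc0).
  { destruct (periodic_continuous_bounded f Hcont Hf) as (M & _ & HM).
    exists (M + 1); intro x; specialize (HM x); lra. }
  destruct HRex as [Rc0 HRc0].
  destruct (Hfek Rc0 HRc0) as (L & HL0 & HLlow & HLcv).
  assert (Hall : forall Rc, (forall x, Rabs (f x) < Rc) ->
     Un_cv (fun n => b Rc (S n) / INR (S n)) L /\ forall n, (0 < n)%nat -> L * INR n <= b Rc n).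
  { intros Rc HR; destruct (Hfek Rc HR) as (L' & HL0' & HLlow' & HLcv').
    assert (L' = L) by (apply Rle_antisym; eauto); subst L'; easy. }
  exists (exp L); split; [|split].
  - pose proof (exp_ineq1_le L); lra.
  - intros Df HDf Rc HRc.
    assert (EDf : Df = f)
      by (apply functional_extensionality; intro x; eapply uniqueness_limite; eauto); subst Df.
    exists (fun n => @max_cnt l e g f (Rc / (lam - 1)) (S n)); split.
    + intro n; apply (is_max_cnt_IsNcount HE tau f Htau Hf), max_cnt_spec.
    + destruct (Hall Rc HRc) as [Hcv _].
      assert (Hc := continuity_seq exp _ L
        (derivable_continuous_pt _ _ (derivable_pt_exp L)) Hcv).
      intros ep Hep; destruct (Hc ep Hep) as [N HN]; exists N; intros n Hn.
      specialize (HN n Hn); unfold Rpower; unfold b, Rdiv in HN.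
      rewrite Rmult_comm; exact HN.
  - intros rho Rc n Hn Hrho HRc Hcnt.
    destruct (Hall Rc HRc) as [_ Hlow]; specialize (Hlow n Hn).
    destruct (@max_cnt_spec l e g f (Rc / (lam - 1)) n) as [(x & t & Hmax) _].
    specialize (Hcnt x t).
    assert (Hb : b Rc n < INR n * ln rho).
    { rewrite <- ln_pow by easy; unfold b; rewrite <- Hmax.
      apply ln_increasing; [|easy].
      rewrite Hmax; pose proof (Hge1 Rc n (HRpos Rc HRc)); lra. }
    assert (HnR : 0 < INR n) by (apply lt_0_INR; lia).
    assert (HL : L < ln rho) by nra.
    rewrite <- (exp_ln rho) by easy; now apply exp_increasing.
Qed.

(** * Choice of the perturbation *)

Lemma exists_not_bad {A} (L : list A) (bad : nat -> A -> Prop) I :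
  sumR (fun i => INR (count (bad i) L)) (seq 0 I) < INR (length L) ->
  exists a, In a L /\ forall i, (i < I)%nat -> ~ bad i a.
Proof.
  intro Hlt; apply NNPP; intro Hno.
  assert (INR (length L) <= sumR (fun i => INR (count (bad i) L)) (seq 0 I)); [|lra].
  rewrite (sumR_ext _ (fun i => sumR (fun a => indic (bad i a)) L)) by (intros; apply count_sumR).
  rewrite sumR_exchange.
  replace (INR (length L)) with (sumR (fun _ => 1) L) by (rewrite sumR_const; ring).
  apply sumR_le; intros a Ha.
  assert (Hb : exists i, (i < I)%nat /\ bad i a).
  { apply NNPP; intro Hn; apply Hno; exists a; split; [easy|]; intros i Hi Hbad; eauto. }
  destruct Hb as (i & Hi & Hbad).
  eapply Rle_trans; [|apply (sumR_member (fun i => indic (bad i a)) _ i)].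
  - rewrite indic_1; [lra|easy].
  - intros; apply indic_range.
  - apply in_seq; lia.
Qed.

Lemma sum_half_pow_le I : sumR (fun i => (/ 2) ^ i) (seq 0 I) <= 2 - 2 * (/ 2) ^ I.
Proof.
  induction I as [|I IH]; [simpl; lra|].
  rewrite seq_S, sumR_app; simpl; lra.
Qed.

Lemma finite_family_bound {A} (F : nat -> A -> R) r :
  (forall k, exists M, 0 <= M /\ forall a, Rabs (F k a) <= M) ->
  exists M, 1 <= M /\ forall k a, (k <= r)%nat -> Rabs (F k a) <= M.
Proof.
  intro H; induction r as [|r (M & HM & Hb)].
  - destruct (H 0%nat) as (M & HM & Hb); exists (M + 1); split; [lra|].
    intros k a Hk; replace k with 0%nat by lia; specialize (Hb a); lra.
  - destruct (H (S r)) as (M' & HM' & Hb'); exists (M + M'); split; [lra|].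
    intros k a Hk; destruct (Nat.eq_dec k (S r)) as [->|].
    + specialize (Hb' a); lra.
    + specialize (Hb k a ltac:(lia)); lra.
Qed.

Lemma lipschitz_of_bounded_deriv (F F' : R -> R) M :
  (forall x, derivable_pt_lim F x (F' x)) -> (forall x, Rabs (F' x) <= M) ->
  forall a b, Rabs (F a - F b) <= M * Rabs (a - b).
Proof.
  intros Hd HM.
  assert (Hlt : forall a b, a < b -> Rabs (F b - F a) <= M * Rabs (b - a)).
  { intros a b Hab; destruct (MVT_cor2 F F' a b Hab) as (c & Hc & _); [intros; apply Hd|].
    rewrite Hc, Rabs_mult; apply Rmult_le_compat_r; [apply Rabs_pos|apply HM]. }
  intros a b; destruct (Rtotal_order a b) as [H|[->|H]].
  - rewrite Rabs_minus_sym, (Rabs_minus_sym a b); auto.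
  - rewrite !Rminus_diag, Rabs_R0; lra.
  - auto.
Qed.

Lemma deriv_periodic (F F' : R -> R) c :
  (forall x, derivable_pt_lim F x (F' x)) -> (forall x, F (x + 1) = F x + c) ->
  forall x, F' (x + 1) = F' x.
Proof.
  intros Hd HF x.
  apply (uniqueness_limite (fun y => F (y + 1)) x).
  - rewrite <- (Rmult_1_r (F' (x + 1))).
    apply (derivable_pt_lim_comp (fun y => y + 1) F); [|apply Hd].
    enough (Hid : derivable_pt_lim (fun y => y + 1) x (1 + 0)) by now rewrite Rplus_0_r in Hid.
    apply (derivable_pt_lim_plus id (fun _ => 1));
      [apply derivable_pt_lim_id|apply derivable_pt_lim_const].
  - replace (fun y => F (y + 1)) with (fun y => F y + c)
      by (apply functional_extensionality; intro; symmetry; apply HF).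
    rewrite <- (Rplus_0_r (F' x)).
    apply (derivable_pt_lim_plus F (fun _ => c)); [apply Hd|apply derivable_pt_lim_const].
Qed.

Lemma nfloor_S_bounds z : 0 <= z -> z < INR (S (nfloor z)) <= z + 1.
Proof. intro Hz; rewrite S_INR; pose proof (nfloor_spec z Hz); lra. Qed.

Section Density.

Context {l : nat} {E e g : R -> R} {lam Lam CE : R} (HE : expanding l E e g lam Lam CE).

(** The constants are chosen without circularity: [B] and [q] fix [D], then [Q], [nu], the bumps
    with [G] and [ep], the first scale [n0], the number [I] of scales, and finally the parameter
    mesh [h]. *)
Lemma good_parameter_exists (f0 : R -> R) M0 C1 rho r eps :
  0 <= M0 -> 0 <= C1 -> (forall y, Rabs (f0 y) <= M0) ->
  (forall a b, Rabs (f0 a - f0 b) <= C1 * Rabs (a - b)) ->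
  (forall y, f0 (y + 1) = f0 y) -> 1 < rho -> (2 <= r)%nat -> 0 < eps ->
  exists (P : nat -> R -> R -> R) (G : nat) (h : R) (c : list nat),
    (forall k a y, derivable_pt_lim (P k a) y (P (S k) a y)) /\
    (forall a y, P 0%nat a (y + 1) = P 0%nat a y) /\
    (forall k y, (k <= r)%nat ->
       Rabs (sumR (fun i => INR (nth i c 0%nat) * h * P k (INR i / INR G) y) (seq 0 G)) < eps) /\
    exists Rc n,
      (forall y, Rabs (perturbed G (fun i => P 1%nat (INR i / INR G)) f0 h c y) < Rc) /\
      (0 < n)%nat /\
      forall x t, INR (cnt l g e (perturbed G (fun i => P 1%nat (INR i / INR G)) f0 h c)
                         (Rc / (lam - 1)) n x t) < rho ^ n.
Proof.
  intros HM0 HC1 Hf0 Hlip0 Hper0 Hrho Hr Heps.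
  pose proof (exp_lam _ _ _ _ _ _ _ HE) as Hlam; pose proof (exp_l _ _ _ _ _ _ _ HE) as Hl.
  pose proof (Lam_gt1 HE) as HLam; pose proof (exp_CE _ _ _ _ _ _ _ HE) as HCE.
  assert (Hi1 : 0 < / (lam - 1)) by (apply Rinv_0_lt_compat; lra).
  (* One factor [q] pays for the growth by blocks, the other one absorbs the prefactor that is
     linear in the number of blocks. *)
  set (q := sqrt rho).
  assert (Hq : 1 < q) by (unfold q; rewrite <- sqrt_1; apply sqrt_lt_1; lra).
  assert (Hqq : rho = q ^ 2) by (unfold q; rewrite pow2_sqrt; lra).
  (* Perturbed derivatives stay below [M0 + 1], so the inequality with [Rc] is strict for the whole
     family. *)
  set (Rc := M0 + 2); set (th := Rc / (lam - 1)).
  assert (Hth : 0 < th) by (apply Rmult_lt_0_compat; [unfold Rc; lra|easy]).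
  set (B := Lam + th * CE + (C1 + 1)).
  assert (HB : 1 < B).
  { unfold B; assert (0 <= th * CE) by (apply Rmult_le_pos; lra); lra. }
  destruct (linear_lt_pow q (2 * B ^ 2) 0 Hq) as [N1 HN1].
  set (D := Nat.max N1 1).
  assert (HD : (0 < D)%nat) by (unfold D; lia).
  assert (HqD : 2 * B ^ 2 <= q ^ D) by (specialize (HN1 D ltac:(unfold D; lia)); lra).
  assert (HDR : 1 <= INR D) by (change 1 with (INR 1); apply le_INR; lia).
  assert (Hil : 0 < / lam < 1).
  { split; [apply Rinv_0_lt_compat; lra|]; rewrite <- Rinv_1; apply Rinv_lt_contravar; lra. }
  destruct (pow_lt_1_zero (/ lam) ltac:(rewrite Rabs_right; lra) ((lam - 1) / (16 * INR D)))
    as [Q HQ].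
  { apply Rmult_lt_0_compat; [lra|apply Rinv_0_lt_compat; lra]. }
  assert (HQ' : INR D * ((/ lam) ^ Q / (lam - 1)) <= 1 / 16).
  { specialize (HQ Q (Nat.le_refl Q)).
    assert (0 < (/ lam) ^ Q) by (apply pow_lt; lra); rewrite Rabs_right in HQ by lra.
    apply Rle_trans with (INR D * ((lam - 1) / (16 * INR D) / (lam - 1))).
    - apply Rmult_le_compat_l; [lra|]; apply Rmult_le_compat_r; lra.
    - right; field; lra. }
  (* The number of good prefixes to be allowed is linear in [N = nu + Q], so a large [nu] brings it
     below [q ^ N]; [Q] is already fixed, hence so is [l ^ Q]. *)
  destruct (linear_lt_pow q (INR D * INR (l ^ Q)) (2 * (INR D * INR (l ^ Q))) Hq) as [N2 HN2].
  set (nu := Nat.max N2 1).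
  assert (Hnu : (0 < nu)%nat) by (unfold nu; lia).
  set (N := (nu + Q)%nat).
  set (D2 := (((2 * N + 1) * D) * l ^ Q)%nat).
  assert (HD2 : INR D2 <= q ^ N).
  { specialize (HN2 N ltac:(unfold N, nu; lia)); unfold D2.
    rewrite !mult_INR, plus_INR, mult_INR; simpl (INR 2); simpl (INR 1); lra. }
  set (de := / Lam ^ nu / 2).
  assert (HLnu : 1 <= Lam ^ nu) by (apply pow_R1_Rle; lra).
  assert (Hde : 0 < de <= 1 / 2).
  { unfold de; assert (0 < / Lam ^ nu) by (apply Rinv_0_lt_compat; lra).
    assert (/ Lam ^ nu <= 1) by (rewrite <- Rinv_1; apply Rinv_le_contravar; lra); lra. }
  set (S0 := 1 + INR nu * Lam ^ nu + / (lam - 1)).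
  assert (HS0 : 1 <= S0).
  { unfold S0; assert (0 <= INR nu * Lam ^ nu)
      by (apply Rmult_le_pos; [apply pos_INR|lra]); lra. }
  set (et := / (16 * (INR D * S0))).
  assert (HDS : 1 <= INR D * S0) by nra.
  assert (Het : 0 < et) by (apply Rinv_0_lt_compat; lra).
  assert (HetD : INR D * (et * S0) <= 1 / 16) by (right; unfold et; field; split; lra).
  destruct (bump_exists et (de / 2) Het ltac:(lra)) as (K & HwK & Hfar & ka & Hka & Hnear).
  destruct (bump_primitive K) as (P & HPd & HP1 & HPper & HPb).
  destruct (finite_family_bound (fun k (p : R * R) => P k (fst p) (snd p)) r) as (M & HM & HMb).
  { intro k; destruct (HPb k) as (M & HM & Hb); exists M; split; [easy|]; intros [a y]; apply Hb. }
  assert (HMb' : forall k a y, (k <= r)%nat -> Rabs (P k a y) <= M)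
    by (intros k a y Hk; exact (HMb k (a, y) Hk)).
  clear HMb HPb.
  set (G := S (nfloor (/ ka + 4 / de))).
  assert (HG : (0 < G)%nat) by (unfold G; lia).
  assert (HGR : / ka + 4 / de < INR G).
  { apply nfloor_S_bounds.
    assert (0 < / ka) by now apply Rinv_0_lt_compat.
    assert (0 < 4 / de) by (apply Rmult_lt_0_compat; [lra|apply Rinv_0_lt_compat; lra]); lra. }
  assert (HGka : / INR G <= ka).
  { rewrite <- (Rinv_inv ka); apply Rinv_le_contravar; [now apply Rinv_0_lt_compat|].
    assert (0 < 4 / de) by (apply Rmult_lt_0_compat; [lra|apply Rinv_0_lt_compat; lra]); lra. }
  assert (HGde : / INR G <= de / 4).
  { replace (de / 4) with (/ (4 / de)) by (field; lra).
    apply Rinv_le_contravar;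
      [apply Rmult_lt_0_compat; [lra|apply Rinv_0_lt_compat; lra]|].
    assert (0 < / ka) by now apply Rinv_0_lt_compat.
    lra. }
  assert (HGp : 0 < INR G) by (apply lt_0_INR; lia).
  set (b := fun i : nat => P 1%nat (INR i / INR G)).
  (* [ep] bounds each coefficient; with [G] bumps bounded by [M] up to order [r], the perturbation
     stays below [Rmin eps 1 / 2]. The 1 keeps [Rc] and [B] valid for the family. *)
  set (ep := Rmin eps 1 / (2 * INR G * M)).
  assert (Hmin : 0 < Rmin eps 1) by (apply Rmin_glb_lt; lra).
  assert (HGM : 0 < 2 * INR G * M) by (apply Rmult_lt_0_compat; lra).
  assert (Hep : 0 < ep) by (apply Rmult_lt_0_compat; [easy|now apply Rinv_0_lt_compat]).
  assert (HepGM : INR G * (ep * M) = Rmin eps 1 / 2) by (unfold ep; field; lra).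
  pose proof (Rmin_l eps 1) as Hme; pose proof (Rmin_r eps 1) as Hm1.
  set (C0 := exp (CE / (lam - 1))).
  assert (HC0 : 0 < C0) by apply exp_pos.
  set (Y := 18 * th * C0 / ep).
  assert (HY : 0 < Y).
  { apply Rmult_lt_0_compat; [|now apply Rinv_0_lt_compat]; apply Rmult_lt_0_compat; lra. }
  (* All factors of the moment bound that depend neither on the scale [n] nor on [H]. *)
  set (K1 := 3 * (/ th + 1) * (B ^ N) ^ 2 * (INR l ^ N) ^ D * Y ^ D).
  assert (HlR : 0 < INR l) by (apply lt_0_INR; lia).
  assert (HBN : 0 < B ^ N) by (apply pow_lt; lra).
  assert (Hith : 0 < / th) by now apply Rinv_0_lt_compat.
  assert (HK1 : 0 < K1).
  { unfold K1; repeat apply Rmult_lt_0_compat; try lra; repeat apply pow_lt; easy. }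
  (* Scale [n0 + i * N] is bad with proportion at most [K1 * (/ 2) ^ (n0 + i)]; the sum over [i]
     must be below 1. *)
  destruct (pow_lt_1_zero (/ 2) ltac:(rewrite Rabs_right; lra) (/ (2 * K1))) as [n0 Hn0].
  { apply Rinv_0_lt_compat; lra. }
  specialize (Hn0 n0 (Nat.le_refl n0)).
  assert (Hh0 : 0 < (/ 2) ^ n0) by (apply pow_lt; lra).
  rewrite Rabs_right in Hn0 by lra.
  destruct (linear_lt_pow q (INR l ^ n0) (INR l ^ N * q ^ n0) Hq) as [N3 HN3].
  set (I := Nat.max N3 1).
  set (nmax := (n0 + I * N)%nat).
  (* The mesh [h = ep / H] is adapted to the largest scale [nmax]; refining the grid leaves the
     bound on the bad proportion unchanged. *)
  set (H := S (nfloor (ep * Lam ^ (Q + nmax) / (2 * th)))).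
  set (h := ep / INR H).
  assert (HH : 0 < INR H) by (apply lt_0_INR; unfold H; lia).
  assert (Hh : 0 < h) by (apply Rmult_lt_0_compat; [easy|now apply Rinv_0_lt_compat]).
  assert (HhH : INR H * h = ep) by (unfold h; field; lra).
  assert (Hhmax : h * Lam ^ (Q + nmax) <= 2 * th).
  { assert (HHb : ep * Lam ^ (Q + nmax) / (2 * th) < INR H).
    { apply nfloor_S_bounds; apply Rmult_le_pos; [|left; apply Rinv_0_lt_compat; lra].
      apply Rmult_le_pos; [lra|apply pow_le; lra]. }
    apply Rmult_le_reg_r with (INR H / (2 * th));
      [apply Rmult_lt_0_compat; [easy|apply Rinv_0_lt_compat; lra]|].
    replace (h * Lam ^ (Q + nmax) * (INR H / (2 * th)))
      with (ep * Lam ^ (Q + nmax) / (2 * th)) by (unfold h; field; lra).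
    replace (2 * th * (INR H / (2 * th))) with (INR H) by (field; lra); lra. }
  assert (Hcoef : forall c i, In c (params H G) -> (i < G)%nat ->
     Rabs (INR (nth i c 0%nat) * h) <= ep).
  { intros c i Hc Hi; apply In_params in Hc as [_ Hc]; specialize (Hc i Hi).
    apply lt_INR in Hc; pose proof (pos_INR (nth i c 0%nat)).
    rewrite Rabs_right by nra; rewrite <- HhH; apply Rmult_le_compat_r; lra. }
  assert (Hsum : forall c (w : nat -> R) m, In c (params H G) ->
     (forall i, Rabs (w i) <= m) ->
     Rabs (sumR (fun i => INR (nth i c 0%nat) * h * w i) (seq 0 G)) <= INR G * (ep * m)).
  { intros c w m Hc Hw; eapply Rle_trans; [apply Rabs_sumR|].
    replace (INR G) with (INR (length (seq 0 G))) by now rewrite length_seq.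
    rewrite <- sumR_const; apply sumR_le; intros i Hi; apply in_seq in Hi.
    rewrite Rabs_mult; apply Rmult_le_compat; try apply Rabs_pos; [apply Hcoef; easy|apply Hw]. }
  assert (HP1per : forall a y, P 1%nat a (y + 1) = P 1%nat a y).
  { intros a; apply (deriv_periodic (P 0%nat a) (P 1%nat a) 0); [apply HPd|].
    intro y; rewrite HPper; ring. }
  assert (Hfam : forall c, In c (params H G) ->
    (forall y, Rabs (perturbed G b f0 h c y) <= M0 + 1) /\
    (forall a b', Rabs (perturbed G b f0 h c a - perturbed G b f0 h c b')
                  <= (C1 + 1) * Rabs (a - b')) /\
    (forall y, perturbed G b f0 h c (y + 1) = perturbed G b f0 h c y)).
  { intros c Hc; unfold perturbed; split; [|split].
    - intro y; eapply Rle_trans; [apply Rabs_triang|].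
      assert (H1 := Hsum c (fun i => b i y) M Hc ltac:(intro; apply HMb'; lia)).
      rewrite HepGM in H1; specialize (Hf0 y); cbv beta in H1; lra.
    - intros a b'.
      assert (H1 := Hsum c (fun i => b i a - b i b') (M * Rabs (a - b')) Hc).
      assert (H2 : forall i, Rabs (b i a - b i b') <= M * Rabs (a - b')).
      { intro i; apply (lipschitz_of_bounded_deriv _ (P 2%nat (INR i / INR G)));
          [apply HPd|intro; apply HMb'; lia]. }
      specialize (H1 H2).
      replace (INR G * (ep * (M * Rabs (a - b')))) with (INR G * (ep * M) * Rabs (a - b')) in H1
        by ring.
      rewrite HepGM in H1.
      set (s1 := sumR (fun i => INR (nth i c 0%nat) * h * (b i a - b i b')) (seq 0 G)) in *.
      replace (f0 a + sumR (fun i => INR (nth i c 0%nat) * h * b i a) (seq 0 G)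
         - (f0 b' + sumR (fun i => INR (nth i c 0%nat) * h * b i b') (seq 0 G)))
        with ((f0 a - f0 b') + s1).
      + eapply Rle_trans; [apply Rabs_triang|]; specialize (Hlip0 a b').
        pose proof (Rabs_pos (a - b')); nra.
      + unfold s1; rewrite (sumR_ext (fun i => INR (nth i c 0%nat) * h * (b i a - b i b'))
          (fun i => INR (nth i c 0%nat) * h * b i a
             + (-1) * (INR (nth i c 0%nat) * h * b i b'))) by (intros; ring).
        rewrite sumR_plus, sumR_scal; ring.
    - intro y; rewrite Hper0; f_equal; apply sumR_ext; intros i _; unfold b; now rewrite HP1per. }
  set (bad := fun i c => exists x t, (D2 <=
     count (good l g e (perturbed G b f0 h c) th q (n0 + i * N) x t) (words l N))%nat).
  assert (Hbad : forall i, (i < I)%nat ->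
    INR (count (bad i) (params H G)) <= INR H ^ G * K1 * (/ 2) ^ n0 * (/ 2) ^ i).
  { intros i Hi; set (n := (n0 + i * N)%nat).
    assert (Hn : (n <= nmax)%nat) by (unfold n, nmax; nia).
    (* The mesh in [(x, t)] for which the Lipschitz error over [N + n] steps is exactly [th]. *)
    set (s := th / B ^ (N + n)).
    assert (HBn : 0 < B ^ (N + n)) by (apply pow_lt; lra).
    assert (HBn1 : 1 <= B ^ (N + n)) by (apply pow_R1_Rle; lra).
    assert (Hs : 0 < s) by (apply Rmult_lt_0_compat; [easy|now apply Rinv_0_lt_compat]).
    assert (His : 0 < / s) by now apply Rinv_0_lt_compat.
    set (gx := S (nfloor (/ s))); set (gt := S (nfloor (2 * th / s))).
    assert (H2s : 0 < 2 * th / s) by (apply Rmult_lt_0_compat; lra).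
    assert (Hgx := nfloor_S_bounds (/ s) ltac:(lra)); fold gx in Hgx.
    assert (Hgt := nfloor_S_bounds (2 * th / s) ltac:(lra)); fold gt in Hgt.
    assert (Hcount := count_bad_params HE G b et de h nu Q D HG HGde ltac:(lra) ltac:(lra)).
    assert (Hbd : INR (count (bad i) (params H G)) * q ^ (n * D) * INR H ^ D
      <= INR gx * INR gt * (INR l ^ N) ^ D * INR H ^ G * (18 * th * C0 / h) ^ D).
    { eapply Hcount with (s := s) (Cf := C1 + 1) (B := B); try easy.
      - intros j y; unfold b; rewrite HP1; apply bmp_bounds.
      - intros j y; unfold b; rewrite HP1; pose proof (bmp_bounds K (INR j / INR G) y); lra.
      - intros j y Hf; unfold b; rewrite HP1; now apply Hfar.
      - intros j y m Hm; unfold b; rewrite HP1; apply (Hnear _ _ m); lra.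
      - unfold Rc; lra.
      - lra.
      - intros c Hc; destruct (Hfam c Hc) as (F1 & F2 & F3); split; [|split; easy].
        intro y; specialize (F1 y); unfold Rc; lra.
      - fold th; fold N; right; unfold s; field; lra.
      - replace 1 with (/ s * s) by (field; lra); apply Rmult_le_compat_r; lra.
      - fold th; replace (2 * th) with (2 * th / s * s) by (field; lra).
        apply Rmult_lt_compat_r; lra.
      - fold th; eapply Rle_trans; [|exact Hhmax]; apply Rmult_le_compat_l; [lra|].
        apply Rle_pow; [lra|lia]. }
    assert (Hgx' : INR gx <= (/ th + 1) * B ^ (N + n)).
    { replace (/ s) with (/ th * B ^ (N + n)) in Hgx by (unfold s; field; lra); nra. }
    assert (Hgt' : INR gt <= 3 * B ^ (N + n)).
    { replace (2 * th / s) with (2 * B ^ (N + n)) in Hgt by (unfold s; field; lra); lra. }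
    assert (HHD : 0 < INR H ^ D) by now apply pow_lt.
    assert (HHG : 0 < INR H ^ G) by now apply pow_lt.
    (* The factor [INR H ^ D] cancels the one on the left, which makes the proportion independent of
       [H]. *)
    assert (HX : (18 * th * C0 / h) ^ D = Y ^ D * INR H ^ D).
    { rewrite <- Rpow_mult_distr; f_equal; unfold Y, h; field; lra. }
    assert (Hgg : INR gx * INR gt <= 3 * (/ th + 1) * (B ^ N) ^ 2 * (B ^ 2) ^ n).
    { apply Rle_trans with ((/ th + 1) * B ^ (N + n) * (3 * B ^ (N + n))).
      - apply Rmult_le_compat; try apply pos_INR; easy.
      - right; rewrite <- (pow_mult B 2 n), (Nat.mul_comm 2 n), (pow_mult B n 2), pow_add; ring. }
    assert (HlND : 0 < (INR l ^ N) ^ D) by (repeat apply pow_lt; easy).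
    assert (HYD : 0 < Y ^ D) by now apply pow_lt.
    assert (HB2 : 0 < (B ^ 2) ^ n) by (apply pow_lt, pow_lt; lra).
    assert (Hfinal : INR (count (bad i) (params H G)) * q ^ (n * D)
      <= INR H ^ G * K1 * (B ^ 2) ^ n).
    { apply Rmult_le_reg_r with (INR H ^ D); [easy|].
      eapply Rle_trans; [exact Hbd|]; rewrite HX.
      replace (INR gx * INR gt * (INR l ^ N) ^ D * INR H ^ G * (Y ^ D * INR H ^ D))
        with (INR gx * INR gt * ((INR l ^ N) ^ D * INR H ^ G * Y ^ D * INR H ^ D)) by ring.
      replace (INR H ^ G * K1 * (B ^ 2) ^ n * INR H ^ D)
        with (3 * (/ th + 1) * (B ^ N) ^ 2 * (B ^ 2) ^ n
              * ((INR l ^ N) ^ D * INR H ^ G * Y ^ D * INR H ^ D)) by (unfold K1; ring).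
      apply Rmult_le_compat_r; [|easy].
      left; apply Rmult_lt_0_compat; [apply Rmult_lt_0_compat; [apply Rmult_lt_0_compat|]|]; easy. }
    (* [B ^ 2] per step is spent on the grid points in [(x, t)], and the spare [2] gives the decay
       in [n]. *)
    assert (Hqn : 2 ^ n * (B ^ 2) ^ n <= q ^ (n * D)).
    { rewrite <- Rpow_mult_distr, Nat.mul_comm, pow_mult; apply pow_incr.
      assert (0 < B ^ 2) by (apply pow_lt; lra); lra. }
    assert (H2n : 0 < 2 ^ n) by (apply pow_lt; lra).
    assert (Hc0 : 0 <= INR (count (bad i) (params H G))) by apply pos_INR.
    set (ct := INR (count (bad i) (params H G))) in *.
    assert (Hct : ct * 2 ^ n <= INR H ^ G * K1).
    { apply Rmult_le_reg_r with ((B ^ 2) ^ n); [easy|].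
      eapply Rle_trans; [|exact Hfinal].
      rewrite Rmult_assoc; now apply Rmult_le_compat_l. }
    assert (Hct2 : ct <= INR H ^ G * K1 * (/ 2) ^ n).
    { apply Rmult_le_reg_r with (2 ^ n); [easy|].
      rewrite (Rmult_assoc (INR H ^ G * K1)), <- Rpow_mult_distr.
      replace (/ 2 * 2) with 1 by field; rewrite pow1; lra. }
    eapply Rle_trans; [exact Hct2|].
    rewrite (Rmult_assoc (INR H ^ G * K1)); apply Rmult_le_compat_l; [nra|].
    rewrite <- pow_add.
    assert (Hle : (n0 + i <= n)%nat) by (unfold n, N, nu; nia).
    replace n with ((n0 + i) + (n - (n0 + i)))%nat by lia; rewrite pow_add.
    assert (Hp1 : 0 < (/ 2) ^ (n0 + i)) by (apply pow_lt; lra).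
    assert (Hp2 : (/ 2) ^ (n - (n0 + i)) <= 1).
    { rewrite <- (pow1 (n - (n0 + i))); apply pow_incr; lra. }
    nra. }
  destruct (exists_not_bad (params H G) bad I) as (c & Hc & Hnb).
  { rewrite length_params.
    assert (HHG : 0 < INR H ^ G) by now apply pow_lt.
    apply Rle_lt_trans with (sumR (fun i => INR H ^ G * K1 * (/ 2) ^ n0 * (/ 2) ^ i) (seq 0 I)).
    - apply sumR_le; intros i Hi; apply in_seq in Hi; apply Hbad; lia.
    - rewrite sumR_scal.
      pose proof (sum_half_pow_le I) as Hhalf.
      assert (HhI : 0 < (/ 2) ^ I) by (apply pow_lt; lra).
      assert (Hsmall : K1 * (/ 2) ^ n0 < 1 / 2).
      { apply Rmult_lt_compat_l with (r := K1) in Hn0; [|easy].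
        replace (K1 * / (2 * K1)) with (1 / 2) in Hn0 by (field; lra); easy. }
      set (sm := sumR (fun i => (/ 2) ^ i) (seq 0 I)) in *.
      assert (Hkn : 0 < K1 * (/ 2) ^ n0) by (now apply Rmult_lt_0_compat).
      rewrite !Rmult_assoc, <- (Rmult_assoc K1).
      rewrite <- (Rmult_1_r (INR H ^ G)) at 2; apply Rmult_lt_compat_l; [easy|].
      apply Rle_lt_trans with (K1 * (/ 2) ^ n0 * 2); [apply Rmult_le_compat_l; lra|lra]. }
  exists P, G, h, c; split; [easy|]; split; [easy|]; split.
  - intros k y Hk.
    assert (H1 := Hsum c (fun i => P k (INR i / INR G) y) M Hc ltac:(intro; now apply HMb')).
    rewrite HepGM in H1; cbv beta in H1; lra.
  - exists Rc, nmax; split; [|split].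
    + intro y; destruct (Hfam c Hc) as (F1 & _); specialize (F1 y); unfold Rc; fold b; lra.
    + unfold nmax, I, N, nu; nia.
    + intros x t; fold b; fold th.
      eapply Rle_lt_trans.
      * apply (cnt_growth (perturbed G b f0 h c) th q n0 N D2 I Hq HD2); [|lia].
        intros i x' t' Hi; apply not_ge; intro Hge; apply (Hnb i Hi); exists x', t'; lia.
      * specialize (HN3 I ltac:(unfold I; lia)).
        assert (HqI : 0 < q ^ (I * N)) by (apply pow_lt; lra).
        apply Rlt_le_trans with (q ^ (I * N) * q ^ I).
        -- apply Rmult_lt_compat_l; [easy|]; lra.
        -- rewrite <- pow_add, Hqq, <- pow_mult; apply Rle_pow; [lra|].
           unfold nmax, N, nu; nia.
Qed.

End Density.

(** * Genericity *)

Lemma DerivSeq_C2 r f d : (2 <= r)%nat -> DerivSeq r f d ->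
  (forall x, derivable_pt_lim f x (d 1%nat x)) /\
  (forall x, derivable_pt_lim (d 1%nat) x (d 2%nat x)) /\
  continuity (d 1%nat) /\ continuity (d 2%nat).
Proof.
  intros Hr (H0 & Hd & Hc).
  assert (E0 : d 0%nat = f) by (apply functional_extensionality, H0).
  assert (Hcont : forall k, (k < r)%nat -> continuity (d k)).
  { intros k Hk x; apply derivable_continuous_pt; exists (d (S k) x); now apply Hd. }
  split; [|split; [|split]].
  - intro x; rewrite <- E0; apply Hd; lia.
  - intro x; apply Hd; lia.
  - apply Hcont; lia.
  - destruct (Nat.eq_dec r 2) as [->|]; [easy|apply Hcont; lia].
Qed.

Lemma DerivSeq_periodic_lipschitz r f d c : (2 <= r)%nat -> DerivSeq r f d ->
  (forall x, f (x + 1) = f x + c) ->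
  (forall x, d 1%nat (x + 1) = d 1%nat x) /\
  exists C, 0 <= C /\ forall a b, Rabs (d 1%nat a - d 1%nat b) <= C * Rabs (a - b).
Proof.
  intros Hr Hd Hper; destruct (DerivSeq_C2 r f d Hr Hd) as (D1 & D2 & C1 & C2).
  assert (P1 : forall x, d 1%nat (x + 1) = d 1%nat x) by (apply (deriv_periodic f _ c); easy).
  split; [easy|].
  assert (P2 : forall x, d 2%nat (x + 1) = d 2%nat x).
  { apply (deriv_periodic (d 1%nat) _ 0); [easy|]; intro; rewrite P1; ring. }
  destruct (periodic_continuous_bounded (d 2%nat) C2 P2) as (M & HM & Hb).
  exists M; split; [easy|]; now apply (lipschitz_of_bounded_deriv _ (d 2%nat)).
Qed.

Lemma expanding_lift r l E dE lam Lam : (2 <= r)%nat -> (2 <= l)%nat ->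
  DerivSeq r E dE -> CircleLift l E -> 1 < lam ->
  (forall x, lam <= dE 1%nat x <= Lam) ->
  exists g CE, expanding l E (dE 1%nat) g lam Lam CE.
Proof.
  intros Hr Hl HD Hlift Hlam Hb.
  destruct (DerivSeq_C2 r E dE Hr HD) as (D1 & D2 & C1 & C2).
  destruct (DerivSeq_periodic_lipschitz r E dE (INR l) Hr HD Hlift) as (P1 & CE & HCE & Hlip).
  assert (Hsurj : forall y, exists x, E x = y).
  { intro y.
    assert (Hgrow : forall a b, a < b -> lam * (b - a) <= E b - E a).
    { intros a b Hab; destruct (MVT_cor2 E (dE 1%nat) a b Hab) as (c & Hc & _);
        [intros; apply D1|].
      rewrite Hc; apply Rmult_le_compat_r; [lra|apply Hb]. }
    set (A := Rabs (y - E 0) + 1).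
    assert (HA : 0 < A) by (unfold A; pose proof (Rabs_pos (y - E 0)); lra).
    pose proof (Hgrow 0 A HA) as H1; pose proof (Hgrow (- A) 0 ltac:(lra)) as H2.
    pose proof (Rle_abs (y - E 0)) as H3; pose proof (Rle_abs (- (y - E 0))) as H4.
    rewrite Rabs_Ropp in H4.
    destruct (IVT (fun x => E x - y) (- A) A) as (x & _ & Hx).
    - intro x; apply continuity_pt_minus; [|apply continuity_pt_const; easy].
      apply derivable_continuous_pt; exists (dE 1%nat x); apply D1.
    - lra.
    - unfold A in *; nra.
    - unfold A in *; nra.
    - exists x; lra. }
  set (g := fun y => epsilon (inhabits 0) (fun x => E x = y)).
  exists g, CE; constructor; try easy.
  intro y; apply (epsilon_spec (inhabits 0) (fun x => E x = y)), Hsurj.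
Qed.

Lemma derivable_pt_lim_sumR {A} (F F' : A -> R -> R) (L : list A) x :
  (forall a, derivable_pt_lim (F a) x (F' a x)) ->
  derivable_pt_lim (fun y => sumR (fun a => F a y) L) x (sumR (fun a => F' a x) L).
Proof.
  intro H; induction L as [|a L IH]; simpl; [apply derivable_pt_lim_const|].
  now apply (derivable_pt_lim_plus (F a) (fun y => sumR (fun a => F a y) L)).
Qed.

Section Genericity.

Context {l : nat} {E e g : R -> R} {lam Lam CE : R} (HE : expanding l E e g lam Lam CE).
Context (r : nat) (Hr : (2 <= r)%nat).

(** A finite certificate for a rate below [rho]: one cone and one time. It is stable under small
    changes of [tau]. *)
Definition slow (rho : R) (tau : R -> R) : Prop :=
  CrS1 r tau /\ exists f Rc n,
    (forall x, derivable_pt_lim tau x (f x)) /\ (forall x, Rabs (f x) < Rc) /\ (0 < n)%nat /\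
    forall x t, INR (cnt l g e f (Rc / (lam - 1)) n x t) < rho ^ n.

Lemma CrS1_deriv tau : CrS1 r tau -> exists d, DerivSeq r tau d /\
  (forall x, derivable_pt_lim tau x (d 1%nat x)) /\ continuity (d 1%nat) /\
  (forall x, d 1%nat (x + 1) = d 1%nat x) /\
  exists C, 0 <= C /\ forall a b, Rabs (d 1%nat a - d 1%nat b) <= C * Rabs (a - b).
Proof.
  intros [[d Hd] Hper]; exists d.
  destruct (DerivSeq_C2 r tau d Hr Hd) as (D1 & _ & C1 & _).
  destruct (DerivSeq_periodic_lipschitz r tau d 0 Hr Hd) as (P1 & HC); [|easy].
  intro x; rewrite Hper; ring.
Qed.

Lemma slow_open rho : OpenCr r (slow rho).
Proof.
  pose proof (exp_lam _ _ _ _ _ _ _ HE) as Hlam; pose proof (Lam_gt1 HE) as HLam.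
  split; [now intros tau [H _]|].
  intros tau (Htau & f & Rc & n & Hder & HRc & Hn & Hcnt).
  destruct (CrS1_deriv tau Htau) as (d & Hd & D1 & C1 & P1 & _).
  assert (Ef : d 1%nat = f)
    by (apply functional_extensionality; intro x; eapply uniqueness_limite; eauto).
  rewrite Ef in *.
  destruct (periodic_continuous_lt f Rc C1 P1 HRc) as (R0 & HR0 & HR0b).
  set (R1 := (R0 + Rc) / 2).
  assert (Hpow : 0 < Lam ^ n) by (apply pow_lt; lra).
  assert (HnR : 0 < INR n) by (apply lt_0_INR; lia).
  (* The certificate is passed on with the smaller cone given by [R1]; the width
     [(Rc - R1) / (lam - 1)] gained absorbs the change of slopes in [n] steps when the derivatives
     differ by at most [A]. *)
  set (A := (Rc - R1) / (lam - 1) / (Lam ^ n * INR n)).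
  assert (HA : 0 < A).
  { apply Rmult_lt_0_compat; [apply Rmult_lt_0_compat|]; try apply Rinv_0_lt_compat;
      try apply Rmult_lt_0_compat; unfold R1; lra. }
  exists (Rmin ((Rc - R0) / 2) A); split; [apply Rmin_glb_lt; [lra|easy]|].
  intros sigma Hsig (ds & dt & Hds & Hdt & Hclose); split; [easy|].
  destruct (DerivSeq_C2 r sigma ds Hr Hds) as (S1 & _); destruct (DerivSeq_C2 r tau dt Hr Hdt) as (T1 & _).
  assert (Edt : dt 1%nat = f)
    by (apply functional_extensionality; intro x; eapply uniqueness_limite; eauto).
  assert (Hdiff : forall x, Rabs (ds 1%nat x - f x) < Rmin ((Rc - R0) / 2) A).
  { intro x; rewrite <- Edt; apply Hclose; lia. }
  pose proof (Rmin_l ((Rc - R0) / 2) A) as Hm1; pose proof (Rmin_r ((Rc - R0) / 2) A) as Hm2.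
  exists (ds 1%nat), R1, n; split; [easy|]; split; [|split; [easy|]].
  - intro x; specialize (Hdiff x); specialize (HR0b x).
    replace (ds 1%nat x) with ((ds 1%nat x - f x) + f x) by ring.
    eapply Rle_lt_trans; [apply Rabs_triang|]; unfold R1; lra.
  - intros x t; eapply Rle_lt_trans; [|apply (Hcnt x t)].
    apply le_INR, count_le; intros u Hu Hs; apply In_words in Hu as [Hu _].
    assert (Hp := sl_perturb HE (ds 1%nat) f A u
      ltac:(intro y; specialize (Hdiff y); lra) x t t 0 ltac:(rewrite Rminus_diag, Rabs_R0; lra)).
    rewrite Hu, Rplus_0_l in Hp.
    replace (Lam ^ n * (INR n * A)) with ((Rc - R1) / (lam - 1)) in Hp
      by (unfold A; field; repeat split; lra).
    replace (sl g e f x t u)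
      with (sl g e (ds 1%nat) x t u + - (sl g e (ds 1%nat) x t u - sl g e f x t u)) by ring.
    eapply Rle_trans; [apply Rabs_triang|]; rewrite Rabs_Ropp.
    replace (Rc / (lam - 1)) with (R1 / (lam - 1) + (Rc - R1) / (lam - 1)) by (field; lra).
    lra.
Qed.

Lemma slow_dense rho : 1 < rho -> DenseCr r (slow rho).
Proof.
  intros Hrho tau eps Htau Heps.
  destruct (CrS1_deriv tau Htau) as (d & Hd & D1 & C1 & P1 & Cl & HCl & Hlip).
  destruct (periodic_continuous_bounded (d 1%nat) C1 P1) as (M0 & HM0 & Hb).
  destruct (good_parameter_exists HE (d 1%nat) M0 Cl rho r eps)
    as (P & G & h & c & HPd & HPper & Hsmall & Rc & n & HRc & Hn & Hcnt); try easy.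
  set (w := fun k y => sumR (fun i => INR (nth i c 0%nat) * h * P k (INR i / INR G) y) (seq 0 G)).
  set (ds := fun k y => d k y + w k y).
  assert (Hw : forall k y, derivable_pt_lim (w k) y (w (S k) y)).
  { intros k y.
    apply (derivable_pt_lim_sumR (fun i y => INR (nth i c 0%nat) * h * P k (INR i / INR G) y)
      (fun i y => INR (nth i c 0%nat) * h * P (S k) (INR i / INR G) y)).
    intro i; apply (derivable_pt_lim_scal (P k (INR i / INR G))), HPd. }
  destruct Htau as [_ Hper]; destruct Hd as (E0 & Hdd & Hdc).
  assert (Hds : DerivSeq r (ds 0%nat) ds).
  { split; [easy|]; split.
    - intros k x Hk; apply (derivable_pt_lim_plus (d k) (w k)); [now apply Hdd|apply Hw].
    - intro x; apply (continuity_pt_plus (d r) (w r)); [apply Hdc|].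
      apply derivable_continuous_pt; exists (w (S r) x); apply Hw. }
  exists (ds 0%nat); split; [split|].
  - split; [now exists ds|].
    intro x; unfold ds, w; rewrite !E0, Hper; f_equal.
    apply sumR_ext; intros i _; now rewrite HPper.
  - exists (ds 1%nat), Rc, n; split; [|split; [|split]]; try easy.
    intro x; destruct (DerivSeq_C2 r _ _ Hr Hds) as (H1 & _); apply H1.
  - exists ds, d; split; [easy|]; split; [now split|].
    intros k x Hk; unfold ds; replace (d k x + w k x - d k x) with (w k x) by ring.
    now apply Hsmall.
Qed.

End Genericity.

Theorem theorem1 (r : nat) (l : nat) (E : R -> R) (dE : nat -> R -> R)
  (lam Lam : R) :
  (2 <= r)%nat -> (2 <= l)%nat ->
  DerivSeq r E dE -> CircleLift l E ->
  1 < lam -> lam <= Lam ->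
  (forall x, lam <= dE 1%nat x <= Lam) ->
  (forall rho : R, rho > 1 ->
     exists V : (R -> R) -> Prop,
       OpenCr r V /\ DenseCr r V /\
       forall tau, V tau -> exists Lim, NLimit E (dE 1%nat) tau lam Lim /\ Lim < rho)
  /\
  (exists Res : (R -> R) -> Prop,
     ResidualCr r Res /\
     forall tau, Res tau -> NLimit E (dE 1%nat) tau lam 1).
Proof.
  intros Hr Hl HD Hlift Hlam _ Hb.
  destruct (expanding_lift r l E dE lam Lam Hr Hl HD Hlift Hlam Hb) as (g & CE & HE).
  set (V := fun rho => @slow l (dE 1%nat) g lam r rho).
  assert (Hrate : forall tau, CrS1 r tau -> exists Lim, 1 <= Lim /\
    NLimit E (dE 1%nat) tau lam Lim /\ forall rho, 0 < rho -> V rho tau -> Lim < rho).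
  { intros tau Htau; destruct (CrS1_deriv r Hr tau Htau) as (d & Hd & D1 & C1 & P1 & _).
    destruct (growth_limit HE tau (d 1%nat) D1 C1 (proj2 Htau) P1) as (Lim & HL1 & HL & Hlow).
    exists Lim; split; [easy|]; split; [easy|].
    intros rho Hrho (_ & f & Rc & n & Hf & HRc & Hn & Hcnt).
    assert (Ef : f = d 1%nat)
      by (apply functional_extensionality; intro x; eapply uniqueness_limite; eauto); subst f.
    now apply (Hlow rho Rc n). }
  split.
  - intros rho Hrho; exists (V rho); split; [apply (slow_open HE r Hr)|].
    split; [now apply (slow_dense HE r Hr)|].
    intros tau Htau; destruct (Hrate tau (proj1 Htau)) as (Lim & _ & HL & Hlow).
    exists Lim; split; [easy|]; apply Hlow; [lra|easy].
  - exists (fun tau => CrS1 r tau /\ NLimit E (dE 1%nat) tau lam 1); split; [split|].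
    + now intros tau [H _].
    (* The thresholds decrease to 1, and every rate is at least 1, so a rate below all of them
       equals 1. *)
    + exists (fun n => V (1 + / (INR n + 1))).
      assert (Hpos : forall n, 0 < / (INR n + 1))
        by (intro n; apply Rinv_0_lt_compat; pose proof (pos_INR n); lra).
      split.
      * intro n; specialize (Hpos n); split; [apply (slow_open HE r Hr)|].
        apply (slow_dense HE r Hr); lra.
      * intros tau Htau Hall; split; [easy|].
        destruct (Hrate tau Htau) as (Lim & HL1 & HL & Hlow).
        enough (Lim = 1) by now subst Lim.
        apply Rle_antisym; [|easy]; apply le_epsilon; intros ep Hep.
        destruct (INR_unbounded (/ ep)) as [n Hn].
        assert (Hlt : Lim < 1 + / (INR n + 1)).
        { apply Hlow; [specialize (Hpos n); lra|apply Hall]. }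
        assert (Hiep : 0 < / ep) by now apply Rinv_0_lt_compat.
        assert (/ (INR n + 1) < ep); [|lra].
        rewrite <- (Rinv_inv ep); apply Rinv_lt_contravar; [|lra].
        apply Rmult_lt_0_compat; lra.
    + now intros tau [_ H].
Qed.
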